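(* Let $C \subset \mathbb{P}^2$ be a smooth projective plane curve of degree $d > 4$ over $\mathbb{C}$. Then any meromorphic function $f : C \to \mathbb{P}^1$ of degree $d$ can be realized as a linear projection; that is, there exist a point $p \in \mathbb{P}^2 \setminus C$ and an identification of the pencil of lines through $p$ with $\mathbb{P}^1$ such that $f$ equals the resulting linear projection $\pi_p : C \to \mathbb{P}^1$.
   Context: The base field is $\mathbb{C}$. Smooth curves are assumed irreducible. A meromorphic function of degree $d$ on a smooth projective curve $C$ is a surjective (hence finite) morphism $f : C \to \mathbb{P}^1$ of degree $d$. For a point $p \in \mathbb{P}^2 \setminus C$, identify $\mathbb{P}^1$ with the pencil of lines in $\mathbb{P}^2$ passing through $p$; the linear projection $\pi_p : C \to \mathbb{P}^1$ is the morphism sending $x \in C$ to the line through $p$ and $x$. It is a finite surjective morphism of degree $d = \deg C$. *)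

(* Defs.v *)
From HB Require Import structures.
From mathcomp Require Import all_boot all_order all_algebra.
From mathcomp Require Import mpoly.

Set Implicit Arguments.
Unset Strict Implicit.
Unset Printing Implicit Defensive.

Import GRing.Theory.
Local Open Scope ring_scope.

(* P^n(K) is the set of lines of K^(n+1). Algebraic sets, morphisms and
   rational functions are described by their K-points, hence K is algebraically
   closed throughout. *)
Definition proj_space (K : closedFieldType) (n : nat) : Type :=
  {L : {vspace 'rV[K]_n.+1} | \dim L == 1%N}.

(* Homogeneous coordinates of x, for an arbitrary choice of a nonzero vector on
   the line x. Polynomials are evaluated at points through [ev]: this is only
   meaningful for forms and up to a common scalar, and all the notions below
   apply it to forms only and are independent of the choice made by [vpick]. *)
Definition ev (K : closedFieldType) (n : nat) (P : {mpoly K[n.+1]})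
    (x : proj_space K n) : K :=
  P.@[vpick (val x) 0].

Definition zeros (K : closedFieldType) (n : nat) (P : {mpoly K[n.+1]}) :
    {pred proj_space K n} :=
  fun x => ev P x == 0.

Definition irreducible_mpoly (K : closedFieldType) (n : nat)
    (P : {mpoly K[n]}) : Prop :=
  [/\ P != 0, P \isn't a GRing.unit
    & forall G H : {mpoly K[n]}, P = G * H ->
        G \is a GRing.unit \/ H \is a GRing.unit].

(* F is an equation of a smooth (irreducible) plane curve of degree d, whose
   set of points is [zeros F]; smoothness is the Jacobian criterion. *)
Definition smooth_plane_curve (K : closedFieldType) (d : nat)
    (F : {mpoly K[3]}) : Prop :=
  [/\ F \is d.-homog, irreducible_mpoly F
    & forall x : proj_space K 2, x \in zeros F ->
        exists i : 'I_3, ev (F^`M(i)) x != 0].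

(* Maps on an algebraic set X of P^n are total functions on P^n of which only
   the restriction to X matters. The map f is a morphism to P^m if, around
   each point x of X, it is given by m+1 forms of the same degree. The
   complements of the zero sets of forms are a basis of the Zariski topology.
   The forms A_j have no common zero on the neighborhood, because the line
   f y is not 0. *)
Definition morphism_on (K : closedFieldType) (n m : nat)
    (X : {pred proj_space K n}) (f : proj_space K n -> proj_space K m) : Prop :=
  forall x, x \in X ->
  exists (e : nat) (H : {mpoly K[n.+1]})
         (k : nat) (A : 'I_m.+1 -> {mpoly K[n.+1]}),
    [/\ H \is e.-homog, ev H x != 0, forall j, A j \is k.-homog
      & forall y, y \in X -> ev H y != 0 ->
          val (f y) = <[\row_j ev (A j) y]>%VS].

(* P holds on a nonempty open subset of X. *)
Definition generically (K : closedFieldType) (n : nat)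
    (X : {pred proj_space K n}) (P : proj_space K n -> Prop) : Prop :=
  exists (e : nat) (H : {mpoly K[n.+1]}),
    [/\ H \is e.-homog, exists2 x, x \in X & ev H x != 0
      & forall x, x \in X -> ev H x != 0 -> P x].

(* For X irreducible, the function field K(X) is the set of all phi satisfying
   [rational_on X phi], with pointwise operations, modulo generic equality. *)
Definition rational_on (K : closedFieldType) (n : nat)
    (X : {pred proj_space K n}) (phi : proj_space K n -> K) : Prop :=
  exists (k : nat) (G H : {mpoly K[n.+1]}),
    [/\ G \is k.-homog, H \is k.-homog
      & generically X (fun x => ev H x != 0 /\ phi x = ev G x / ev H x)].

(* [has_degree X Y f N] states that [K(X) : f^* K(Y)] = N, for a dominant
   morphism f from X to Y: K(X) has a basis u of N elements over K(Y), where
   K(Y) acts on K(X) through f^* a = a \o f. *)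
Definition has_degree (K : closedFieldType) (n m : nat)
    (X : {pred proj_space K n}) (Y : {pred proj_space K m})
    (f : proj_space K n -> proj_space K m) (N : nat) : Prop :=
  exists u : 'I_N -> proj_space K n -> K,
    [/\ forall i, rational_on X (u i),
        forall a : 'I_N -> proj_space K m -> K,
          (forall i, rational_on Y (a i)) ->
          generically X (fun x => \sum_i a i (f x) * u i x = 0) ->
          forall i, generically Y (fun y => a i y = 0)
      & forall phi, rational_on X phi ->
          exists2 a : 'I_N -> proj_space K m -> K,
            forall i, rational_on Y (a i)
            & generically X (fun x => phi x = \sum_i a i (f x) * u i x)].

(* Surjective morphisms X -> P^1 of degree d. *)
Definition meromorphic_function (K : closedFieldType) (n : nat)
    (X : {pred proj_space K n}) (d : nat)
    (f : proj_space K n -> proj_space K 1) : Prop :=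
  [/\ morphism_on X f,
      forall q : proj_space K 1, exists2 x, x \in X & f x = q
    & has_degree X predT f d].

(* A line of P^2 is a plane of K^3. *)
Definition pencil (K : closedFieldType) (p : proj_space K 2) :
    {pred {vspace 'rV[K]_3}} :=
  fun M => (\dim M == 2%N) && (val p <= M)%VS.

(* The line through p and x, when x differs from p. *)
Definition linear_projection (K : closedFieldType) (p x : proj_space K 2) :
    {vspace 'rV[K]_3} :=
  (val p + val x)%VS.

(* The pencil of lines through p is the projective line of K^3 / p; it is
   identified with P^1 by a linear isomorphism from K^3 / p to K^2, that is by a
   linear map from K^3 to K^2 of kernel p. *)
Definition pencil_identification (K : closedFieldType) (p : proj_space K 2)
    (theta : {vspace 'rV[K]_3} -> proj_space K 1) : Prop :=
  exists2 l : 'Hom('rV[K]_3, 'rV[K]_2),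
    lker l = val p
    & forall M, M \in pencil p -> val (theta M) = (l @: M)%VS.

(* Main.v *)
(* A general fibre of f = (A0 : A1), cut out by N = A0 - t A1, consists of at most d
   points of C, and it is unramified because the characteristic is 0. Let G be
   a form of degree d - 3 vanishing at all of its points but q, and let l be a general
   line through q. By Noether's AF + BG theorem, G l A1 / N is induced on C by a form of
   degree d - 2; it vanishes at the d - 1 points of l and C other than q, hence
   on l, and this forces G(q) = 0. So the fibre satisfies the Cayley-Bacharach
   condition in degree d - 3, and since d <= 2(d - 3) + 1, it lies on a line
   {lambda = 0}. By AF + BG again, lambda A0 / N and lambda A1 / N are induced by linear
   forms M0 and M1, and f = (M0 : M1) is the projection from the point p where M0 and
   M1 vanish. If p were on C, then K(C) would have degree at most d - 1 over K(f). *)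

From HB Require Import structures.
From Stdlib Require Import Classical_Prop Classical_Pred_Type.
Require Import Defs.
From mathcomp Require Import all_boot all_order all_algebra.
From mathcomp Require Import reals.
From mathcomp Require Import complex.
From mathcomp Require Import mpoly.
From mathcomp Require Import ring zify.

Set Implicit Arguments.
Unset Strict Implicit.
Unset Printing Implicit Defensive.

Import GRing.Theory.
Local Open Scope ring_scope.

(** The forms A0 and A1 may have common zeros on C, so N = 0 cuts out base points besides the fibre,
    with no control on their multiplicity. The local hypothesis of Noether's theorem is therefore
    checked in two ways. At a point of the fibre, N is a local parameter, by the Jacobian of F and
    N, and divides every form vanishing there. At any other point, base points included, a second
    expression (B0 : B1) of f with A0 B1 = A1 B0 on C turns A1 / N into B1 / (B0 - t B1), whose
    denominator is nonzero. The function field enters through linear relations over K(f): a relation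
    between d + 1 forms of the same degree bounds the fibres and keeps f from having derivative
    zero, and a relation between d functions excludes p from C. Noether's theorem itself is reduced,
    by moving a point off C to (0 : 1 : 0), to polynomials monic in y over K[x], where Gauss's lemma
    and Bezout identities take the place of intersection theory. The condition d > 4 is exactly the
    inequality d <= 2(d - 3) + 1. *)

(** * Substitution, derivation and homogeneous components of polynomials *)

Lemma mpoly_alg_ind (n : nat) (A : comNzRingType) (Q : {mpoly A[n]} -> Prop) :
  (forall c, Q c%:MP) -> (forall i, Q 'X_i) ->
  (forall p q, Q p -> Q q -> Q (p + q)) ->
  (forall p q, Q p -> Q q -> Q (p * q)) -> forall p, Q p.
Proof.
move=> QC QX QD QM p.
have Q0 : Q 0 by rewrite -(mpolyC0 n A); apply: QC.
have Q1 : Q 1 by rewrite -(mpolyC1 n A); apply: QC.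
rewrite (mpolyE p); elim: (msupp p) => [|m s IH]; first by rewrite big_nil.
rewrite big_cons; apply: (QD) => //; rewrite -mul_mpolyC; apply: (QM) => //.
rewrite mpolyXE_id; apply: (big_ind Q) => [//||i _]; first exact: QM.
by elim: (m i) => [|k IHk]; rewrite ?expr0 // exprS; apply: QM.
Qed.

Definition msubst (n k : nat) (A : comNzRingType) (h : 'I_n -> {mpoly A[k]})
  (p : {mpoly A[n]}) : {mpoly A[k]} := mmap (@mpolyC k A) h p.

Section Msubst.
Variables (n k : nat) (A : comNzRingType) (h : 'I_n -> {mpoly A[k]}).

HB.instance Definition _ := GRing.RMorphism.copy (msubst h) (mmap (@mpolyC k A) h).

Lemma msubstC c : msubst h c%:MP = c%:MP.
Proof. exact: mmapC. Qed.

Lemma msubstX i : msubst h 'X_i = h i.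
Proof. by rewrite /msubst mmapX mmap1U. Qed.

Lemma msubst_meval (v : 'I_k -> A) p :
  (msubst h p).@[v] = p.@[fun i => (h i).@[v]].
Proof.
elim/mpoly_alg_ind: p => [c|i|p q Hp Hq|p q Hp Hq].
- by rewrite msubstC !mevalC.
- by rewrite msubstX mevalXU.
- by rewrite !rmorphD /= Hp Hq.
- by rewrite !rmorphM /= Hp Hq.
Qed.

Lemma msubst_homog d e p : (forall i, h i \is e.-homog) ->
  p \is d.-homog -> msubst h p \is (d * e).-homog.
Proof.
move=> hh /dhomogP hp; rewrite /msubst /mmap big_seq; apply: rpred_sum => m /hp /= <-.
rewrite mul_mpolyC; apply: rpredZ; rewrite /mmap1 mdegE.
rewrite big_distrl /=; elim/big_ind2: _ => //; first exact: dhomog1.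
  by move=> *; apply: dhomogM.
by move=> i _; rewrite mulnC; apply: dhomogMn.
Qed.

End Msubst.

(** Substitutions are ring morphisms, so they agree modulo the ideal of the differences on
    generators. Division by X_i - u and the decomposition of a form vanishing at a point both come
    from this. *)
Lemma msubst_diff (n k : nat) (A : comNzRingType) (h1 h2 : 'I_n -> {mpoly A[k]}) p :
  exists g : 'I_n -> {mpoly A[k]},
    msubst h1 p - msubst h2 p = \sum_i g i * (h1 i - h2 i).
Proof.
elim/mpoly_alg_ind: p => [c|i|p q [g Hg] [g' Hg']|p q [g Hg] [g' Hg']].
- by exists (fun=> 0); rewrite !msubstC subrr big1 // => i _; rewrite mul0r.
- exists (fun j => (j == i)%:R); rewrite !msubstX (bigD1 i) //= eqxx mul1r.
  by rewrite big1 ?addr0 // => j /negPf ->; rewrite mul0r.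
- exists (fun j => g j + g' j); under eq_bigr do rewrite mulrDl.
  by rewrite big_split /= -Hg -Hg' !rmorphD /=; ring.
- exists (fun j => g j * msubst h1 q + msubst h2 p * g' j).
  transitivity ((\sum_i g i * (h1 i - h2 i)) * msubst h1 q
     + msubst h2 p * (\sum_i g' i * (h1 i - h2 i))).
    by rewrite -Hg -Hg' !rmorphM /=; ring.
  rewrite mulr_suml mulr_sumr -big_split /=; apply: eq_bigr => i _; ring.
Qed.

Lemma msubst_id (n : nat) (A : comNzRingType) (p : {mpoly A[n]}) :
  msubst (fun i => 'X_i) p = p.
Proof.
elim/mpoly_alg_ind: p => [c|i|p q Hp Hq|p q Hp Hq].
- by rewrite msubstC.
- by rewrite msubstX.
- by rewrite !rmorphD /= Hp Hq.
- by rewrite !rmorphM /= Hp Hq.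
Qed.

Lemma meval_homogZ (n : nat) (A : comNzRingType) d (p : {mpoly A[n]}) c v w :
  p \is d.-homog -> (forall i, w i = c * v i) -> p.@[w] = c ^+ d * p.@[v].
Proof.
move=> /dhomogP hp hw; rewrite !mevalE big_distrr /= !big_seq.
apply: eq_bigr => m /hp /= <-; rewrite mulrCA; congr (_ * _).
rewrite mdegE -prodrXr -big_split /=; apply: eq_bigr => i _.
by rewrite hw exprMn.
Qed.

Lemma homog_euler (n : nat) (A : comNzRingType) d (p : {mpoly A[n]}) :
  p \is d.-homog -> \sum_i 'X_i * p^`M(i) = p *+ d.
Proof.
move=> /dhomogP hp; rewrite {2}(mpolyE p) -sumrMnl.
have E i : p^`M(i) = \sum_(m <- msupp p) p@_m *: ('X_[m])^`M(i).
  by rewrite {1}(mpolyE p) raddf_sum /=; apply: eq_bigr => m _; rewrite mderivZ.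
under eq_bigr => i _ do rewrite E mulr_sumr.
rewrite exchange_big /= !big_seq; apply: eq_bigr => m /hp /= <-.
rewrite mdegE -sumrMnr; apply: eq_bigr => i _.
rewrite -scalerAr mderivX -scalerAr; case: (posnP (m i)) => [->|mi].
  by rewrite scale0r scaler0 mulr0n.
have le : (U_(i) <= m)%MM by apply/mnm_lepP => j; rewrite mnm1E; case: eqP => // <-.
by rewrite -mpolyXD addmC submK // scaler_nat scalerMnr.
Qed.

Lemma mderiv_homog (n : nat) (A : comNzRingType) d (p : {mpoly A[n]}) i :
  p \is d.-homog -> p^`M(i) \is d.-1.-homog.
Proof.
move=> hp; apply/dhomogP => m /=; rewrite mcoeff_msupp mcoeff_deriv => nz.
have : p@_(m + U_(i)) != 0 by apply: contra nz => /eqP ->; rewrite mul0rn.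
by rewrite -mcoeff_msupp => /(dhomog_mf hp) /=; rewrite mdegD mdeg1 addn1 => <-.
Qed.

Lemma pihomogMl (n : nat) (A : comNzRingType) k d (p q : {mpoly A[n]}) :
  p \is k.-homog -> pihomog mdeg (k + d) (p * q) = p * pihomog mdeg d q.
Proof.
move=> hp; rewrite {1}(pihomog_partitionE (leqnn (mmeasure mdeg q))) mulr_sumr raddf_sum /=.
rewrite [in RHS](pihomog_partitionE (leqnn (mmeasure mdeg q))) raddf_sum mulr_sumr /=.
apply: eq_bigr => i _; have hi := dhomogM hp (pihomogP mdeg i q).
case: (eqVneq (i : nat) d) => [<-|ne].
  by rewrite pihomog_id pihomog_dE.
have H0 (a b : nat) (r : {mpoly A[n]}) : a != b -> r \is b.-homog -> pihomog mdeg a r = 0.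
  by move=> ab hr; apply: (pihomog_ne0 _ hr); rewrite eq_sym.
rewrite (H0 d _ _ _ (pihomogP mdeg i q)) 1?eq_sym // mulr0 (H0 _ _ _ _ hi) //.
by rewrite eqn_add2l eq_sym.
Qed.

Lemma homogX (A : comNzRingType) n (i : 'I_n) : 'X_i \is [in A[n], 1.-homog].
Proof. by rewrite dhomogX /= mdeg1. Qed.

Lemma homogXnM (A : comNzRingType) n (i : 'I_n) e N (p : {mpoly A[n]}) :
  p \is N.-homog -> 'X_i ^+ e * p \is (e + N).-homog.
Proof.
by move=> hp; apply: dhomogM => //; rewrite -{2}[e]mul1n; apply/dhomogMn/homogX.
Qed.

Lemma mderivXU (A : comNzRingType) n (i j : 'I_n) :
  ('X_i : {mpoly A[n]})^`M(j) = (i == j)%:R.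
Proof.
rewrite mderivX mnmE; case: eqP => [->|_]; last by rewrite scale0r.
rewrite scale1r (_ : (U_(j) - U_(j))%MM = 0%MM) ?mpolyX0 //.
by apply/mnmP => k; rewrite mnmBE subnn mnm0E.
Qed.

Lemma closed_field_notin (K : closedFieldType) (s : seq K) : exists a, a \notin s.
Proof.
have nz : \prod_(a <- s) ('X - a%:P) != 0.
  by rewrite prodf_seq_neq0; apply/allP => a _ /=; rewrite polyXsubC_eq0.
by have /closed_nonrootP[a] := nz; rewrite root_prod_XsubC; exists a.
Qed.

Lemma msubst_comp (n k l : nat) (A : comNzRingType) (h : 'I_n -> {mpoly A[k]})
    (g : 'I_k -> {mpoly A[l]}) p :
  msubst g (msubst h p) = msubst (fun i => msubst g (h i)) p.
Proof.
elim/mpoly_alg_ind: p => [c|i|p q Hp Hq|p q Hp Hq].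
- by rewrite !msubstC.
- by rewrite !msubstX.
- by rewrite !rmorphD /= Hp Hq.
- by rewrite !rmorphM /= Hp Hq.
Qed.

Lemma eq_msubst (n k : nat) (A : comNzRingType) (h g : 'I_n -> {mpoly A[k]}) p :
  h =1 g -> msubst h p = msubst g p.
Proof.
move=> hg; elim/mpoly_alg_ind: p => [c|i|p q Hp Hq|p q Hp Hq].
- by rewrite !msubstC.
- by rewrite !msubstX.
- by rewrite !rmorphD /= Hp Hq.
- by rewrite !rmorphM /= Hp Hq.
Qed.

Lemma msubst_subr1 (n : nat) (A : comNzRingType) (i : 'I_n) (u : {mpoly A[n]}) p :
  exists g, p = msubst (fun j => if j == i then u else 'X_j) p + g * ('X_i - u).
Proof.
have [g Hg] := msubst_diff (fun j => 'X_j) (fun j => if j == i then u else 'X_j) p.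
exists (g i); move: Hg; rewrite msubst_id => /eqP; rewrite subr_eq => /eqP {1}->.
rewrite addrC (bigD1 i) //= eqxx big1 ?addr0 // => j /negPf ->.
by rewrite subrr mulr0.
Qed.

(** * Points of nonvanishing, and division by a variable *)

Section Nonroot.
Variables (K : closedFieldType) (n : nat).
Implicit Types (p : {mpoly K[n]}) (i : 'I_n).

Local Notation sub1 i a := (msubst (fun j => if j == i then a%:MP else 'X_j)).

(** Each exceptional a splits off a factor X_i - a of p, which lowers the size of p, so there are
    finitely many. *)
Lemma msubst1_neq0 p i : p != 0 -> exists s : seq K, forall a, a \notin s -> sub1 i a p != 0.
Proof.
have [k] := ubnP (msize p); elim: k p => // k IH p lepk nzp.
have [[a pa0]|H] := classic (exists a, sub1 i a p = 0); last first.
  by exists [::] => a _; apply/eqP => pa; case: H; exists a.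
have [g] := msubst_subr1 i a%:MP p; rewrite pa0 add0r => Dp.
have nzg : g != 0 by apply: contra_neq nzp => g0; rewrite Dp g0 mul0r.
have sX : msize ('X_i - a%:MP_[n]) = 2.
  have cX : ('X_i - a%:MP_[n])@_U_(i) = 1.
    rewrite mcoeffB mcoeffX eqxx mcoeffC (_ : (U_(i) == 0)%MM = false) ?mulr0 ?subr0 //.
    by apply/eqP => /(congr1 mdeg); rewrite mdeg0 mdeg1.
  apply/eqP; rewrite eqn_leq; apply/andP; split.
    apply: (leq_trans (mmeasureD_le _ _ _)); rewrite geq_max mmeasureN msizeX mdeg1.
    by rewrite mmeasureC; case: eqP.
  have -> : 2 = (mdeg (U_(i)%MM : 'X_{1..n})).+1 by rewrite mdeg1.
  by apply: msize_mdeg_lt; rewrite mcoeff_msupp cX oner_eq0.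
have nzX : 'X_i - a%:MP_[n] != 0 by rewrite -msize_poly_eq0 sX.
have [|s Hs] := IH g _ nzg.
  by move: lepk; rewrite Dp msizeM // sX addn2.
exists (a :: s) => b; rewrite inE negb_or => /andP[ba bs].
rewrite Dp rmorphM mulf_neq0 ?Hs // rmorphB /= msubstX msubstC eqxx -mpolyCB.
by rewrite mpolyC_eq0 subr_eq0.
Qed.

Lemma mpoly_nonroot p : p != 0 -> exists v : 'I_n -> K, p.@[v] != 0.
Proof.
move=> nzp.
have H (s : seq 'I_n) : exists c : 'I_n -> K,
    msubst (fun j => if j \in s then (c j)%:MP else 'X_j) p != 0.
  elim: s => [|i s [c Hc]]; first by exists (fun=> 0); rewrite /= msubst_id.
  have [t Ht] := msubst1_neq0 i Hc; have [a /Ht Ha] := closed_field_notin t.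
  exists (fun j => if j \in s then c j else a); move: Ha; rewrite msubst_comp.
  apply: contraNneq => <-; apply/eqP/eq_msubst => j; rewrite inE.
  case: ifP => js; first by rewrite orbT msubstC.
  by rewrite orbF msubstX; case: eqP.
have [c] := H (enum 'I_n); rewrite (@eq_msubst _ _ _ _ (fun j => (c j)%:MP)); last first.
  by move=> j; rewrite mem_enum.
move=> nz; exists c; apply: contraNneq nz => pc0; apply/eqP/mpolyP => m.
have -> : msubst (fun j => (c j)%:MP) p = (p.@[c])%:MP_[n].
  elim/mpoly_alg_ind: (p) => [b|i|q r Hq Hr|q r Hq Hr].
  - by rewrite msubstC mevalC.
  - by rewrite msubstX mevalXU.
  - by rewrite !rmorphD /= Hq Hr.
  - by rewrite !rmorphM /= Hq Hr.
by rewrite pc0.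
Qed.

Lemma mpoly_ext p q : (forall v, p.@[v] = q.@[v]) -> p = q.
Proof.
move=> H; apply/eqP; rewrite -subr_eq0; apply: contraT => /mpoly_nonroot[v].
by rewrite mevalB H subrr eqxx.
Qed.

End Nonroot.

Lemma mpolyX_neq0 (K : closedFieldType) n (i : 'I_n) : 'X_i != 0 :> {mpoly K[n]}.
Proof. by rewrite -msize_poly_eq0 msizeX. Qed.

Definition msub0 (A : comNzRingType) n (i : 'I_n) : {mpoly A[n]} -> {mpoly A[n]} :=
  msubst (fun j => if j == i then 0 else 'X_j).
HB.instance Definition _ (A : comNzRingType) n (i : 'I_n) :=
  GRing.RMorphism.copy (@msub0 A n i) (msubst (fun j => if j == i then 0 else 'X_j)).

Lemma msub0X (A : comNzRingType) n (i j : 'I_n) :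
  msub0 i 'X_j = (if j == i then 0 else 'X_j) :> {mpoly A[n]}.
Proof. exact: msubstX. Qed.

Lemma mpoly_dvdX (K : closedFieldType) n (i : 'I_n) (p : {mpoly K[n]}) :
  msub0 i p = 0 -> exists q, p = 'X_i * q.
Proof.
by have [g] := msubst_subr1 i 0 p => Dp p0; exists g; rewrite Dp [msubst _ p]p0 add0r subr0 mulrC.
Qed.

Lemma mpolyX_expM (K : closedFieldType) n (i : 'I_n) e (F P Q : {mpoly K[n]}) :
  'X_i ^+ e * F = P * Q -> exists a b P' Q',
    [/\ P = 'X_i ^+ a * P', Q = 'X_i ^+ b * Q' & F = P' * Q'].
Proof.
elim: e P Q => [|e IH] P Q; first by rewrite mul1r => ->; exists 0%N, 0%N, P, Q; rewrite !mul1r.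
move=> H; have : msub0 i (P * Q) = 0.
  by rewrite -H !rmorphM rmorphXn /= msub0X eqxx expr0n mul0r.
rewrite rmorphM => /eqP; rewrite mulf_eq0 => /orP[] /eqP /mpoly_dvdX[R DR].
  have [|a [b [P' [Q' [E1 E2 ->]]]]] := IH R Q.
    by apply: (mulfI (mpolyX_neq0 K i)); rewrite !mulrA -exprS H DR.
  by exists a.+1, b, P', Q'; split=> //; rewrite DR ?E1 ?E2 exprS mulrA.
have [|a [b [P' [Q' [E1 E2 ->]]]]] := IH P R.
  by apply: (mulfI (mpolyX_neq0 K i)); rewrite mulrA -exprS H DR; ring.
by exists a, b.+1, P', Q'; split=> //; rewrite DR ?E1 ?E2 exprS mulrA.
Qed.

Lemma mpolyX_expK (K : closedFieldType) n (i : 'I_n) e (F G Q : {mpoly K[n]}) :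
  msub0 i F != 0 ->
  'X_i ^+ e * G = Q * F -> exists Q', Q = 'X_i ^+ e * Q' /\ G = Q' * F.
Proof.
move=> nzF; elim: e Q => [|e IH] Q; first by rewrite mul1r => ->; exists Q; rewrite mul1r.
move=> H; have [R DR] : exists R, Q = 'X_i * R.
  apply: mpoly_dvdX; apply: (mulIf nzF); rewrite mul0r -rmorphM -H !rmorphM rmorphXn /=.
  by rewrite msub0X eqxx expr0n mul0r.
have [|Q' [DR' ->]] := IH R.
  by apply: (mulfI (mpolyX_neq0 K i)); rewrite mulrA -exprS H DR; ring.
by exists Q'; rewrite DR DR' exprS mulrA.
Qed.

Lemma ord3_cases (i k j : 'I_3) : i != 1 -> k != 1 -> i != k -> [|| j == i, j == 1 | j == k].
Proof.
by case: i => -[|[|[|//]]] ?; case: k => -[|[|[|//]]] ?; case: j => -[|[|[|//]]] ?.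
Qed.

(** * Ternary forms as polynomials in y *)

Section LeadCoef.
Variables (K : closedFieldType) (A : idomainType) (f : {rmorphism K -> A}).
Variable (h : 'I_3 -> A).

(** The variable y = X_1 is kept and the other two are sent to A. The ring A is K[x] for
    dehomogenization, and K for restriction to a line through (0 : 1 : 0). *)
Definition ypoly : {mpoly K[3]} -> {poly A} :=
  mmap (polyC \o f) (fun j : 'I_3 => if j == 1 then 'X else (h j)%:P).
HB.instance Definition _ := GRing.RMorphism.copy ypoly
  (mmap (polyC \o f) (fun j : 'I_3 => if j == 1 then 'X else (h j)%:P)).

Variables (d : nat) (F : {mpoly K[3]}).
Hypothesis Fhom : F \is d.-homog.

Let Y (m : 'X_{1..3}) : mmap1 (fun j : 'I_3 => if j == 1 then 'X else (h j)%:P) m =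
  (h 0 ^+ m 0 * h ord_max ^+ m ord_max) *: 'X ^+ m 1.
Proof.
rewrite /mmap1 3!big_ord_recl big_ord0 mulr1 /=.
have -> : lift ord0 ord0 = 1 :> 'I_3 by apply/val_inj.
have -> : lift ord0 (lift ord0 ord0) = ord_max :> 'I_3 by apply/val_inj.
by rewrite -mul_polyC rmorphM !rmorphXn /= -[ord0]/(0 : 'I_3); ring.
Qed.

Lemma ypolyC c : ypoly c%:MP = (f c)%:P.
Proof. by rewrite /ypoly mmapC. Qed.

Lemma ypolyX i : ypoly 'X_i = if i == 1 then 'X else (h i)%:P.
Proof. by rewrite /ypoly mmapX mmap1U. Qed.

Lemma size_ypoly : (size (ypoly F) <= d.+1)%N.
Proof.
rewrite /ypoly /mmap big_seq; apply: (leq_trans (size_sum _ _ _)); apply/bigmax_leqP_seq => m mF _.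
rewrite Y /= mul_polyC; do 2 apply: (leq_trans (size_scale_leq _ _)).
rewrite size_polyXn ltnS -(dhomog_mf Fhom mF) /= mdegE.
by rewrite (bigD1 1) //= leq_addr.
Qed.

Lemma coef_ypoly : (ypoly F)`_d = f F.@[fun j => (j == 1)%:R].
Proof.
rewrite /ypoly /mmap mevalE rmorph_sum coef_sum; rewrite !big_seq; apply: eq_bigr => m mF.
rewrite Y /= mul_polyC !coefZ coefXn rmorphM /=; congr (_ * _).
rewrite 3!big_ord_recl big_ord0 mulr1 /=.
have -> : lift ord0 ord0 = 1 :> 'I_3 by apply/val_inj.
have -> : lift ord0 (lift ord0 ord0) = ord_max :> 'I_3 by apply/val_inj.
have /= := dhomog_mf Fhom mF; rewrite mdegE 3!big_ord_recl big_ord0 /=.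
have -> : lift ord0 ord0 = 1 :> 'I_3 by apply/val_inj.
have -> : lift ord0 (lift ord0 ord0) = ord_max :> 'I_3 by apply/val_inj.
have -> : ord0 = 0 :> 'I_3 by [].
rewrite addn0 expr1n mul1r !expr0n => <-.
rewrite addnCA -{2}[m 1]addn0 eqn_add2l addn_eq0.
case: eqP => [->|_] /=; last by rewrite mulr0 mul0r rmorph0.
by case: eqP => [->|_] /=; rewrite ?mulr0 ?mul0r ?rmorph0 // !mulr1 rmorph1.
Qed.

Hypothesis F1 : F.@[fun j => (j == 1)%:R] != 0.

Lemma size_ypoly_eq : size (ypoly F) = d.+1.
Proof.
apply/eqP; rewrite eqn_leq size_ypoly ltnNge; apply: contra F1 => le.
by rewrite -(fmorph_eq0 f) -coef_ypoly nth_default.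
Qed.

Lemma lead_coef_ypoly : lead_coef (ypoly F) = f F.@[fun j => (j == 1)%:R].
Proof. by rewrite lead_coefE size_ypoly_eq coef_ypoly. Qed.

End LeadCoef.

(** * Dehomogenization to K[x][y] *)

Definition dehom (K : closedFieldType) : {mpoly K[3]} -> {poly {poly K}} :=
  ypoly (@polyC K) (fun j => if j == 0 then 'X else 1).
HB.instance Definition _ (K : closedFieldType) :=
  GRing.RMorphism.copy (@dehom K) (ypoly (@polyC K) (fun j => if j == 0 then 'X else 1)).

Section Dehom.
Variable K : closedFieldType.
Implicit Types (P Q : {mpoly K[3]}) (p q : {poly {poly K}}).

Definition pt3 (a b c : K) : 'I_3 -> K := fun j => if j == 0 then a else if j == 1 then b else c.

Lemma dehomC c : dehom c%:MP = c%:P%:P :> {poly {poly K}}.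
Proof. exact: ypolyC. Qed.

Lemma dehomX i : dehom 'X_i = if i == 1 then 'X else if i == 0 then 'X%:P else 1 :> {poly {poly K}}.
Proof.
rewrite [LHS](@ypolyX K _ _ _ i); case: ifP => // _; by case: ifP.
Qed.

Lemma dehomB P Q : dehom (P - Q) = dehom P - dehom Q.
Proof. exact: rmorphB. Qed.

Lemma dehomM P Q : dehom (P * Q) = dehom P * dehom Q.
Proof. exact: rmorphM. Qed.

Lemma dehom_linear a : dehom ('X_0 - a *: 'X_ord_max) = ('X - a%:P)%:P :> {poly {poly K}}.
Proof.
by rewrite dehomB -mul_mpolyC dehomM dehomC !dehomX /= mulr1 polyCB.
Qed.

Lemma dehom_meval P a b : (dehom P).[b%:P].[a] = P.@[pt3 a b 1].
Proof.
elim/mpoly_alg_ind: P => [c|i|p q Hp Hq|p q Hp Hq].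
- by rewrite dehomC mevalC !hornerC.
- rewrite dehomX mevalXU /pt3.
  case: i => -[|[|[|//]]] i /=; rewrite ?hornerX ?hornerC ?hornerX ?hornerE //.
- by rewrite !rmorphD /= !hornerD Hp Hq.
- by rewrite !rmorphM /= !hornerM Hp Hq.
Qed.

Lemma dehom_inj N P Q : P \is N.-homog -> Q \is N.-homog -> dehom P = dehom Q -> P = Q.
Proof.
move=> hP hQ /eqP; rewrite -subr_eq0 -rmorphB => /eqP.
have : P - Q \is N.-homog by rewrite rpredB.
move: (P - Q) (@subr0_eq _ P Q) => R H hR R0; apply: H.
(* The factor z settles the points with z = 0; at the others, homogeneity reduces to z = 1. *)
apply: (mulfI (mpolyX_neq0 K (ord_max : 'I_3))); rewrite mulr0; apply: mpoly_ext => v.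
rewrite mevalM meval0 mevalXU; have [->|nz] := eqVneq (v ord_max) 0; first by rewrite mul0r.
rewrite (@meval_homogZ _ _ _ _ (v ord_max) (pt3 (v 0 / v ord_max) (v 1 / v ord_max) 1) v hR).
  by rewrite -dehom_meval R0 !horner0 !mulr0.
case => -[|[|[|//]]] j; rewrite /pt3 /= ?mulr1 ?(mulrC (v ord_max)) ?divfK //; congr v; exact/val_inj.
Qed.

Lemma dehomXnM M P : dehom ('X_ord_max ^+ M * P) = dehom P.
Proof. by rewrite rmorphM rmorphXn /= dehomX /= expr1n mul1r. Qed.

Lemma dehom_rep p : exists N P, P \is N.-homog /\ dehom P = p.
Proof.
have repD q r : (exists N P, P \is N.-homog /\ dehom P = q) ->
    (exists N P, P \is N.-homog /\ dehom P = r) ->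
    exists N P, P \is N.-homog /\ dehom P = q + r.
  move=> [N [P [hP <-]]] [M [Q [hQ <-]]].
  exists (M + N)%N, ('X_ord_max ^+ M * P + 'X_ord_max ^+ N * Q); split.
    by apply: rpredD; rewrite ?homogXnM // addnC homogXnM.
  by rewrite rmorphD /= !dehomXnM.
have repX q i : (exists N P, P \is N.-homog /\ dehom P = q) ->
    exists N P, P \is N.-homog /\ dehom P = q * dehom 'X_i.
  move=> [N [P [hP <-]]]; exists (N + 1)%N, (P * 'X_i).
  by rewrite rmorphM /=; split=> //; apply: dhomogM (homogX _ _).
elim/poly_ind: p => [|p c IH].
  by exists 0%N, 0; rewrite rmorph0 rpred0.
apply: (repD); first by have := repX _ 1 IH; rewrite dehomX.
elim/poly_ind: c => [|c a IHc].
  by exists 0%N, 0; rewrite rmorph0 rpred0.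
rewrite polyCD polyCM; apply: (repD); first by have := repX _ 0 IHc; rewrite dehomX.
by exists 0%N, a%:MP; rewrite dehomC; split=> //; apply/dhomogP => m; rewrite msuppC; case: eqP => // _; rewrite inE => /eqP ->; rewrite /= mdeg0.
Qed.

End Dehom.

(** * Gauss's lemma in K[x][y] *)

Section Gauss.
Variable K : closedFieldType.
Implicit Types (p q g : {poly {poly K}}) (c : {poly K}).

Lemma polyXsubC_dvd_coef q a : map_poly (horner_eval a) q = 0 ->
  exists q', q = ('X - a%:P) *: q'.
Proof.
move=> q0; exists (map_poly (fun c => c %/ ('X - a%:P)) q); apply/polyP => j.
rewrite coefZ coef_map_id0 ?div0p // mulrC divpK // dvdp_XsubCl.
by rewrite /root -[_.[a]]/(horner_eval a _) -coef_map q0 coef0.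
Qed.

(* A root [a] of [c] is removed at each step: modulo x - a the product q g
   vanishes in the domain K[y], so that x - a divides q or g. *)
Lemma Gauss_content c p q g : c != 0 -> c *: p = q * g ->
  exists q' g' e, p = q' * g' /\ g = e *: g'.
Proof.
have [n] := ubnP (size c); elim: n c q g => // n IH c q g lecn nzc H.
have [/eqP/size_poly1P[k nzk Dc]|/closed_rootP[a]] := eqVneq (size c) 1.
  exists (k^-1%:P *: q), g, 1; rewrite scale1r -scalerAl -H Dc scalerA -polyCM.
  by rewrite mulVf // scale1r.
rewrite -dvdp_XsubCl => /dvdpP[c' Dc].
have nzX := polyXsubC_eq0 a.
have nzc' : c' != 0 by apply: contraNneq nzc => c0; rewrite Dc c0 mul0r.
have ltc' : (size c' < n)%N.
  by move: lecn; rewrite Dc size_Mmonic ?monicXsubC // size_XsubC addn2.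
have inj r1 r2 : ('X - a%:P) *: r1 = ('X - a%:P) *: r2 -> r1 = r2 :> {poly {poly K}}.
  by rewrite -!mul_polyC => /mulfI; apply; rewrite polyC_eq0 nzX.
have : map_poly (horner_eval a) q * map_poly (horner_eval a) g = 0.
  rewrite -rmorphM -H; apply/polyP => j; rewrite coef_map coefZ Dc /= /horner_eval !hornerM.
  by rewrite hornerXsubC subrr mulr0 mul0r coef0.
move/eqP; rewrite mulf_eq0 => /orP[] /eqP /polyXsubC_dvd_coef[r Dr].
  apply: (IH c' r g) => //; apply: inj.
  by rewrite scalerA mulrC -Dc H Dr scalerAl.
have [|q' [g' [e [-> Dg]]]] := IH c' q r ltc' nzc'.
  by apply: inj; rewrite scalerA mulrC -Dc H Dr scalerAr.
by exists q', g', (('X - a%:P) * e); rewrite Dr Dg scalerA.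
Qed.

Variables (p : {poly {poly K}}) (c : K).
Hypotheses (c0 : c != 0) (lp : lead_coef p = c%:P) (p1 : (1 < size p)%N).
Hypothesis irr : forall q g, p = q * g ->
  (exists2 k : K, k != 0 & q = k%:P%:P) \/ (exists2 k : K, k != 0 & g = k%:P%:P).

Let up : lead_coef p \in GRing.unit.
Proof. by rewrite lp poly_unitE size_polyC c0 coefC eqxx unitfE c0. Qed.

(** Over K[x], [%|] is divisibility up to a nonzero factor in K[x]; the constant leading coefficient
    of p turns it into true divisibility. *)
Lemma irr_dvdpP q : reflect (exists r, q = r * p) (p %| q).
Proof. exact: Pdiv.IdomainUnit.dvdpP. Qed.

(** A gcd of positive degree in y, freed from its content by [Gauss_content], is a true factor of p,
    hence equal to p up to a constant. *)
Lemma irr_coprimep q : ~~ (p %| q) -> coprimep p q.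
Proof.
apply: contraR; rewrite coprimep_def => ng1.
have nzp : p != 0 by rewrite -size_poly_gt0 ltnW.
have nzg : gcdp p q != 0 by rewrite gcdp_eq0 negb_and nzp.
have gt1 : (1 < size (gcdp p q))%N.
  by rewrite ltn_neqAle eq_sym ng1 size_poly_gt0.
have /Pdiv.WeakIdomain.dvdpP[[a r] /= nza Da] := dvdp_gcdl p q.
have [q' [g' [e [Dp Dg]]]] := Gauss_content nza Da.
apply: dvdp_trans (dvdp_gcdr p q).
have [[k nzk Dq']|[k nzk Dg']] := irr Dp; last first.
  by move: gt1; rewrite Dg Dg' -mul_polyC -polyCM ltnNge size_polyC_leq1.
rewrite Dg; apply: (dvdp_trans _ (_ : g' %| _)); last by rewrite -mul_polyC dvdp_mulIr.
by rewrite Dp Dq' mul_polyC dvdpZl // polyC_eq0.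
Qed.

Lemma irr_prime q r : p %| q * r -> (p %| q) || (p %| r).
Proof.
by case: (boolP (p %| q)) => // /irr_coprimep cop; rewrite Gauss_dvdpr.
Qed.

(** Here c, a polynomial in x alone, plays the part of the resultant of p and q with respect to
    y. *)
Lemma irr_Bezout q : ~~ (p %| q) -> exists c u w, c != 0 /\ c%:P = u * p + w * q.
Proof.
move=> /irr_coprimep /Bezout_coprimepP[[u w]] /=.
rewrite -size_poly_eq1 => /size_poly1P[b nzb Db].
by exists b, u, w.
Qed.

End Gauss.

Lemma mpoly_unitP (K : fieldType) n (p : {mpoly K[n]}) :
  reflect (exists2 c, c != 0 & p = c%:MP) (p \is a GRing.unit).
Proof.
apply: (iffP idP) => [|[c nzc ->]].
  rewrite qualifE /= => /andP[/eqP Dp]; rewrite unitfE => nz; exists p@_0 => //.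
by apply/andP; rewrite mcoeffC eqxx mulr1 unitfE.
Qed.

Lemma homog0_const (A : comNzRingType) n (p : {mpoly A[n]}) :
  p \is 0.-homog -> p = (p@_0)%:MP.
Proof.
move=> hp; apply/mpolyP => m; rewrite mcoeffC.
have [->|nz] := eqVneq m 0%MM; first by rewrite mulr1.
by rewrite mulr0; apply: (dhomog_nemf_coeff hp); rewrite /= mdeg_eq0.
Qed.

Lemma homog_size (A : comNzRingType) n N (p : {mpoly A[n]}) :
  p != 0 -> p \is N.-homog -> msize p = N.+1.
Proof.
move=> nz /dhomogP hp; rewrite -mlead_deg // -[RHS]/(N.+1); congr _.+1.
by apply: hp; apply: mlead_supp.
Qed.

(** * Plane curves in coordinates *)

(* The point (0 : 1 : 0) is off the curve: up to a constant, F is monic of degree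
   d in y = 'X_1. The coordinates are x = 'X_0 and z = 'X_ord_max, and [dehom]
   sets z = 1. *)
Section MonicCurve.
Variables (K : closedFieldType) (d : nat) (F : {mpoly K[3]}).
Hypotheses (Fhom : F \is d.-homog) (Firr : irreducible_mpoly F).
Hypothesis F1 : F.@[fun j => (j == 1)%:R] != 0.

Lemma irr_neq0 : F != 0. Proof. by case: Firr. Qed.

Lemma irr_deg_gt0 : (0 < d)%N.
Proof.
rewrite lt0n; apply/negP => /eqP d0; case: Firr => nz nu _; case/negP: nu.
move: Fhom; rewrite d0 => /homog0_const DF; apply/mpoly_unitP; exists F@_0 => //.
by apply: contraNneq nz => F00; rewrite DF F00.
Qed.

Let p := dehom F.

Let sp : size p = d.+1. Proof. exact: (size_ypoly_eq _ _ Fhom F1). Qed.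
Let lp : lead_coef p = (F.@[fun j => (j == 1)%:R])%:P. Proof. exact: (lead_coef_ypoly _ _ Fhom F1). Qed.
Let p1 : (1 < size p)%N. Proof. by rewrite sp ltnS irr_deg_gt0. Qed.

Lemma monic_msub0 (i : 'I_3) : i != 1 -> msub0 i F != 0.
Proof.
move=> i1; apply: contraNneq F1 => F0; have := congr1 (meval (fun j => (j == 1)%:R)) F0.
rewrite meval0 msubst_meval => H; rewrite -[X in _ == X]H; apply/eqP/meval_eq => j.
case: (eqVneq j i) => [->|_]; first by rewrite (negPf i1) meval0.
by rewrite mevalXU.
Qed.

Let pirr q g : p = q * g ->
  (exists2 k : K, k != 0 & q = k%:P%:P) \/ (exists2 k : K, k != 0 & g = k%:P%:P).
Proof.
move=> Dp; have [N [P [hP DP]]] := dehom_rep q; have [M [Q [hQ DQ]]] := dehom_rep g.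
(* Powers of z give both sides the degree N + M + d, so that they are equal as soon as their
   dehomogenizations are. *)
have H : 'X_ord_max ^+ (N + M) * F = ('X_ord_max ^+ d * P) * Q.
  apply: (@dehom_inj _ (N + M + d)%N); first exact: homogXnM.
    by rewrite addnC addnA; apply: dhomogM => //; apply: homogXnM.
  by rewrite dehomXnM rmorphM /= dehomXnM DP DQ.
have [a [b [P' [Q' [DP' DQ' DF]]]]] := mpolyX_expM H.
case: Firr => _ _ /(_ _ _ DF) [] /mpoly_unitP[k nzk Dk]; [left|right]; exists k => //.
  by rewrite -DP -(dehomXnM d) DP' dehomXnM Dk dehomC.
by rewrite -DQ DQ' dehomXnM Dk dehomC.
Qed.

(** The quotient in K[x][y] lifts to a form up to powers of z, and these cancel because z does not
    divide F. *)
Lemma dehom_dvd N G : G \is N.-homog -> p %| dehom G -> exists Q, G = Q * F.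
Proof.
move=> hG /(irr_dvdpP F1 lp)[r Dr].
have [M [Q [hQ DQ]]] := dehom_rep r.
have H : 'X_ord_max ^+ (M + d) * G = ('X_ord_max ^+ N * Q) * F.
  apply: (@dehom_inj _ (M + d + N)%N); first exact: homogXnM.
    by rewrite addnC addnA; apply: dhomogM => //; apply: homogXnM.
  by rewrite dehomXnM rmorphM /= dehomXnM DQ Dr.
have nz : msub0 ord_max F != 0 by apply: monic_msub0.
by have [Q' [_ ->]] := mpolyX_expK nz H; exists Q'.
Qed.

Lemma monic_prime N M B X : B \is N.-homog -> X \is M.-homog ->
  (exists Q, B * X = Q * F) -> (exists Q, B = Q * F) \/ (exists Q, X = Q * F).
Proof.
move=> hB hX [Q H].
have : p %| dehom B * dehom X by rewrite -rmorphM H rmorphM dvdp_mull.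
by case/(irr_prime p1 pirr)/orP => /dehom_dvd E; [left|right]; apply: E; eassumption.
Qed.

Lemma monic_Bezout N G : G \is N.-homog -> ~ (exists Q, G = Q * F) ->
  exists r u w, r != 0 /\ r%:P = u * p + w * dehom G.
Proof.
move=> hG nd; apply: (irr_Bezout p1 pirr).
by apply/negP => /(dehom_dvd hG).
Qed.

(** The polynomial in x given by [monic_Bezout] splits over K; homogenized, it is a product of lines
    through (0 : 1 : 0) that contains all common zeros of F and G. *)
Lemma monic_factors N G : G \is N.-homog -> ~ (exists Q, G = Q * F) ->
  exists e (rs : seq K) U W,
    'X_ord_max ^+ e * \prod_(a <- rs) ('X_0 - a *: 'X_ord_max) = U * F + W * G.
Proof.
move=> hG /(monic_Bezout hG)[r [u [w [nzr Dr]]]].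
have [rs Drs] := closed_field_poly_normal r.
set c := lead_coef r in Drs; have nzc : c != 0 by rewrite lead_coef_eq0.
have [a [U [hU DU]]] := dehom_rep (c^-1%:P *: u).
have [b [W [hW DW]]] := dehom_rep (c^-1%:P *: w).
pose P := \prod_(a <- rs) ('X_0 - a *: 'X_ord_max : {mpoly K[3]}).
have hP : P \is (size rs).-homog.
  rewrite /P; elim: rs {Drs P} => [|x rs IH]; first by rewrite big_nil dhomog1.
  rewrite big_cons -[size _]/(1 + size rs)%N; apply: dhomogM => //.
  by apply: rpredB; rewrite ?rpredZ ?homogX.
have DP : dehom P = (c^-1 *: r)%:P.
  rewrite Drs scalerA mulVf // scale1r /P rmorph_prod [in RHS]rmorph_prod /=.
  by apply: eq_bigr => x _; rewrite dehom_linear.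
exists (a + d + b + N)%N, rs, ('X_ord_max ^+ (size rs + b + N) * U), ('X_ord_max ^+ (size rs + a + d) * W).
rewrite -/P -!mulrA; apply: (@dehom_inj _ (a + d + b + N + size rs)%N).
- exact: homogXnM.
- apply: rpredD.
    rewrite (_ : (a + d + b + N + _ = size rs + b + N + (a + d))%N); last by ring.
    by apply: homogXnM; apply: dhomogM.
  rewrite (_ : (a + d + b + N + _ = size rs + a + d + (b + N))%N); last by ring.
  by apply: homogXnM; apply: dhomogM.
rewrite rmorphD /= !dehomXnM !rmorphM /= DP DU DW -/p -!scalerAl.
by rewrite -scalerDr -Dr -!mul_polyC -polyCM mul_polyC.
Qed.

Lemma ypoly_horner (h : 'I_3 -> K) P t :
  (ypoly idfun h P).[t] = P.@[fun j => if j == 1 then t else h j].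
Proof.
elim/mpoly_alg_ind: P => [c|i|q r Hq Hr|q r Hq Hr].
- by rewrite ypolyC mevalC hornerC.
- by rewrite ypolyX mevalXU; case: ifP; rewrite ?hornerX ?hornerC.
- by rewrite !rmorphD /= !hornerD Hq Hr.
- by rewrite !rmorphM /= !hornerM Hq Hr.
Qed.

Lemma ypoly_factor (h : 'I_3 -> K) : exists2 rs : seq K, size rs = d &
  forall t, F.@[fun j => if j == 1 then t else h j] =
    F.@[fun j => (j == 1)%:R] * \prod_(a <- rs) (t - a).
Proof.
have sq := size_ypoly_eq idfun h Fhom F1; have lq := lead_coef_ypoly idfun h Fhom F1.
have [rs Drs] := closed_field_poly_normal (ypoly idfun h F).
exists rs.
  by move: sq; rewrite Drs lq /= size_scale // size_prod_XsubC => -[].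
move=> t; rewrite -ypoly_horner Drs lq /= hornerZ horner_prod; congr (_ * _).
by apply: eq_bigr => a _; rewrite hornerXsubC.
Qed.

Lemma meval_row n (f : 'I_n -> K) (P : {mpoly K[n]}) : P.@[(\row_j f j) 0] = P.@[f].
Proof. by apply: meval_eq => j; rewrite mxE. Qed.

(** If F did not divide G, let r in K[x] come from [monic_Bezout] and take a with r(a) nonzero. The
    line x = a z meets the curve, F being monic of positive degree in y, and the Bezout identity at
    such a point gives r(a) = 0. *)
Lemma monic_Null N G : G \is N.-homog ->
  (forall v : 'rV[K]_3, v != 0 -> F.@[v 0] = 0 -> G.@[v 0] = 0) -> exists Q, G = Q * F.
Proof.
move=> hG H; have [//|nd] := classic (exists Q, G = Q * F).
have [r [u [w [nzr Dr]]]] := monic_Bezout hG nd.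
have [a nra] := closed_nonrootP _ nzr; case/negP: nra.
have [rs srs Drs] := ypoly_factor (pt3 a 0 1).
case: rs srs Drs => [srs|b rs _ Drs]; first by move: irr_deg_gt0; rewrite -srs.
have E P : P.@[pt3 a b 1] = P.@[fun j : 'I_3 => if j == 1 then b else pt3 a 0 1 j].
  by apply: meval_eq => j; rewrite /pt3; have [->|] := eqVneq j 1.
have F0 : F.@[pt3 a b 1] = 0 by rewrite E Drs big_cons subrr mul0r mulr0.
have nz : \row_j pt3 a b 1 j != 0.
  by apply/eqP => /rowP /(_ ord_max); rewrite !mxE => /eqP; rewrite /pt3 /= oner_eq0.
have := H _ nz; rewrite !meval_row => /(_ F0) G0.
have := congr1 (fun q => q.[b%:P].[a]) Dr.
by rewrite !hornerE /= !dehom_meval F0 G0 !mulr0 addr0 /root => ->.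
Qed.

End MonicCurve.

Section MonicCurveIdeals.
Variables (K : closedFieldType) (d : nat) (F : {mpoly K[3]}).
Hypotheses (Fhom : F \is d.-homog) (Firr : irreducible_mpoly F).
Hypothesis F1 : F.@[fun j => (j == 1)%:R] != 0.
Implicit Types (P Q G : {mpoly K[3]}).

Let dgt0 : (0 < d)%N. Proof. exact: (irr_deg_gt0 Fhom Firr). Qed.

Lemma pt3_line (a b t : K) : pt3 a t b =1 (fun j => if j == 1 then t else pt3 a 0 b j).
Proof. by move=> j; rewrite /pt3; have [->|] := eqVneq j 1. Qed.

Lemma line_zeros (a b : K) : exists s : seq 'rV[K]_3,
  forall t, F.@[pt3 a t b] = 0 -> \row_j pt3 a t b j \in s.
Proof.
have [rs _ H] := ypoly_factor Fhom F1 (pt3 a 0 b).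
exists [seq \row_j pt3 a t b j | t <- rs] => t.
rewrite (meval_eq _ (@pt3_line a b t)) H => /eqP; rewrite mulf_eq0 (negPf F1) /=.
rewrite prodf_seq_eq0 => /hasP[c crs /=]; rewrite subr_eq0 => /eqP ->.
exact: map_f.
Qed.

Lemma row3P (u v : 'rV[K]_3) : u 0 0 = v 0 0 -> u 0 1 = v 0 1 -> u 0 ord_max = v 0 ord_max -> u = v.
Proof.
move=> H0 H1 H2; apply/rowP => -[[|[|[|//]]] j]; [move: H0|move: H1|move: H2];
  by congr (_ = _); congr (_ _ _); apply/val_inj.
Qed.

(** Common zeros lie on the line z = 0 or on one of the lines x = a z of [monic_factors]. Each of
    these passes through (0 : 1 : 0), which is off the curve, and so meets the curve in finitely
    many points. *)
Lemma monic_finite N G : G \is N.-homog -> ~ (exists Q, G = Q * F) ->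
  exists s : seq 'rV[K]_3, forall v : 'rV[K]_3, v != 0 -> F.@[v 0] = 0 -> G.@[v 0] = 0 ->
    exists2 w, w \in s & exists c, v = c *: w.
Proof.
move=> hG nd; have [e [rs [U [W H]]]] := monic_factors Fhom Firr F1 hG nd.
have [s0 Hs0] := line_zeros 1 0.
have [s1 Hs1] : exists s : seq 'rV[K]_3, forall a t, a \in rs ->
    F.@[pt3 a t 1] = 0 -> \row_j pt3 a t 1 j \in s.
  elim: rs {H} => [|a rs [s IH]]; first by exists [::].
  have [s' Hs'] := line_zeros a 1; exists (s' ++ s) => b t.
  rewrite inE mem_cat => /orP[/eqP ->|brs] Fb; first by rewrite Hs'.
  by rewrite (IH b) ?orbT.
exists (s0 ++ s1) => v nzv Fv Gv.
have [v2|v2] := eqVneq (v 0 ord_max) 0.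
  have nz0 : v 0 0 != 0.
    apply: contra_neq nzv => v0; apply: row3P; rewrite ?v2 ?v0 mxE //; apply/eqP.
    move/eqP: Fv; rewrite (@meval_homogZ _ _ _ _ (v 0 1) (fun j => (j == 1)%:R) _ Fhom).
      by rewrite mulf_eq0 (negPf F1) orbF expf_eq0 dgt0.
    move=> j; have [->|j1] := eqVneq j 1; first by rewrite mulr1.
    rewrite mulr0; have := @ord3_cases 0 ord_max j isT isT isT.
    by rewrite (negPf j1) => /orP[] /eqP ->.
  have Dv : v = v 0 0 *: \row_j pt3 1 (v 0 1 / v 0 0) 0 j.
    by apply: row3P; rewrite !mxE /pt3 /= ?mulr1 ?mulr0 // mulrC divfK.
  exists (\row_j pt3 1 (v 0 1 / v 0 0) 0 j); last by exists (v 0 0).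
  rewrite mem_cat Hs0 //; apply/eqP; move/eqP: Fv.
  rewrite (@meval_homogZ _ _ _ _ (v 0 0) (pt3 1 (v 0 1 / v 0 0) 0) _ Fhom).
    by rewrite mulf_eq0 expf_eq0 (negPf nz0) andbF.
  by move=> j; rewrite {1}Dv !mxE.
have Dv : v = v 0 ord_max *: \row_j pt3 (v 0 0 / v 0 ord_max) (v 0 1 / v 0 ord_max) 1 j.
  by apply: row3P; rewrite !mxE /pt3 /= ?mulr1 // mulrC divfK.
exists (\row_j pt3 (v 0 0 / v 0 ord_max) (v 0 1 / v 0 ord_max) 1 j); last by exists (v 0 ord_max).
rewrite mem_cat Hs1 ?orbT //.
  have := congr1 (meval (v 0)) H; rewrite mevalD !mevalM Fv Gv !mulr0 addr0.
  move/eqP; rewrite mulf_eq0 rmorphXn /= mevalXU expf_eq0 (negPf v2) andbF /=.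
  rewrite rmorph_prod /= prodf_seq_eq0 => /hasP[a ars /=].
  by rewrite mevalB mevalZ !mevalXU subr_eq0 => /eqP ->; rewrite mulfK.
apply/eqP; move/eqP: Fv.
rewrite (@meval_homogZ _ _ _ _ (v 0 ord_max)
  (pt3 (v 0 0 / v 0 ord_max) (v 0 1 / v 0 ord_max) 1) _ Fhom).
  by rewrite mulf_eq0 expf_eq0 (negPf v2) andbF.
by move=> j; rewrite {1}Dv !mxE.
Qed.

Section Power.
Variables (I : {mpoly K[3]} -> Prop) (i k : 'I_3).
Hypotheses (ID : forall P Q, I P -> I Q -> I (P + Q)) (IM : forall P Q, I Q -> I (P * Q)).
Hypotheses (i1 : i != 1) (k1 : k != 1) (ik : i != k).

Let good P := forall M, ~ I ('X_k ^+ M * P).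
Let bad P := exists M, I ('X_k ^+ M * P).

Let NgoodP P : ~ good P <-> bad P.
Proof.
split; last by case=> M IP /(_ M).
by move=> /not_all_ex_not[M /NNPP IM']; exists M.
Qed.

Let badM P Q : bad Q -> bad (P * Q).
Proof. by case=> M IQ; exists M; rewrite mulrCA; apply: IM. Qed.

Let badD P Q : bad P -> bad Q -> bad (P + Q).
Proof.
case=> M IP [N IQ]; exists (M + N)%N; rewrite mulrDr; apply: ID.
  by rewrite exprD mulrAC mulrC; apply: IM.
by rewrite exprD -mulrA; apply: IM.
Qed.

Let badX e P : bad ('X_k ^+ e * P) -> bad P.
Proof. by case=> M; rewrite mulrA -exprD => IP; exists (M + e)%N. Qed.

Let badZ c P : c != 0 -> bad (c *: P) -> bad P.
Proof. by move=> nzc /(badM c^-1%:MP); rewrite mul_mpolyC scalerA mulVf // scale1r. Qed.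

(** When w is multiplied by the factors one at a time, some factor is the first to turn a good
    product into a bad one. *)
Let extract (T : eqType) (s : seq T) (l : T -> {mpoly K[3]}) w : good w ->
  bad ((\prod_(a <- s) l a) * w) -> exists2 a, a \in s & exists2 w', good w' & 
    (exists q, w' = q * w) /\ bad (l a * w').
Proof.
move=> gw; elim: s => [|a s IH]; first by rewrite big_nil mul1r => /NgoodP.
rewrite big_cons -mulrA => H; have [b|] := classic (bad ((\prod_(a <- s) l a) * w)).
  have [c cs Hc] := IH b; exists c => //; by rewrite inE cs orbT.
move/NgoodP/NNPP => g; exists a; first by rewrite inE eqxx.
by exists ((\prod_(a <- s) l a) * w) => //; split=> //; exists (\prod_(a <- s) l a).
Qed.

(* An elementary Nullstellensatz. Call w bad if I contains some X_k^M w. If 1 is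
   not bad, then going through the linear factors of a binary form of I, and then
   through those of F restricted to one of the lines X_i = a X_k so obtained, one
   finds w that is not bad while (X_i - a X_k) w and (X_1 - b X_k) w are. Every form
   of I then vanishes at the point X_i = a, X_1 = b, X_k = 1. *)
Lemma monic_power (ls : seq (K * K)) : I F ->
  (forall l, l \in ls -> l != (0, 0)) ->
  I (\prod_(l <- ls) (l.1 *: 'X_i + l.2 *: 'X_k)) ->
  (forall v : 'rV[K]_3, v != 0 -> F.@[v 0] = 0 ->
     exists N V, [/\ V \is N.-homog, I V & V.@[v 0] != 0]) ->
  exists M, I ('X_k ^+ M).
Proof.
move=> IF nzls Ils HV; have [[M IM1]|g] := classic (bad 1); first by exists M; rewrite mulr1 in IM1.
have g1 : good 1 by apply: NNPP => /NgoodP.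
have [|l /nzls nzl [w gw [_ badl]]] := @extract _ ls (fun l => l.1 *: 'X_i + l.2 *: 'X_k) 1 g1.
  by exists 0%N; rewrite mul1r mulr1.
have Nbw : ~ bad w by move/NgoodP; apply.
have l1 : l.1 != 0.
  apply/eqP => l10; apply: Nbw; apply: (@badX 1); apply: (@badZ l.2).
    by apply: contraNneq nzl => l20; rewrite [l]surjective_pairing l10 l20.
  by move: badl; rewrite l10 scale0r add0r expr1 scalerAl.
pose a := - (l.2 / l.1).
have bada : bad (('X_i - a *: 'X_k) * w).
  have la : l.1 * a = - l.2 by rewrite /a mulrN mulrC divfK.
  by apply: (badZ l1); rewrite scalerAl scalerBr scalerA la scaleNr opprK.
pose h (j : 'I_3) := if j == i then a else 1.
have [rs srs Hrs] := ypoly_factor Fhom F1 h.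
set c := F.@[_] in Hrs; have nzc : c != 0 by [].
have [g0 Dg] := msubst_subr1 i (a *: 'X_k) F.
have DF : msubst (fun j => if j == i then a *: 'X_k else 'X_j) F =
    c *: \prod_(b <- rs) ('X_1 - b *: 'X_k).
  (* After multiplication by X_k only the points with X_k nonzero matter; scaled to X_k = 1, they
     lie on the line where [ypoly_factor] splits F. *)
  apply: (mulfI (mpolyX_neq0 K k)); apply: mpoly_ext => v; rewrite !mevalM mevalXU.
  have [->|nz] := eqVneq (v k) 0; first by rewrite !mul0r.
  rewrite msubst_meval (@meval_homogZ _ _ _ _ (v k) (fun j => if j == 1 then v 1 / v k else h j) _ Fhom).
    rewrite Hrs mevalZ rmorph_prod /=; congr (_ * _); rewrite mulrCA; congr (_ * _).
    rewrite -srs; elim: rs {Hrs srs} => [|b rs IH]; first by rewrite !big_nil mulr1.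
    rewrite !big_cons -IH mevalB mevalZ !mevalXU exprS.
    have -> : v 1 - b * v k = v k * (v 1 / v k - b) by rewrite mulrBr [v k * (_ / _)]mulrC divfK // (mulrC b).
    by rewrite mulrACA.
  move=> j; rewrite /h; have := ord3_cases j i1 k1 ik.
  have [->|_ /=] := eqVneq j i; first by rewrite (negPf i1) mevalZ mevalXU mulrC.
  by case/orP => /eqP ->; rewrite mevalXU ?eqxx ?(negPf k1) ?mulr1 // mulrC divfK.
have : bad ((\prod_(b <- rs) ('X_1 - b *: 'X_k)) * w).
  apply: (badZ nzc); rewrite scalerAl -DF.
  have -> : msubst (fun j => if j == i then a *: 'X_k else 'X_j) F * w =
      w * F + - g0 * (('X_i - a *: 'X_k) * w) by rewrite [in RHS]Dg; ring.
  by apply: badD; apply: badM => //; exists 0%N; rewrite mul1r.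
move/(extract gw) => [b brs [w' gw' [[q Dw'] badb]]].
have {bada} bada : bad (('X_i - a *: 'X_k) * w').
  by rewrite Dw' mulrCA; apply: badM.
have {Nbw} Nbw : ~ bad w' by move/NgoodP; apply.
pose u (j : 'I_3) := if j == 1 then b else h j.
(* Modulo the forms X_j - u_j X_k, whose products with w' are all bad, V is V(u) X_k^N. As V w' is
   bad too, a nonzero V(u) would make w' bad. *)
have key N V : V \is N.-homog -> I V -> V.@[u] = 0.
  move=> hV IV; apply/eqP; apply: contraT => nzV; case: Nbw.
  apply: (@badX N); apply: (badZ nzV).
  have [g2 Dg2] := msubst_diff (fun j => 'X_j) (fun j => u j *: 'X_k) V.
  have DV : msubst (fun j => u j *: 'X_k) V = V.@[u] *: 'X_k ^+ N.
    apply: mpoly_ext => v; rewrite msubst_meval mevalZ rmorphXn /= mevalXU.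
    rewrite mulrC; apply: (meval_homogZ hV) => j.
    by rewrite mevalZ mevalXU mulrC.
  rewrite scalerAl -DV.
  have -> : msubst (fun j => u j *: 'X_k) V * w' =
      w' * V + \sum_j (- g2 j) * (('X_j - u j *: 'X_k) * w').
    rewrite [X in w' * X](_ : V = msubst (fun j => u j *: 'X_k) V + \sum_i0 g2 i0 * ('X_i0 - u i0 *: 'X_k)).
      rewrite mulrDr [w' * _]mulrC -addrA [X in _ + X](_ : _ = 0) ?addr0 // mulr_sumr -big_split /=.
      by apply: big1 => j _; ring.
    by rewrite -Dg2 msubst_id addrC subrK.
  apply: badD; first by apply: badM; exists 0%N; rewrite mul1r.
  elim/big_ind: _ => //.
  - by exists 0%N; rewrite mulr0 -(mul0r F); apply: IM.
  move=> j _; apply: badM; rewrite /u /h; have := ord3_cases j i1 k1 ik.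
  have [->|_ /=] := eqVneq j i; first by rewrite (negPf i1).
  case/orP => /eqP ->; rewrite ?eqxx // (negPf k1) scale1r subrr mul0r.
  by exists 0%N; rewrite mulr0 -(mul0r F); apply: IM.
have nzu : \row_j u j != 0.
  apply/eqP => /rowP /(_ k); rewrite !mxE /u (negPf k1) /h eq_sym (negPf ik) => /eqP.
  by rewrite oner_eq0.
have [|N [V [hV IV]]] := HV _ nzu; first by rewrite meval_row (key d).
by rewrite meval_row (key N) ?eqxx.
Qed.

End Power.
End MonicCurveIdeals.

(** * Noether's theorem for an equation monic in y *)

Lemma pihomog_ideal (A : comNzRingType) n d D (F W : {mpoly A[n]}) : F \is d.-homog ->
  exists W', pihomog mdeg D (W * F) = W' * F.
Proof.
move=> hF; case: (leqP d D) => [dD|Dd].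
  exists (pihomog mdeg (D - d) W); rewrite mulrC -(subnKC dD) pihomogMl //.
  by rewrite mulrC addKn.
exists 0; rewrite mul0r (pihomog_partitionE (leqnn (mmeasure mdeg W))) mulr_suml raddf_sum /=.
apply: big1 => i _; apply: (pihomog_ne0 _ (dhomogM (pihomogP mdeg i W) hF)).
by rewrite gtn_eqF // ltn_addl.
Qed.

Lemma mul_Xexp_eq (K : closedFieldType) n (i k : 'I_n) a b (P Q : {mpoly K[n]}) : i != k ->
  'X_i ^+ a * P = 'X_k ^+ b * Q -> exists R, P = 'X_k ^+ b * R.
Proof.
move=> ik /esym; rewrite [_ ^+ a * _]mulrC => /mpolyX_expK[|R [-> _]]; last by exists R.
by rewrite rmorphXn /= msub0X (negPf ik) expf_neq0 // mpolyX_neq0.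
Qed.

(** F is not a zero divisor modulo (X_i^a, X_k^b). Modulo X_i, X_k^b divides F W, and F is prime to
    X_k there, so X_k^b divides W; removing this part leaves a multiple of X_i, and a decreases. *)
Lemma mul_ideal_Xexp (K : closedFieldType) n (i k : 'I_n) a b (F W P Q : {mpoly K[n]}) :
  i != k -> msub0 k (msub0 i F) != 0 ->
  F * W = 'X_i ^+ a * P + 'X_k ^+ b * Q ->
  exists P' Q', W = 'X_i ^+ a * P' + 'X_k ^+ b * Q'.
Proof.
move=> ik nzF; elim: a W P Q => [|a IH] W P Q H.
  by exists W, 0; rewrite mul1r mulr0 addr0.
have sXi j : msub0 i ('X_k ^+ j) = 'X_k ^+ j :> {mpoly K[n]}.
  by rewrite rmorphXn /= msub0X eq_sym (negPf ik).
have H0 : 'X_k ^+ b * msub0 i Q = msub0 i W * msub0 i F.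
  have := congr1 (msub0 i) H; rewrite rmorphM rmorphD !rmorphM /= sXi rmorphXn /= msub0X.
  by rewrite eqxx expr0n mul0r add0r mulrC => ->.
have [W' [DW' _]] := mpolyX_expK nzF H0.
have [g] := msubst_subr1 i 0 W; rewrite [msubst _ W]DW' subr0 => DW.
have DQ : msub0 i Q = W' * msub0 i F.
  apply: (mulfI (expf_neq0 b (mpolyX_neq0 K k))); rewrite H0 DW'; ring.
have [Q' DQ'] : exists Q', Q - F * W' = 'X_i * Q'.
  have [g1 D1] := msubst_subr1 i 0 Q; have [g2 D2] := msubst_subr1 i 0 F.
  exists (g1 - g2 * W'); rewrite {1}D1 {1}D2 [msubst _ Q]DQ -[msubst _ F]/(msub0 i F); ring.
have [|P1 [Q1 Dg]] := IH g P Q'.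
  apply: (mulfI (mpolyX_neq0 K i)).
  have -> : 'X_i * (F * g) = F * W - 'X_k ^+ b * (F * W') by rewrite DW; ring.
  by rewrite H exprS -addrA -mulrBr DQ'; ring.
exists P1, (W' + 'X_i * Q1); rewrite DW Dg exprS; ring.
Qed.

Section Regular.
Variables (K : closedFieldType) (d : nat) (F : {mpoly K[3]}).
Hypotheses (Fhom : F \is d.-homog) (Firr : irreducible_mpoly F).
Hypothesis F1 : F.@[fun j => (j == 1)%:R] != 0.

(* With I = {V | V G in (B, F)}, [monic_power] gives z^M1 G = B T1 and
   x^M2 G = B T2 modulo F, hence x^M2 T1 = z^M1 T2 modulo F. As (x, z, F) is a
   regular sequence, T1 is divisible by z^M1 modulo F. *)
Lemma monic_regular m k (G B : {mpoly K[3]}) :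
  G \is (k + m).-homog -> B \is k.-homog -> ~ (exists Q, B = Q * F) ->
  (forall v : 'rV[K]_3, v != 0 -> F.@[v 0] = 0 -> exists e V,
     [/\ V \is e.-homog, V.@[v 0] != 0 & exists U W, V * G = B * U + W * F]) ->
  exists H W, H \is m.-homog /\ G = B * H + W * F.
Proof.
move=> hG hB nd loc; pose I V := exists U W, V * G = B * U + W * F.
have ID P Q : I P -> I Q -> I (P + Q).
  by move=> [U [W H]] [U' [W' H']]; exists (U + U'), (W + W'); rewrite mulrDl H H'; ring.
have IM P Q : I Q -> I (P * Q).
  by move=> [U [W H]]; exists (P * U), (P * W); rewrite -mulrA H; ring.
have IF : I F by exists 0, G; ring.
have HV (v : 'rV[K]_3) : v != 0 -> F.@[v 0] = 0 ->
    exists N V, [/\ V \is N.-homog, I V & V.@[v 0] != 0].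
  by move=> nzv Fv; have [e [V [hV nzV IV]]] := loc v nzv Fv; exists e, V.
have [e [rs [U [W HR]]]] := monic_factors Fhom Firr F1 hB nd.
have IR : I ('X_ord_max ^+ e * \prod_(a <- rs) ('X_0 - a *: 'X_ord_max)).
  by exists (W * G), (U * G); rewrite HR; ring.
have [M1 [U1 [W1 H1]]] : exists M, I ('X_ord_max ^+ M).
  apply: (@monic_power _ d F Fhom F1 I 0 ord_max ID IM isT isT isT
     (nseq e (0, 1) ++ [seq (1, - a) | a <- rs]) IF) => //.
    move=> l; rewrite mem_cat => /orP[/nseqP[-> _]|/mapP[a _ ->]];
    by rewrite xpair_eqE oner_eq0 ?andbF.
  rewrite big_cat big_nseq /= iter_mulr mulr1 scale0r add0r scale1r big_map.
  by under eq_bigr do rewrite scale1r scaleNr.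
have [M2 [U2 [W2 H2]]] : exists M, I ('X_0 ^+ M).
  apply: (@monic_power _ d F Fhom F1 I ord_max 0 ID IM isT isT isT
     (nseq e (1, 0) ++ [seq (- a, 1) | a <- rs]) IF) => //.
    move=> l; rewrite mem_cat => /orP[/nseqP[-> _]|/mapP[a _ ->]];
    by rewrite xpair_eqE oner_eq0 ?andbF.
  rewrite big_cat big_nseq /= iter_mulr mulr1 scale0r addr0 scale1r big_map.
  by under eq_bigr do rewrite scale1r scaleNr addrC.
(* The component of degree k + M + m of the identity makes the cofactor of B a form, as
   [monic_prime] requires. *)
have proj i M U' W' : 'X_i ^+ M * G = B * U' + W' * F ->
    exists W'', 'X_i ^+ M * G = B * pihomog mdeg (M + m) U' + W'' * F.
  have hX : 'X_i ^+ M * G \is [in K[3], (k + (M + m)).-homog] by rewrite addnCA; apply: homogXnM.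
  move=> /(congr1 (pihomog mdeg (k + (M + m)))); rewrite (pihomog_dE hX) pihomogD pihomogMl //.
  by have [W'' ->] := pihomog_ideal (k + (M + m)) W' Fhom; exists W''.
have {H1} [W1' H1] := proj _ _ _ _ H1; have {H2} [W2' H2] := proj _ _ _ _ H2.
set T1 := pihomog _ _ _ in H1; set T2 := pihomog _ _ _ in H2.
have [Q DQ] : exists Q, 'X_0 ^+ M2 * T1 - 'X_ord_max ^+ M1 * T2 = Q * F.
  have hB' : 'X_0 ^+ M2 * T1 - 'X_ord_max ^+ M1 * T2 \is [in K[3], (M2 + (M1 + m)).-homog].
    apply: rpredB; first by apply: homogXnM; apply: pihomogP.
    by rewrite addnCA; apply: homogXnM; apply: pihomogP.
  case: (monic_prime Fhom Firr F1 hB hB') => //.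
  exists ('X_ord_max ^+ M1 * W2' - 'X_0 ^+ M2 * W1').
  have -> : B * ('X_0 ^+ M2 * T1 - 'X_ord_max ^+ M1 * T2) =
    'X_0 ^+ M2 * ('X_ord_max ^+ M1 * G - W1' * F) - 'X_ord_max ^+ M1 * ('X_0 ^+ M2 * G - W2' * F).
    by rewrite H1 H2; ring.
  ring.
have nz0 : msub0 (ord_max : 'I_3) (msub0 (0 : 'I_3) F) != 0.
  apply: contraNneq F1 => F0; have := congr1 (meval (fun j => (j == 1)%:R)) F0.
  rewrite meval0 !msubst_meval => E; rewrite -[X in _ == X]E; apply/eqP/meval_eq => j.
  case: (eqVneq j 0) => [->|_]; first by rewrite meval0.
  rewrite mevalXU; case: (eqVneq j ord_max) => [->|_]; first by rewrite meval0.
  by rewrite mevalXU.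
have [|P' [Q' DW]] := @mul_ideal_Xexp K 3 0 ord_max M2 M1 F Q T1 (- T2) isT nz0.
  by rewrite mulrC -DQ; ring.
have [|R DR] := @mul_Xexp_eq K 3 0 ord_max M2 M1 (T1 - F * P') (T2 + F * Q') isT.
  apply/eqP; rewrite -subr_eq0; apply/eqP.
  transitivity ('X_0 ^+ M2 * T1 - 'X_ord_max ^+ M1 * T2 - F * ('X_0 ^+ M2 * P' + 'X_ord_max ^+ M1 * Q')).
    ring.
  by rewrite DQ -DW; ring.
(* z^M1 (G - B R) is a multiple of F, and z does not divide F, so z^M1 cancels. *)
have [||W3 [_ DG]] := @mpolyX_expK K 3 ord_max M1 F (G - B * R) (B * P' + W1').
- exact: (monic_msub0 F1).
- rewrite mulrBr H1 -[T1](subrK (F * P')) DR; ring.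
exists (pihomog mdeg m R).
have DG' : G = B * R + W3 * F by rewrite -DG addrC subrK.
have := congr1 (pihomog mdeg (k + m)) DG'.
rewrite pihomog_dE // pihomogD pihomogMl //.
have [W4 ->] := pihomog_ideal (k + m) W3 Fhom => E.
by exists W4; split; [apply: pihomogP|].
Qed.

End Regular.

(** * Linear changes of coordinates, and arbitrary irreducible plane curves *)

Section LinearChange.
Variables (K : closedFieldType) (n : nat).
Implicit Types (g : 'M[K]_n) (P : {mpoly K[n]}).

Definition lsub g : {mpoly K[n]} -> {mpoly K[n]} := msubst (fun j => \sum_i g i j *: 'X_i).
HB.instance Definition _ g :=
  GRing.RMorphism.copy (lsub g) (msubst (fun j => \sum_i g i j *: 'X_i)).

Lemma mpoly_ext_row P Q : (forall v : 'rV[K]_n, P.@[v 0] = Q.@[v 0]) -> P = Q.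
Proof. by move=> H; apply: mpoly_ext => v; have := H (\row_j v j); rewrite !meval_row. Qed.

Lemma lsub_meval g P (v : 'rV[K]_n) : (lsub g P).@[v 0] = P.@[(v *m g) 0].
Proof.
rewrite msubst_meval; apply: meval_eq => j; rewrite mxE raddf_sum /=.
by apply: eq_bigr => i _; rewrite mevalZ mevalXU mulrC.
Qed.

Lemma lsubK g P : g \in unitmx -> lsub (invmx g) (lsub g P) = P.
Proof. by move=> ug; apply: mpoly_ext_row => v; rewrite !lsub_meval mulmxKV. Qed.

Lemma lsubKV g P : g \in unitmx -> lsub g (lsub (invmx g) P) = P.
Proof. by move=> ug; apply: mpoly_ext_row => v; rewrite !lsub_meval mulmxK. Qed.

Lemma lsub_homog g N P : P \is N.-homog -> lsub g P \is N.-homog.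
Proof.
move=> hP; rewrite -[N]muln1; apply: msubst_homog => // j.
by apply: rpred_sum => i _; apply/rpredZ/homogX.
Qed.

Lemma lsub_irr g P : g \in unitmx -> irreducible_mpoly P -> irreducible_mpoly (lsub g P).
Proof.
move=> ug [nz nu H]; have ug' : invmx g \in unitmx by rewrite unitmx_inv.
have U (h : 'M_n) Q : Q \is a GRing.unit -> lsub h Q \is a GRing.unit.
  by move/mpoly_unitP => [c nzc ->]; rewrite /lsub msubstC; apply/mpoly_unitP; exists c.
split.
- by apply: contraNneq nz => P0; rewrite -(lsubK P ug) P0 rmorph0.
- by apply: contraNN nu => /(U (invmx g)); rewrite lsubK.
move=> G Q DP; case: (H (lsub (invmx g) G) (lsub (invmx g) Q)).
- by rewrite -(rmorphM (lsub (invmx g))) -DP /= lsubK.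
- by move=> /(U g); rewrite lsubKV; [left|].
- by move=> /(U g); rewrite lsubKV; [right|].
Qed.

Lemma exists_unitmx_row (i : 'I_n) (v : 'rV[K]_n) : v != 0 ->
  exists2 g : 'M[K]_n, g \in unitmx & delta_mx 0 i *m g = v.
Proof.
move=> nzv; pose f : 'M[K]_n := \matrix_(a, b) v 0 b.
have Df : delta_mx (0 : 'I_1) i *m f = v by apply/rowP => j; rewrite -rowE !mxE.
have [|g ug Dg] := @complete_unitmx _ 1 n (delta_mx 0 i) f.
  by rewrite Df mxrank_delta rank_rV nzv.
by exists g; rewrite // -Dg.
Qed.

End LinearChange.

Section Curve.
Variables (K : closedFieldType) (d : nat) (F : {mpoly K[3]}).
Hypotheses (Fhom : F \is d.-homog) (Firr : irreducible_mpoly F).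

(** A point off the curve is moved to (0 : 1 : 0), which transfers all results on monic equations to
    F. *)
Lemma curve_coord : exists2 g : 'M[K]_3, g \in unitmx &
  (lsub g F).@[fun j => (j == 1)%:R] != 0.
Proof.
have [u nzu] := mpoly_nonroot (irr_neq0 Firr).
have nzv : \row_j u j != 0.
  apply: contraNneq nzu => u0; apply/eqP.
  rewrite (@meval_homogZ _ _ _ _ 0 u u Fhom) ?expr0n; last first.
    by move=> i; rewrite mul0r; move/rowP/(_ i): u0; rewrite !mxE.
  by rewrite (gtn_eqF (irr_deg_gt0 Fhom Firr)) mul0r.
have [g ug Dg] := exists_unitmx_row 1 nzv.
exists g => //; rewrite -meval_row lsub_meval.
rewrite (_ : \row_j _ = delta_mx 0 1) ?Dg ?meval_row //.
by apply/rowP => j; rewrite !mxE.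
Qed.

Lemma curve_prime N M B X : B \is N.-homog -> X \is M.-homog ->
  (exists Q, B * X = Q * F) -> (exists Q, B = Q * F) \/ (exists Q, X = Q * F).
Proof.
have [g ug F1] := curve_coord; move=> hB hX [Q H].
have back P : (exists Q, lsub g P = Q * lsub g F) -> exists Q, P = Q * F.
  by move=> [R HR]; exists (lsub (invmx g) R); rewrite -[LHS](lsubK _ ug) HR rmorphM /= lsubK.
case: (monic_prime (lsub_homog g Fhom) (lsub_irr ug Firr) F1 (lsub_homog g hB) (lsub_homog g hX)).
- by exists (lsub g Q); rewrite -!rmorphM H.
- by left; apply: back.
- by right; apply: back.
Qed.

Lemma curve_Null N G : G \is N.-homog ->
  (forall v : 'rV[K]_3, v != 0 -> F.@[v 0] = 0 -> G.@[v 0] = 0) -> exists Q, G = Q * F.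
Proof.
have [g ug F1] := curve_coord; move=> hG H.
have [|R HR] := monic_Null (lsub_homog g Fhom) (lsub_irr ug Firr) F1 (lsub_homog g hG).
  move=> v nzv; rewrite !lsub_meval; apply: H.
  by apply: contra_neq nzv => vg0; rewrite -(mulmxK ug v) vg0 mul0mx.
by exists (lsub (invmx g) R); rewrite -[LHS](lsubK _ ug) HR rmorphM /= lsubK.
Qed.

Lemma curve_finite N G : G \is N.-homog -> ~ (exists Q, G = Q * F) ->
  exists s : seq 'rV[K]_3, forall v : 'rV[K]_3, v != 0 -> F.@[v 0] = 0 -> G.@[v 0] = 0 ->
    exists2 w, w \in s & exists c, v = c *: w.
Proof.
have [g ug F1] := curve_coord; move=> hG nd.
have [|s Hs] := monic_finite (lsub_homog g Fhom) (lsub_irr ug Firr) F1 (lsub_homog g hG).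
  case=> R HR; apply: nd; exists (lsub (invmx g) R).
  by rewrite -[LHS](lsubK _ ug) HR rmorphM /= lsubK.
exists [seq w *m g | w <- s] => v nzv Fv Gv.
have [||| w ws [c Dw]] := Hs (v *m invmx g).
- by apply: contra_neq nzv => vg0; rewrite -(mulmxKV ug v) vg0 mul0mx.
- by rewrite lsub_meval mulmxKV.
- by rewrite lsub_meval mulmxKV.
exists (w *m g); first exact: map_f.
by exists c; rewrite scalemxAl -Dw mulmxKV.
Qed.

(* Max Noether's AF + BG theorem for the pair (F, B). *)
Lemma curve_regular m k (G B : {mpoly K[3]}) :
  G \is (k + m).-homog -> B \is k.-homog -> ~ (exists Q, B = Q * F) ->
  (forall v : 'rV[K]_3, v != 0 -> F.@[v 0] = 0 -> exists e V,
     [/\ V \is e.-homog, V.@[v 0] != 0 & exists U W, V * G = B * U + W * F]) ->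
  exists H W, H \is m.-homog /\ G = B * H + W * F.
Proof.
have [g ug F1] := curve_coord; move=> hG hB nd loc.
have [||H [W [hH DG]]] := monic_regular (lsub_homog g Fhom) (lsub_irr ug Firr) F1
  (lsub_homog g hG) (lsub_homog g hB).
- case=> R HR; apply: nd; exists (lsub (invmx g) R).
  by rewrite -[LHS](lsubK _ ug) HR rmorphM /= lsubK.
- move=> v nzv; rewrite lsub_meval => Fv.
  have [|e [V [hV nzV [U [W E]]]]] := loc _ _ Fv.
    by apply: contra_neq nzv => vg0; rewrite -(mulmxK ug v) vg0 mul0mx.
  exists e, (lsub g V); split; [exact: lsub_homog|by rewrite lsub_meval|].
  by exists (lsub g U), (lsub g W); rewrite -!rmorphM E rmorphD.
exists (lsub (invmx g) H), (lsub (invmx g) W); split; first exact: lsub_homog.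
by rewrite -[LHS](lsubK _ ug) DG rmorphD !rmorphM /= !lsubK.
Qed.

(** For a form P this means, by [curve_zero], that P is nonzero in the homogeneous coordinate ring
    of the curve. *)
Definition nonzero_on P := exists v : 'rV[K]_3, [/\ v != 0, F.@[v 0] = 0 & P.@[v 0] != 0].

Lemma curve_nonzeroM N M P Q : P \is N.-homog -> Q \is M.-homog ->
  nonzero_on P -> nonzero_on Q -> nonzero_on (P * Q).
Proof.
move=> hP hQ [v [nzv Fv Pv]] [w [nzw Fw Qw]]; apply: NNPP => H.
have [|[R DP]|[R DQ]] := curve_prime hP hQ.
- apply: (curve_Null (dhomogM hP hQ)) => u nzu Fu; apply/eqP; apply: contraT => nz.
  by case: H; exists u.
- by case/eqP: Pv; rewrite DP mevalM Fv mulr0.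
- by case/eqP: Qw; rewrite DQ mevalM Fw mulr0.
Qed.

Lemma curve_zero N P : P \is N.-homog -> ~ nonzero_on P -> exists Q, P = Q * F.
Proof.
move=> hP H; apply: (curve_Null hP) => v nzv Fv; apply/eqP; apply: contraT => nz.
by case: H; exists v.
Qed.

Lemma nonzero_on_ndvd P : nonzero_on P -> ~ exists Q, P = Q * F.
Proof. by move=> [v [nzv Fv /eqP Pv]] [Q DP]; apply: Pv; rewrite DP mevalM Fv mulr0. Qed.

End Curve.

(** * The Cayley-Bacharach condition *)

Section CayleyBacharach.
Variable K : closedFieldType.
Implicit Types (c : 'cV[K]_3) (u v q : 'rV[K]_3) (s t : seq 'rV[K]_3).

Definition linform c : {mpoly K[3]} := \sum_i c i 0 *: 'X_i.

Lemma linform_meval c v : (linform c).@[v 0] = (v *m c) 0 0.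
Proof.
rewrite mxE raddf_sum; apply: eq_bigr => i _ /=.
by rewrite mevalZ mevalXU mulrC.
Qed.

Lemma linform_homog c : linform c \is 1.-homog.
Proof. by apply: rpred_sum => i _; apply/rpredZ/homogX. Qed.

Lemma linform_neq0 c : c != 0 -> linform c != 0.
Proof.
case/cV0Pn => a; apply: contraNneq => c0; have := linform_meval c (delta_mx 0 a).
by rewrite c0 meval0 -rowE mxE => <-.
Qed.

Lemma linform_col m (A : 'M[K]_(3, m)) j v : (linform (col j A)).@[v 0] = (v *m A) 0 j.
Proof. by rewrite linform_meval !mxE; apply: eq_bigr => i _; rewrite mxE. Qed.

Lemma linform_sep u q : ~~ (q <= u)%MS ->
  exists c, (linform c).@[u 0] = 0 /\ (linform c).@[q 0] != 0.
Proof.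
rewrite submxE => /rV0Pn[j nz]; exists (col j (cokermx u)).
by rewrite !linform_col nz mulmx_coker mxE.
Qed.

Lemma linform_through u v : exists c, [/\ c != 0, (linform c).@[u 0] = 0 & (linform c).@[v 0] = 0].
Proof.
have : cokermx (col_mx u v) != 0.
  rewrite -mxrank_eq0 mxrank_coker subn_eq0 -ltnNge.
  exact: (leq_ltn_trans (rank_leq_row _)).
case/matrix0Pn => i [j nz]; exists (col j (cokermx (col_mx u v))).
have /eqP := mulmx_coker (col_mx u v); rewrite mul_col_mx col_mx_eq0 => /andP[/eqP u0 /eqP v0].
rewrite !linform_col u0 v0 !mxE; split=> //.
by apply: contraNneq nz => /colP /(_ i); rewrite mxE => ->; rewrite mxE.
Qed.

(** G is a product of lines, one through each point of t and none through q, completed to degree k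
    by a coordinate that is nonzero at q. *)
Lemma separating_form q t k : q != 0 -> (forall u, u \in t -> ~~ (q <= u)%MS) ->
  (size t <= k)%N -> exists G : {mpoly K[3]},
  [/\ G \is k.-homog, forall u, u \in t -> G.@[u 0] = 0 & G.@[q 0] != 0].
Proof.
move=> nzq; elim: k t => [|k IH] [|u t] //= Ht.
- by move=> _; exists 1; split; rewrite ?dhomog1 ?meval1 ?oner_eq0.
- move=> _; have [||G [hG _ nz]] := IH [::] => //.
  have [j nj] := rV0Pn _ nzq; exists ('X_j * G); split=> //.
    by rewrite -[k.+1]/(1 + k)%N dhomogM ?homogX.
  by rewrite mevalM mevalXU mulf_neq0.
rewrite ltnS => le; have [|G [hG Gt nz]] := IH t _ le.
  by move=> v vt; apply: Ht; rewrite inE vt orbT.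
have [c [cu cq]] := linform_sep (Ht u (mem_head _ _)).
exists (linform c * G); split; last by rewrite mevalM mulf_neq0.
  by rewrite -[k.+1]/(1 + k)%N dhomogM ?linform_homog.
by move=> v; rewrite inE mevalM => /orP[/eqP ->|/Gt ->]; rewrite ?cu ?mul0r ?mulr0.
Qed.

Definition distinct_points s :=
  [/\ uniq s, forall v, v \in s -> v != 0
    & forall u v, u \in s -> v \in s -> u != v -> ~~ (u <= v)%MS].

Definition cayley_bacharach k s := forall G, G \is k.-homog -> forall q, q \in s ->
  (forall v, v \in s -> v != q -> G.@[v 0] = 0) -> G.@[q 0] = 0.

(** With at most k points besides q, [separating_form] would violate the condition at q. *)
Lemma cayley_bacharach_size k s q : distinct_points s -> cayley_bacharach k s ->
  q \in s -> (k.+2 <= size s)%N.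
Proof.
move=> [us nz ds] cb qs; rewrite ltnNge; apply/negP => le.
have [|||G [hG Gt]] := @separating_form q [seq v <- s | v != q] k.
- exact: nz.
- by move=> u; rewrite mem_filter => /andP[uq us']; apply: ds => //; rewrite eq_sym.
- have := count_predC (pred1 q) s; rewrite (count_uniq_mem q us) qs size_filter => E.
  by rewrite -ltnS (leq_trans _ le) // -E.
by rewrite (cb G hG q qs) ?eqxx // => v vs vq; apply: Gt; rewrite mem_filter vq.
Qed.

Lemma max_nat_prop (P : nat -> Prop) N m : P m -> (forall n, P n -> (n <= N)%N) ->
  exists2 M, P M & forall n, P n -> (n <= M)%N.
Proof.
move=> + H; have [k] := ubnP (N - m)%N; elim: k m => // k IH m le Pm.
have [[n [Pn mn]]|H'] := classic (exists n, P n /\ (m < n)%N).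
  by apply: (IH n) => //; have := H _ Pn; lia.
by exists m => // n Pn; rewrite leqNgt; apply/negP => lt; apply: H'; exists n.
Qed.

(* Induction on k: if c is a line with the most points of s, the points of s off c
   satisfy the condition in degree k - 1, hence they are at least k + 1 and lie on
   a line, so that c also has at least k + 1 points and s at least 2k + 2. *)
Lemma cayley_bacharach_line k s : distinct_points s -> cayley_bacharach k s ->
  (size s <= k.*2.+1)%N ->
  exists2 c, c != 0 & forall v, v \in s -> (linform c).@[v 0] = 0.
Proof.
elim: k s => [|k IH] s ds cb le.
  case: s ds cb le => [|u [|v s]] // ds cb _.
    by exists (delta_mx 0 0) => //; apply/eqP => /colP /(_ 0); rewrite !mxE => /eqP; rewrite oner_eq0.
  by have := cayley_bacharach_size ds cb (mem_head _ _).
pose on c := count (fun v => (linform c).@[v 0] == 0) s.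
have [||n [c [nzc ->]] maxc] := @max_nat_prop (fun n => exists c, c != 0 /\ n = on c) (size s) (on (delta_mx 0 0)).
- exists (delta_mx 0 0); split=> //.
  by apply/eqP => /colP /(_ 0); rewrite !mxE => /eqP; rewrite oner_eq0.
- by move=> n [c [_ ->]]; apply: count_size.
have max c' : c' != 0 -> (on c' <= on c)%N by move=> nz; apply: maxc; exists c'.
pose s1 := [seq v : 'rV[K]_3 <- s | (linform c).@[v 0] != 0].
have ss1 : (on c + size s1 = size s)%N by rewrite size_filter; apply: count_predC.
have [E|[q qs1]] : s1 = [::] \/ exists q, q \in s1.
  by case: (s1) => [|q t]; [left|right; exists q; rewrite mem_head].
- exists c => // v vs; apply/eqP; apply: contraT => nz.
  by have : v \in s1 by [rewrite mem_filter nz]; rewrite E.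
(* Two points on c bring the bound 2(k + 1) + 1 on the size of s down to 2k + 1 for s1. *)
have on2 : (2 <= on c)%N.
  have qs : q \in s by move: qs1; rewrite mem_filter => /andP[].
  have [c' nzc' /leq_trans] : exists2 c', c' != 0 & (2 <= on c')%N; last by apply; apply: max.
  rewrite /on; have := cayley_bacharach_size ds cb qs; case: (s) => [|u [|v t]] // _.
  have [c' [nzc' cu cv]] := linform_through u v.
  by exists c' => //=; rewrite cu cv eqxx.
have [us nz dd] := ds.
have ds1 : distinct_points s1.
  split; first exact: filter_uniq.
    by move=> v; rewrite mem_filter => /andP[_ /nz].
  by move=> u v; rewrite !mem_filter => /andP[_ ?] /andP[_ ?]; apply: dd.
have cb1 : cayley_bacharach k s1.
  move=> G hG r; rewrite mem_filter => /andP[cr rs] H.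
  have : (linform c * G).@[r 0] = 0.
    apply: (cb _ _ r rs); first by rewrite -[k.+1]/(1 + k)%N dhomogM ?linform_homog.
    move=> v vs vr; rewrite mevalM; have [->|cv] := eqVneq (linform c).@[v 0] 0; first by rewrite mul0r.
    by rewrite H ?mulr0 // mem_filter cv.
  by rewrite mevalM => /eqP; rewrite mulf_eq0 (negPf cr) => /eqP.
have size1 : (size s1 <= k.*2.+1)%N by lia.
have [c' nzc' Hc'] := IH _ ds1 cb1 size1.
have : (size s1 <= on c')%N.
  rewrite size_filter -(@eq_in_count _ (fun v : 'rV[K]_3 => ((linform c).@[v 0] != 0) &&
    ((linform c').@[v 0] == 0))); first by apply: sub_count => v /andP[].
  move=> v vs /=; case: eqP => //= /eqP cv.
  by rewrite Hc' ?eqxx // mem_filter cv.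
have := max _ nzc'; have := cayley_bacharach_size ds1 cb1 qs1; lia.
Qed.

End CayleyBacharach.

(** * Local division at a simple point of a fibre *)

Lemma coefM_top (A : nzRingType) (p q : {poly A}) e f :
  (size p <= e.+1)%N -> (size q <= f.+1)%N -> (p * q)`_(e + f) = p`_e * q`_f.
Proof.
move=> sp sq; have le : (e < (e + f).+1)%N by rewrite ltnS leq_addr.
rewrite coefM (bigD1 (Ordinal le)) //= addKn big1 ?addr0 // => j; rewrite -val_eqE /= => ne.
case: (ltngtP j e) ne => // lt _.
  by rewrite [q`__]nth_default ?mulr0 //; apply: (leq_trans sq); have := ltn_ord j; lia.
by rewrite [p`__]nth_default ?mul0r //; apply: (leq_trans sp).
Qed.

(** A root x of p / gcd(p, q) would be a root of r, since p / gcd(p, q) is prime to q / gcd(p, q)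
    and hence divides r. *)
Lemma dvdp_local (K : closedFieldType) (p q : {poly K}) : p != 0 ->
  (forall x, root p x -> exists2 r, ~~ root r x & p %| q * r) -> p %| q.
Proof.
move=> nzp H; have nzg : gcdp p q != 0 by rewrite gcdp_eq0 negb_and nzp.
have cop : coprimep (p %/ gcdp p q) (q %/ gcdp p q) by rewrite coprimep_div_gcd ?nzp.
have := divpK (dvdp_gcdr p q); have := divpK (dvdp_gcdl p q).
move: (gcdp p q) nzg (p %/ _) (q %/ _) cop => g nzg p1 q1 cop Dp Dq.
have [p11|/closed_rootP[x rx]] := eqVneq (size p1) 1%N.
  rewrite -Dp -Dq dvdp_mul2r //; have /size_poly1P[c nzc ->] : size p1 == 1%N by rewrite p11.
  by rewrite -[c%:P]mulr1 mul_polyC dvdpZl // dvd1p.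
have [|r nr] := H x; first by rewrite -Dp rootM rx.
rewrite -Dp -Dq mulrAC dvdp_mul2r // Gauss_dvdpr // => dv.
by rewrite (root_dvdp dv rx) in nr.
Qed.

(** The top coefficient of a form along q + X w is its value at w, the point at infinity of the
    line. The map f allows lines over K as well as over K[x]. *)
Lemma mmap_line_top (R A : comNzRingType) n (f : R -> A) (q w : 'I_n -> A) N (P : {mpoly R[n]}) :
  P \is N.-homog -> let g := mmap (polyC \o f) (fun a => (q a)%:P + w a *: 'X) P in
  (size g <= N.+1)%N /\ g`_N = mmap f w P.
Proof.
move=> /dhomogP hP; pose T e (p : {poly A}) c := (size p <= e.+1)%N /\ p`_e = c.
have TM e f' p r c b : T e p c -> T f' r b -> T (e + f')%N (p * r) (c * b).
  move=> [sp pe] [sr rf]; split; last by rewrite coefM_top // pe rf.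
  by apply: (leq_trans (size_polyMleq _ _)); clear -sp sr; lia.
suff H m : m \in msupp P -> T N (mmap1 (fun a => (q a)%:P + w a *: 'X) m) (mmap1 w m).
  split.
    rewrite /mmap big_seq; apply: (leq_trans (size_sum _ _ _)).
    apply/bigmax_leqP_seq => m mP _; rewrite mul_polyC.
    by apply: (leq_trans (size_scale_leq _ _)); case: (H m mP).
  rewrite /mmap coef_sum !big_seq; apply: eq_bigr => m mP.
  by rewrite mul_polyC coefZ; case: (H m mP) => _ ->.
move=> /hP /= <-; rewrite mdegE /mmap1.
elim/big_ind3: _ => [|e p c f' r b|i _].
- by split; rewrite ?size_poly1 ?coef1.
- exact: TM.
elim: (m i) => [|k IH]; first by split; rewrite ?size_poly1 ?coef1.
rewrite !exprS -[k.+1]/(1 + k)%N; apply: TM => //; split.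
  rewrite (leq_trans (size_polyD _ _)) // geq_max (leq_trans (size_polyC_leq1 _)) //=.
  by rewrite (leq_trans (size_scale_leq _ _)) // size_polyX.
by rewrite coefD coefC coefZ coefX mulr1 add0r.
Qed.

Section Line.
Variables (K : closedFieldType) (n : nat) (q w : 'rV[K]_n).
Implicit Types P : {mpoly K[n]}.

Definition restr : {mpoly K[n]} -> {poly K} :=
  mmap polyC (fun a => (q 0 a)%:P + w 0 a *: 'X).
HB.instance Definition _ :=
  GRing.RMorphism.copy restr (mmap polyC (fun a => (q 0 a)%:P + w 0 a *: 'X)).

Lemma restrC c : restr c%:MP = c%:P. Proof. exact: mmapC. Qed.

Lemma restrX i : restr 'X_i = (q 0 i)%:P + w 0 i *: 'X.
Proof. by rewrite /restr mmapX mmap1U. Qed.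

Lemma restr_horner P x : (restr P).[x] = P.@[(q + x *: w) 0].
Proof.
elim/mpoly_alg_ind: P => [c|i|p r Hp Hr|p r Hp Hr].
- by rewrite restrC mevalC hornerC.
- by rewrite restrX mevalXU !hornerE !mxE mulrC.
- by rewrite !rmorphD /= !hornerD Hp Hr.
- by rewrite !rmorphM /= !hornerM Hp Hr.
Qed.

Lemma restr_deriv P : (restr P)^`() = \sum_i w 0 i *: restr P^`M(i).
Proof.
elim/mpoly_alg_ind: P => [c|i|p r Hp Hr|p r Hp Hr].
- by rewrite restrC derivC big1 // => i _; rewrite mderivC rmorph0 scaler0.
- rewrite restrX derivD derivC derivZ derivX add0r (bigD1 i) //= big1 => [|j ji].
    by rewrite addr0 mderivXU eqxx rmorph1.
  by rewrite mderivXU eq_sym (negPf ji) rmorph0 scaler0.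
- rewrite rmorphD derivD Hp Hr -big_split; apply: eq_bigr => i _ /=.
  by rewrite mderivD rmorphD scalerDr.
- rewrite rmorphM derivM Hp Hr mulr_suml mulr_sumr -big_split; apply: eq_bigr => i _ /=.
  by rewrite mderivM rmorphD !rmorphM scalerDr scalerAl scalerAr.
Qed.

Lemma restr_top N P : P \is N.-homog ->
  (size (restr P) <= N.+1)%N /\ (restr P)`_N = P.@[w 0].
Proof. exact: (@mmap_line_top K K n idfun (q 0) (w 0) N P). Qed.

End Line.

Section LocalDivision.
Variables (K : closedFieldType) (i j l : 'I_3) (v : 'rV[K]_3).
Hypotheses (ij : i != j) (il : i != l) (jl : j != l).

Let cases a : [|| a == i, a == j | a == l].
Proof.
move: ij il jl; case: i => -[|[|[|//]]] ?; case: j => -[|[|[|//]]] ?;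
  case: l => -[|[|[|//]]] ?; by case: a => -[|[|[|//]]] ?.
Qed.

Lemma sum_ord3 (A : zmodType) (f : 'I_3 -> A) : \sum_a f a = f i + f j + f l.
Proof.
rewrite (bigD1 i) //= (bigD1 j) 1?eq_sym //= (bigD1 l) /=; last first.
  by rewrite ![l == _]eq_sym il jl.
rewrite big1 ?addr0 ?addrA // => a /andP[/andP[/negPf ai /negPf aj]].
by have := cases a; rewrite ai aj /= => ->.
Qed.

Definition jac (P Q : {mpoly K[3]}) := P^`M(i) * Q^`M(j) - P^`M(j) * Q^`M(i).

(** If v_l were 0, Euler's relations would put (v_i, v_j) in the kernel of the matrix with
    determinant [jac P Q] at v, and v would be 0. *)
Lemma jac_coord_neq0 d k (P Q : {mpoly K[3]}) :
  P \is d.-homog -> Q \is k.-homog -> v != 0 -> P.@[v 0] = 0 -> Q.@[v 0] = 0 ->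
  (jac P Q).@[v 0] != 0 -> v 0 l != 0.
Proof.
move=> hP hQ nzv Pv Qv; apply: contraNneq => vl.
have euler N (R : {mpoly K[3]}) : R \is N.-homog -> R.@[v 0] = 0 ->
    v 0 i * (R^`M(i)).@[v 0] + v 0 j * (R^`M(j)).@[v 0] = 0.
  move=> hR Rv; have := congr1 (meval (v 0)) (homog_euler hR).
  by rewrite sum_ord3 !mevalD !mevalM !mevalXU vl mul0r addr0 mevalMn Rv mul0rn.
have eP := euler _ _ hP Pv; have eQ := euler _ _ hQ Qv.
rewrite /jac mevalB !mevalM.
set Pi := meval _ _ in eP *; set Pj := meval _ _ in eP *.
set Qi := meval _ _ in eQ *; set Qj := meval _ _ in eQ *.
have Ei : v 0 i * (Pi * Qj - Pj * Qi) = 0.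
  have -> : v 0 i * (Pi * Qj - Pj * Qi) = (v 0 i * Pi + v 0 j * Pj) * Qj - Pj * (v 0 i * Qi + v 0 j * Qj) by ring.
  by rewrite eP eQ; ring.
have Ej : v 0 j * (Pi * Qj - Pj * Qi) = 0.
  have -> : v 0 j * (Pi * Qj - Pj * Qi) = Pi * (v 0 i * Qi + v 0 j * Qj) - (v 0 i * Pi + v 0 j * Pj) * Qi by ring.
  by rewrite eP eQ; ring.
apply/eqP; apply: contraNeq nzv => nz; apply/eqP/rowP => a; rewrite mxE.
have /eqP vi : v 0 i == 0 by move/eqP: Ei; rewrite mulf_eq0 [X in _ || X](negPf nz) orbF.
have /eqP vj : v 0 j == 0 by move/eqP: Ej; rewrite mulf_eq0 [X in _ || X](negPf nz) orbF.
by have := cases a => /or3P[] /eqP ->.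
Qed.

(** Compare the substitutions X_a := v_l X_a and X_a := v_a X_l: the first gives v_l^N P and the
    second X_l^N P(v) = 0. For a = l they coincide, so two generators remain. *)
Lemma vanishing_decomp N (P : {mpoly K[3]}) : P \is N.-homog -> P.@[v 0] = 0 ->
  exists P1 P2, [/\ P1 \is N.-1.-homog, P2 \is N.-1.-homog &
    v 0 l ^+ N *: P = (v 0 l *: 'X_i - v 0 i *: 'X_l) * P1 + (v 0 l *: 'X_j - v 0 j *: 'X_l) * P2].
Proof.
case: N => [|N] hP Pv.
  exists 0, 0; rewrite !rpred0 !mulr0 addr0 scale1r; split=> //.
  by move: Pv; rewrite (homog0_const hP) mevalC => ->; rewrite mpolyC0.
have [g Dg] := msubst_diff (fun a => v 0 l *: 'X_a) (fun a => v 0 a *: 'X_l) P.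
have E1 : msubst (fun a => v 0 l *: 'X_a) P = v 0 l ^+ N.+1 *: P.
  apply: mpoly_ext => u; rewrite msubst_meval mevalZ; apply: (meval_homogZ hP) => a.
  by rewrite mevalZ mevalXU.
have E2 : msubst (fun a => v 0 a *: 'X_l) P = 0.
  apply: mpoly_ext => u; rewrite msubst_meval meval0.
  rewrite (@meval_homogZ _ _ _ _ (u l) (v 0) _ hP) ?Pv ?mulr0 // => a.
  by rewrite mevalZ mevalXU mulrC.
have hX a : v 0 l *: 'X_a - v 0 a *: 'X_l \is [in K[3], 1.-homog].
  by apply: rpredB; apply/rpredZ/homogX.
exists (pihomog mdeg N (g i)), (pihomog mdeg N (g j)); split; try exact: pihomogP.
rewrite -(pihomogMl N (g i) (hX i)) -(pihomogMl N (g j) (hX j)) -pihomogD.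
have hl : v 0 l ^+ N.+1 *: P \is N.+1.-homog by apply: rpredZ.
rewrite -[LHS](pihomog_dE hl).
rewrite -E1 -[msubst _ P]subr0 -E2 Dg sum_ord3 subrr mulr0 addr0.
by rewrite mulrC [g j * _]mulrC.
Qed.

(* Cramer's rule: F and N are combinations of X = v_l X_i - v_i X_l and
   Y = v_l X_j - v_j X_l, whose determinant is nonzero at v; so X and Y, and
   hence P, are combinations of F and N after multiplication by it. *)
Lemma local_division d k m (F N P : {mpoly K[3]}) :
  F \is d.-homog -> N \is k.-homog -> P \is m.-homog ->
  v != 0 -> F.@[v 0] = 0 -> N.@[v 0] = 0 -> P.@[v 0] = 0 -> (jac F N).@[v 0] != 0 ->
  exists e V, [/\ V \is e.-homog, V.@[v 0] != 0 & exists U W, V * P = N * U + W * F].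
Proof.
move=> hF hN hP nzv Fv Nv Pv nzJ; have nzl := jac_coord_neq0 hF hN nzv Fv Nv nzJ.
have [P1 [P2 [_ _ DP]]] := vanishing_decomp hP Pv.
have [F1 [F2 [hF1 hF2 DF]]] := vanishing_decomp hF Fv.
have [N1 [N2 [hN1 hN2 DN]]] := vanishing_decomp hN Nv.
set X := _ - _ in DP DF DN; set Y := v 0 l *: 'X_j - _ in DP DF DN.
pose V := N1 * F2 - N2 * F1.
have hV : V \is (k.-1 + d.-1).-homog by apply: rpredB; apply: dhomogM.
have X0 : X.@[v 0] = 0 by rewrite /X mevalB !mevalZ !mevalXU mulrC subrr.
have Y0 : Y.@[v 0] = 0 by rewrite /Y mevalB !mevalZ !mevalXU mulrC subrr.
(* X and Y vanish at v, so the partial derivatives of Q at v are Q1(v) and Q2(v) up to powers of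
   v_l. Hence V(v) is the Jacobian up to sign and such powers. *)
have di e Q Q1 Q2 : v 0 l ^+ e *: Q = X * Q1 + Y * Q2 -> v 0 l ^+ e * (Q^`M(i)).@[v 0] = v 0 l * Q1.@[v 0].
  move=> /(congr1 (fun R => (R^`M(i)).@[v 0])); rewrite mderivZ mevalZ => ->.
  rewrite mderivD !mderivM !mevalD !mevalM X0 Y0 !mul0r !addr0.
  rewrite !mderivB !mderivZ !mderivXU eqxx ![_ == i]eq_sym (negPf ij) (negPf il) !scaler0 subrr subr0.
  by rewrite meval0 mul0r addr0 mevalZ meval1 mulr1.
have dj e Q Q1 Q2 : v 0 l ^+ e *: Q = X * Q1 + Y * Q2 -> v 0 l ^+ e * (Q^`M(j)).@[v 0] = v 0 l * Q2.@[v 0].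
  move=> /(congr1 (fun R => (R^`M(j)).@[v 0])); rewrite mderivZ mevalZ => ->.
  rewrite mderivD !mderivM !mevalD !mevalM X0 Y0 !mul0r !addr0.
  rewrite !mderivB !mderivZ !mderivXU eqxx (negPf ij) [l == j]eq_sym (negPf jl) !scaler0 subrr subr0.
  by rewrite meval0 mul0r add0r mevalZ meval1 mulr1.
have nzV : V.@[v 0] != 0.
  have nz2 : v 0 l ^+ d * v 0 l ^+ k != 0 by rewrite mulf_neq0 // expf_neq0.
  apply: contraNneq nzJ => V0; rewrite -(mulrI_eq0 _ (mulfI nz2)) /jac mevalB !mevalM.
  have -> : v 0 l ^+ d * v 0 l ^+ k * ((F^`M(i)).@[v 0] * (N^`M(j)).@[v 0] - (F^`M(j)).@[v 0] * (N^`M(i)).@[v 0])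
    = (v 0 l ^+ d * (F^`M(i)).@[v 0]) * (v 0 l ^+ k * (N^`M(j)).@[v 0])
     - (v 0 l ^+ d * (F^`M(j)).@[v 0]) * (v 0 l ^+ k * (N^`M(i)).@[v 0]) by ring.
  rewrite (di _ _ _ _ DF) (di _ _ _ _ DN) (dj _ _ _ _ DF) (dj _ _ _ _ DN).
  have := V0; rewrite /V mevalB !mevalM => V0'.
  apply/eqP; transitivity (- (v 0 l ^+ 2) * (N1.@[v 0] * F2.@[v 0] - N2.@[v 0] * F1.@[v 0])); first by ring.
  by rewrite V0' mulr0.
exists (k.-1 + d.-1)%N, (v 0 l ^+ m *: V); split.
- exact: rpredZ.
- by rewrite mevalZ mulf_neq0 // expf_neq0.
exists (v 0 l ^+ k *: (P1 * F2 - P2 * F1)), (v 0 l ^+ d *: (P2 * N1 - P1 * N2)).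
rewrite -scalerAl scalerAr DP [N * (_ *: _)]mulrC -2!scalerAl.
rewrite [_ *: (_ * N)]scalerAr DN [_ *: (_ * F)]scalerAr DF /V; ring.
Qed.

End LocalDivision.

(** * The fibre of f = (A0 : A1) over t, cut out by A0 - t A1 *)

Section Fibre.
Variables (K : closedFieldType) (d : nat) (F : {mpoly K[3]}).
Hypotheses (Fhom : F \is d.-homog) (Firr : irreducible_mpoly F).
Variables (k : nat) (A0 A1 : {mpoly K[3]}) (t : K).
Hypotheses (hA0 : A0 \is k.-homog) (hA1 : A1 \is k.-homog).
Implicit Types (v w q : 'rV[K]_3).

Let N := A0 - t *: A1.
Hypothesis nzN : ~ (exists Q, N = Q * F).

Let hN : N \is k.-homog. Proof. by apply: rpredB => //; apply: rpredZ. Qed.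

(* (B0 : B1) is another expression of f = (A0 : A1), valid near v even if v is a
   base point of (A0, A1), and f v is not t. *)
Definition off_fibre v := exists e B0 B1, [/\ B0 \is e.-homog, B1 \is e.-homog,
  (B0 - t *: B1).@[v 0] != 0 & exists Q, A0 * B1 - A1 * B0 = Q * F].

Variable s : seq 'rV[K]_3.
Hypothesis sF : forall u, u \in s -> F.@[u 0] = 0.
Hypothesis sN : forall u, u \in s -> N.@[u 0] = 0.
Hypothesis sJ : forall u, u \in s ->
  exists i j l : 'I_3, [/\ i != j, i != l, j != l & (jac i j F N).@[u 0] != 0].
Hypothesis soff : forall v, v != 0 -> F.@[v 0] = 0 ->
  (exists2 u, u \in s & exists c, v = c *: u) \/ off_fibre v.

(** P A / N has no pole on the curve: at the points of s, N is a local parameter and P vanishes;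
    elsewhere A / N equals B0 or B1 over B0 - t B1, which is nonzero there. *)
Lemma fibre_regular m P A : P \is m.-homog -> (forall u, u \in s -> P.@[u 0] = 0) ->
  A = A0 \/ A = A1 -> exists M W, M \is m.-homog /\ P * A = N * M + W * F.
Proof.
move=> hP Ps HA; have hA : A \is k.-homog by case: HA => ->.
apply: (curve_regular Fhom Firr _ hN nzN); first by rewrite addnC; apply: dhomogM.
move=> v nzv Fv; have [[u us [c Dv]]|[e [B0 [B1 [hB0 hB1 nzB [Q HQ]]]]]] := soff nzv Fv.
  have nzc : c != 0 by apply: contraNneq nzv => c0; rewrite Dv c0 scale0r.
  have nzu : u != 0 by apply: contraNneq nzv => u0; rewrite Dv u0 scaler0.
  have [i [j [l [ij il jl J]]]] := sJ us.
  have [e [V [hV nzV [U [W H]]]]] :=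
    local_division ij il jl Fhom hN hP nzu (sF us) (sN us) (Ps u us) J.
  exists e, V; split=> //.
    rewrite (@meval_homogZ _ _ _ _ c (u 0) _ hV) ?mulf_neq0 ?expf_neq0 // => a.
    by rewrite Dv mxE.
  by exists (U * A), (W * A); rewrite mulrA H; ring.
exists e, (B0 - t *: B1); split=> //; first by apply: rpredB => //; apply: rpredZ.
rewrite /N -!mul_mpolyC; case: HA => ->.
  exists (P * B0), (- t%:MP * P * Q).
  have -> : - t%:MP * P * Q * F = - t%:MP * P * (Q * F) by ring.
  by rewrite -HQ; ring.
exists (P * B1), (- P * Q).
have -> : - P * Q * F = - P * (Q * F) by ring.
by rewrite -HQ; ring.
Qed.

Hypothesis sA1 : forall u, u \in s -> A1.@[u 0] != 0.
Hypothesis sdist : distinct_points s.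
Hypothesis smooth : forall u, u \in s -> exists i : 'I_3, (F^`M(i)).@[u 0] != 0.

Lemma restr_dvd q w P Q : P = Q * F -> restr q w F %| restr q w P.
Proof. by move=> ->; rewrite rmorphM dvdp_mulIr. Qed.

(** w is any point where none of F, the tangent at q and the lines chosen through q and each u in s
    vanishes; such a point exists because the product of these forms is nonzero. *)
Lemma good_direction q : q \in s -> exists w : 'rV[K]_3, [/\ F.@[w 0] != 0,
  \sum_i w 0 i * (F^`M(i)).@[q 0] != 0 &
  forall u, u \in s -> u != q -> exists c, [/\ (linform c).@[u 0] = 0,
    (linform c).@[q 0] = 0 & (linform c).@[w 0] != 0]].
Proof.
move=> qs; have [us nz ds] := sdist.
have [i nzi] := smooth qs.
pose g : 'cV[K]_3 := \col_i (F^`M(i)).@[q 0].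
have nzg : linform g != 0.
  by apply: linform_neq0; apply: contraNneq nzi => /colP /(_ i); rewrite !mxE => ->.
have [P nzP HP] : exists2 P : {mpoly K[3]}, P != 0 & forall w, P.@[w 0] != 0 ->
    forall u, u \in s -> u != q -> exists c, [/\ (linform c).@[u 0] = 0,
    (linform c).@[q 0] = 0 & (linform c).@[w 0] != 0].
  elim: (s) => [|u r [P nzP HP]]; first by exists 1; rewrite ?oner_neq0.
  have [c [nzc cu cq]] := linform_through u q.
  exists (linform c * P); first by rewrite mulf_neq0 ?linform_neq0.
  move=> w; rewrite mevalM mulf_eq0 negb_or => /andP[cw Pw] v; rewrite inE => /orP[/eqP ->|vr] vq.
    by exists c.
  exact: HP.
have [x] := mpoly_nonroot (mulf_neq0 (mulf_neq0 (irr_neq0 Firr) nzg) nzP).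
rewrite -(meval_row x) !mevalM !mulf_eq0 !negb_or => /andP[/andP[Fx gx] Px].
exists (\row_j x j); split=> //; last exact: HP.
by move: gx; rewrite linform_meval mxE; under eq_bigr do rewrite [g _ _]mxE.
Qed.

(* The restriction phi of F to a general line l = {c = 0} through q is x E(x), where
   the roots of E are the points of the curve on l other than q. The form M of degree
   d - 2 inducing G c A1 / N vanishes at them with multiplicity, so it vanishes on
   l, being of degree less than that of E. Comparing gradients at q in
   G c A1 = N M + W F gives W(q) = 0, because l is not tangent at q, and then
   G(q) = 0. *)
Lemma fibre_cayley_bacharach : (2 < d)%N -> cayley_bacharach (d - 3) s.
Proof.
move=> d3 G hG q qs Gs; have [us nz ds] := sdist.
have [w [Fw gw Hw]] := good_direction qs.
have [c [nzc cq cw]] := linform_through q w.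
have hGl : G * linform c \is [in K[3], (d - 2).-homog].
  have E : (d - 3 + 1 = d - 2)%N by clear -d3; lia.
  by have := dhomogM hG (linform_homog c); rewrite E.
have [|M [W [hM HM]]] := fibre_regular hGl _ (or_intror erefl).
  move=> u us'; rewrite mevalM; have [->|uq] := eqVneq u q; first by rewrite cq mulr0.
  by rewrite Gs ?mul0r.
have euler : \sum_i q 0 i * (F^`M(i)).@[q 0] = 0.
  have := congr1 (meval (q 0)) (homog_euler Fhom); rewrite mevalMn (sF qs) mul0rn raddf_sum /=.
  move=> E0; rewrite -[RHS]E0; by apply: eq_bigr => i _; rewrite mevalM mevalXU.
have restr_c : restr q w (linform c) = 0.
  rewrite raddf_sum /= -[RHS](_ : ((q *m c) 0 0)%:P + ((w *m c) 0 0) *: 'X = 0); last first.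
    by rewrite -!linform_meval cq cw scale0r addr0.
  rewrite !mxE rmorph_sum scaler_suml -big_split; apply: eq_bigr => i _ /=.
  by rewrite -mul_mpolyC rmorphM /= restrC restrX mulrDr -polyCM mulrC mul_polyC scalerA ![c i 0 * _]mulrC.
have [sphi phid] := restr_top q w Fhom; set phi := restr q w F in sphi phid.
have phi0 : phi.[0] = 0 by rewrite restr_horner scale0r addr0 sF.
have /factor_theorem[E] : root phi 0 by apply/eqP.
rewrite subr0 => DE.
have nzphi : phi != 0 by apply: contraNneq Fw => p0; rewrite -phid p0 coef0.
have nzE : E != 0 by apply: contraNneq nzphi => E0; rewrite DE E0 mul0r.
have sE : size E = d.
  have : size phi = d.+1.
    apply/eqP; rewrite eqn_leq sphi ltnNge; apply: contra Fw => le.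
    by rewrite -phid nth_default.
  by rewrite DE size_mulX // => -[].
have E0 : ~~ root E 0.
  apply: contra gw => /eqP E0; have := restr_deriv q w F.
  move/(congr1 (fun p => p.[0])); rewrite -/phi DE derivM derivX mulr1 hornerD hornerMX mulr0 add0r E0.
  rewrite horner_sum => H; rewrite [X in _ == X]H; apply/eqP/eq_bigr => i _.
  by rewrite hornerZ restr_horner scale0r addr0.
(* At a root x of E, the point q + x w of the curve is off the fibre. For the expression (B0 : B1)
   valid there, M (B0 - t B1) = G c B1 modulo F, and c vanishes on the line; so phi, and hence E,
   divides the restriction of M (B0 - t B1). *)
have dvE : E %| restr q w M.
  apply: dvdp_local => // x rx.
  have nzx : x != 0 by apply: contraNneq E0 => <-.
  have Fx : F.@[(q + x *: w) 0] = 0 by rewrite -restr_horner -/phi DE hornerM (eqP rx) mul0r.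
  (* Pairing with the gradient at q shows that b q - x w is never 0, so q + x w is neither 0 nor a
     multiple of q. *)
  have grad b : \sum_i (b *: q - x *: w) 0 i * (F^`M(i)).@[q 0] != 0.
    under eq_bigr do rewrite !mxE mulrBl -!mulrA; rewrite sumrB -!mulr_sumr euler mulr0 sub0r.
    by rewrite oppr_eq0 mulf_neq0.
  have nzqx b : b *: q - x *: w != 0.
    by apply: contraNneq (grad b) => ->; apply/eqP/big1 => i _; rewrite mxE mul0r.
  have nzv : q + x *: w != 0.
    by have := nzqx (-1); rewrite scaleN1r -opprD oppr_eq0.
  have [[u us' [b Dv]]|[e [B0 [B1 [hB0 hB1 nzB [Q HQ]]]]]] := soff nzv Fx.
    have [Du|uq] := eqVneq u q.
      by have := nzqx (b - 1); rewrite scalerBl scale1r -{1}Du -Dv [q + _]addrC addrK subrr eqxx.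
    have [c' [c'u c'q]] := Hw u us' uq; case/negP.
    have lD : (linform c').@[(q + x *: w) 0] = (linform c').@[q 0] + x * (linform c').@[w 0].
      by rewrite !linform_meval mulmxDl -scalemxAl !mxE.
    have lZ : (linform c').@[(b *: u) 0] = b * (linform c').@[u 0].
      by rewrite !linform_meval -scalemxAl !mxE.
    by move/eqP: lD; rewrite Dv lZ c'u c'q mulr0 add0r eq_sym mulf_eq0 (negPf nzx).
  exists (restr q w (B0 - t *: B1)); first by rewrite /root restr_horner.
  have hB : B0 - t *: B1 \is e.-homog by apply: rpredB => //; apply: rpredZ.
  have hX : M * (B0 - t *: B1) - G * linform c * B1 \is [in K[3], (d - 2 + e).-homog].
    by apply: rpredB; apply: dhomogM.
  have [||[R HR]] := curve_prime Fhom Firr hN hX.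
  - exists (- W * (B0 - t *: B1) - G * linform c * Q).
    have -> : (- W * (B0 - t *: B1) - G * linform c * Q) * F =
      - (W * F) * (B0 - t *: B1) - G * linform c * (Q * F) by ring.
    rewrite -HQ; have -> : W * F = G * linform c * A1 - N * M by rewrite HM; ring.
    rewrite /N -!mul_mpolyC; ring.
  - by [].
  have := restr_dvd q w HR; rewrite rmorphB !rmorphM /= restr_c mulr0 mul0r subr0.
  by apply: dvdp_trans; rewrite -/phi DE dvdp_mulIl.
have M0 : restr q w M = 0.
  apply/eqP; apply: contraTT dvE => nzM; rewrite gtNdvdp // sE.
  have [sM _] := restr_top q w hM; apply: (leq_ltn_trans sM); clear -d3; lia.
have Mq : M.@[q 0] = 0.
  by have := congr1 (fun p => p.[0]) M0; rewrite restr_horner scale0r addr0 horner0.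
have grad i : G.@[q 0] * A1.@[q 0] * c i 0 = W.@[q 0] * (F^`M(i)).@[q 0].
  move: (N) HM (sN qs) => N' HM' Nq; have := congr1 (fun P => (P^`M(i)).@[q 0]) HM'.
  have dc : (linform c)^`M(i) = (c i 0)%:MP.
    rewrite raddf_sum /= (bigD1 i) //= mderivZ mderivXU eqxx big1 ?addr0 => [|j ji].
      by rewrite -mul_mpolyC mulr1.
    by rewrite mderivZ mderivXU (negPf ji) scaler0.
  rewrite mderivD !mderivM dc !mevalD !mevalM !mevalD !mevalM mevalC cq Nq (sF qs) Mq.
  by rewrite !(mulr0, mul0r, addr0, add0r) => <-; ring.
have W0 : W.@[q 0] = 0.
  apply/eqP; move: gw; apply: contraNT => nzW.
  rewrite -(mulrI_eq0 _ (mulfI nzW)) mulr_sumr.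
  have : G.@[q 0] * A1.@[q 0] * (linform c).@[w 0] = 0 by rewrite cw mulr0.
  rewrite linform_meval mxE mulr_sumr => E1; rewrite -[X in _ == X]E1; apply/eqP/eq_bigr => i _.
  by rewrite mulrCA -grad; ring.
have [i nzi] := cV0Pn _ nzc.
have := grad i; rewrite W0 mul0r => /eqP; rewrite !mulf_eq0 (negPf nzi) (negPf (sA1 qs)) !orbF.
by move/eqP.
Qed.

End Fibre.

Lemma vlineZ (K : fieldType) (V : vectType K) (c : K) (v : V) : c != 0 ->
  <[c *: v]>%VS = <[v]>%VS.
Proof.
move=> nzc; apply/eqP; rewrite eqEdim -memvE rpredZ ?memv_line //=.
by rewrite !dim_vline scaler_eq0 (negPf nzc).
Qed.

(** * Points, morphisms and rational functions *)

Section Points.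
Variables (K : closedFieldType) (n : nat).
Implicit Types (x y : proj_space K n) (v : 'rV[K]_n.+1) (P : {mpoly K[n.+1]}).

Definition hcoord x : 'rV[K]_n.+1 := vpick (val x).

Lemma hcoord_neq0 x : hcoord x != 0.
Proof. by rewrite vpick0 -dimv_eq0 (eqP (valP x)). Qed.

Lemma hcoordK x : val x = <[hcoord x]>%VS.
Proof.
apply/esym/eqP; rewrite eqEdim -memvE memv_pick /=.
by rewrite (eqP (valP x)) dim_vline hcoord_neq0.
Qed.

Lemma evE P x : ev P x = P.@[hcoord x 0]. Proof. by []. Qed.

Lemma zerosE P x : (x \in zeros P) = (P.@[hcoord x 0] == 0). Proof. by []. Qed.

Lemma proj_space_eq x y : val x = val y -> x = y.
Proof. exact: val_inj. Qed.

Definition pt v (nz : v != 0) : proj_space K n :=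
  exist _ <[v]>%VS (introT eqP (etrans (dim_vline v) (congr1 nat_of_bool nz))).

Lemma hcoord_vline v x : val x = <[v]>%VS -> exists2 c, c != 0 & hcoord x = c *: v.
Proof.
move=> Dx; have : hcoord x \in <[v]>%VS by rewrite -Dx memv_pick.
case/vlineP => c Dc; exists c => //; apply: contraNneq (hcoord_neq0 x) => c0.
by rewrite Dc c0 scale0r.
Qed.

Lemma ev_vline v x e P : val x = <[v]>%VS -> P \is e.-homog ->
  exists2 c, c != 0 & ev P x = c ^+ e * P.@[v 0].
Proof.
move=> /hcoord_vline[c nzc Dx] hP; exists c => //.
by apply: (meval_homogZ hP) => i; rewrite -[vpick _]/(hcoord x) Dx mxE.
Qed.

Lemma ev_vline_eq0 v x e P : val x = <[v]>%VS -> P \is e.-homog ->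
  (ev P x == 0) = (P.@[v 0] == 0).
Proof.
move=> Dx hP; have [c nzc ->] := ev_vline Dx hP.
by rewrite mulf_eq0 expf_eq0 (negPf nzc) andbF.
Qed.

Lemma vline_eqP v w : v != 0 -> <[v]>%VS = <[w]>%VS <-> exists2 c, c != 0 & v = c *: w.
Proof.
move=> nzv; split=> [vw|[c nzc ->]]; last by rewrite vlineZ.
have /vlineP[c Dv] : v \in <[w]>%VS by rewrite -vw memv_line.
by exists c => //; apply: contraNneq nzv => c0; rewrite Dv c0 scale0r.
Qed.

End Points.

Lemma ord2P (j : 'I_2) : j = 0 \/ j = 1.
Proof. by case: j => -[|[|//]] j; [left|right]; apply/val_inj. Qed.

Lemma row2P (K : fieldType) (u v : 'rV[K]_2) : u 0 0 = v 0 0 -> u 0 1 = v 0 1 -> u = v.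
Proof.
move=> H0 H1; apply/rowP => -[[|[|//]] j]; [move: H0|move: H1];
  by congr (_ = _); congr (_ _ _); apply/val_inj.
Qed.

Lemma vline2_eq (K : fieldType) (u v : 'rV[K]_2) : u != 0 -> v != 0 ->
  u 0 0 * v 0 1 = u 0 1 * v 0 0 -> <[u]>%VS = <[v]>%VS.
Proof.
move=> nzu nzv H.
have [v1|v1] := eqVneq (v 0 1) 0.
  have v0 : v 0 0 != 0 by apply: contra_neq nzv => v0; apply: row2P; rewrite ?v0 ?v1 mxE.
  have u1 : u 0 1 = 0.
    by apply/eqP; move/eqP: H; rewrite v1 mulr0 eq_sym mulf_eq0 (negPf v0) orbF.
  have Du : u = (u 0 0 / v 0 0) *: v by apply: row2P; rewrite !mxE ?divfK // u1 v1 mulr0.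
  rewrite Du vlineZ //; apply: contraNneq nzu => c0.
  by rewrite Du c0 scale0r.
have Du : u = (u 0 1 / v 0 1) *: v.
  by apply: row2P; rewrite !mxE ?divfK // mulrAC -H mulfK.
by rewrite Du vlineZ //; apply: contraNneq nzu => c0; rewrite Du c0 scale0r.
Qed.

Definition row2 (K : fieldType) (a b : K) : 'rV[K]_2 := \row_j (if j == 0 then a else b).

Lemma row2_neq0r (K : fieldType) (a b : K) : b != 0 -> row2 a b != 0.
Proof. by apply: contraNneq => /rowP /(_ 1); rewrite !mxE /= => ->. Qed.

Lemma row2_neq0l (K : fieldType) (a b : K) : a != 0 -> row2 a b != 0.
Proof. by apply: contraNneq => /rowP /(_ 0); rewrite !mxE /= => ->. Qed.

(** * Morphisms from the curve to P^1 as pairs of forms *)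

Section Morphism.
Variables (K : closedFieldType) (d : nat) (F : {mpoly K[3]}).
Hypotheses (Fhom : F \is d.-homog) (Firr : irreducible_mpoly F).
Variable f : proj_space K 2 -> proj_space K 1.
Hypothesis fmor : morphism_on (zeros F) f.
Hypothesis fsurj : forall q, exists2 x, x \in zeros F & f x = q.

(** The determinant whose vanishing on the curve expresses that (A 0 : A 1) and (B 0 : B 1)
    agree. *)
Definition cross (A B : 'I_2 -> {mpoly K[3]}) := A 0 * B 1 - A 1 * B 0.

Lemma zeros_pt (v : 'rV[K]_3) (nz : v != 0) : F.@[v 0] = 0 -> pt nz \in zeros F.
Proof.
by move=> Fv; have := ev_vline_eq0 (erefl : val (pt nz) = _) Fhom; rewrite Fv eqxx.
Qed.

Lemma nonzero_on_ev e P x : P \is e.-homog -> x \in zeros F -> ev P x != 0 -> nonzero_on F P.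
Proof. by move=> hP /eqP Fx nz; exists (hcoord x); rewrite hcoord_neq0. Qed.

Lemma cross_homog e e' A B : (forall j, A j \is e.-homog) -> (forall j, B j \is e'.-homog) ->
  cross A B \is (e + e').-homog.
Proof. by move=> hA hB; apply: rpredB; apply: dhomogM. Qed.

Lemma row_ev_neq0 x (A : 'I_2 -> {mpoly K[3]}) : val (f x) = <[\row_j ev (A j) x]>%VS ->
  \row_j ev (A j) x != 0.
Proof.
by move=> Df; have := valP (f x); rewrite /= -[sval _]/(val _) Df dim_vline eqb1.
Qed.

Lemma morphism_global : exists k (A : 'I_2 -> {mpoly K[3]}), [/\ forall j, A j \is k.-homog,
  exists j, nonzero_on F (A j) &
  forall x, x \in zeros F -> exists e (B : 'I_2 -> {mpoly K[3]}),
    [/\ forall j, B j \is e.-homog, val (f x) = <[\row_j ev (B j) x]>%VS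
      & exists Q, cross A B = Q * F]].
Proof.
have [x0 Cx0 _] := fsurj (pt (row2_neq0l 0 (oner_neq0 K))).
have [e0 [H0 [k [A [hH0 nH0 hA fA]]]]] := fmor Cx0.
exists k, A; split=> //.
  have /rV0Pn[j] := row_ev_neq0 (fA _ Cx0 nH0); rewrite mxE => nz.
  by exists j; apply: (nonzero_on_ev (hA j) Cx0).
move=> x Cx; have [e [H [l [B [hH nH hB fB]]]]] := fmor Cx.
exists l, B; split=> //; first exact: fB.
have hAB := cross_homog hA hB.
apply: (curve_zero Fhom Firr hAB) => nAB.
have := curve_nonzeroM Fhom Firr (dhomogM hH hH0) hAB
  (curve_nonzeroM Fhom Firr hH hH0 (nonzero_on_ev hH Cx nH) (nonzero_on_ev hH0 Cx0 nH0)) nAB.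
move=> [v [nzv Fv]]; rewrite !mevalM !mulf_eq0 !negb_or => /andP[/andP[Hv H0v]].
have Cy := zeros_pt nzv Fv; have Dy : val (pt nzv) = <[v]>%VS by [].
have := fA _ Cy; rewrite (ev_vline_eq0 Dy hH0) => /(_ H0v).
have := fB _ Cy; rewrite (ev_vline_eq0 Dy hH) => /(_ Hv) => fBy fAy.
have nA := row_ev_neq0 fAy; rewrite fBy in fAy.
have nB := row_ev_neq0 fBy.
have [c _ Dc] := (vline_eqP _ nB).1 fAy.
have : ev (cross A B) (pt nzv) == 0.
  rewrite evE /cross mevalB !mevalM -!evE.
  move/rowP: Dc => Dc; have := Dc 0; have := Dc 1; rewrite !mxE => -> ->.
  by apply/eqP; ring.
by rewrite (ev_vline_eq0 Dy hAB) => ->.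
Qed.

Variables (k : nat) (A : 'I_2 -> {mpoly K[3]}).
Hypothesis hA : forall j, A j \is k.-homog.
Hypothesis nzA : exists j, nonzero_on F (A j).
Hypothesis fA : forall x, x \in zeros F -> exists e (B : 'I_2 -> {mpoly K[3]}),
    [/\ forall j, B j \is e.-homog, val (f x) = <[\row_j ev (B j) x]>%VS
      & exists Q, cross A B = Q * F].

Lemma zero_on_ev e P x : P \is e.-homog -> ~ nonzero_on F P -> x \in zeros F -> ev P x = 0.
Proof.
move=> hP nP Cx; apply/eqP; apply: contraT => nz; case: nP.
exact: (nonzero_on_ev hP Cx).
Qed.

Lemma cross_trans e e' B B' : (forall j, B j \is e.-homog) -> (forall j, B' j \is e'.-homog) ->
  (exists Q, cross A B = Q * F) -> (exists Q, cross A B' = Q * F) -> ~ nonzero_on F (cross B B').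
Proof.
move=> hB hB' [Q HQ] [Q' HQ'] nBB; have [j nAj] := nzA.
have [v [_ Fv]] := curve_nonzeroM Fhom Firr (hA j) (cross_homog hB hB') nAj nBB.
case/eqP; have : (A j * cross B B') = (B j * Q' - B' j * Q) * F.
  rewrite mulrBl -!mulrA -HQ -HQ' /cross.
  by case: (ord2P j) => ->; ring.
by move=> ->; rewrite mevalM Fv mulr0.
Qed.

(** Taking B to be A computes f off the base points of A; taking B to be a pair of linear forms will
    exhibit f as a projection. *)
Lemma morphism_eval e B x : (forall j, B j \is e.-homog) -> (exists Q, cross A B = Q * F) ->
  x \in zeros F -> \row_j ev (B j) x != 0 -> val (f x) = <[\row_j ev (B j) x]>%VS.
Proof.
move=> hB AB Cx nB; have [e' [B' [hB' fx AB']]] := fA Cx.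
rewrite fx; apply: vline2_eq => //; first exact: (row_ev_neq0 fx).
have := zero_on_ev (cross_homog hB' hB) (cross_trans hB' hB AB' AB) Cx.
rewrite evE /cross mevalB !mevalM -!evE !mxE => /eqP.
by rewrite subr_eq0 => /eqP.
Qed.

(** Otherwise all values of f would satisfy one linear equation, against surjectivity. *)
Lemma morphism_nonconst a b : (a != 0) || (b != 0) -> nonzero_on F (a *: A 0 + b *: A 1).
Proof.
move=> ab; apply: NNPP => nAB; move: ab; apply/negP; rewrite negb_or !negbK.
have H x : x \in zeros F -> exists c : 'rV[K]_2, [/\ val (f x) = <[c]>%VS, c != 0 & a * c 0 0 + b * c 0 1 = 0].
  move=> Cx; have [e [B [hB fx [Q HQ]]]] := fA Cx.
  exists (\row_j ev (B j) x); split=> //; first exact: (row_ev_neq0 fx).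
  have hAB : a *: A 0 + b *: A 1 \is k.-homog by apply: rpredD; apply: rpredZ.
  have hBB : a *: B 0 + b *: B 1 \is e.-homog by apply: rpredD; apply: rpredZ.
  have [j nAj] := nzA.
  suff nBB : ~ nonzero_on F (a *: B 0 + b *: B 1).
    by have := zero_on_ev hBB nBB Cx; rewrite evE mevalD !mevalZ !mxE.
  move=> nBB; have [v [nzv Fv]] := curve_nonzeroM Fhom Firr (hA j) hBB nAj nBB.
  case/eqP.
  have E : A j * (a *: B 0 + b *: B 1) = B j * (a *: A 0 + b *: A 1) +
      (if j == 0 then b%:MP else - a%:MP) * (Q * F).
    rewrite -HQ /cross -!mul_mpolyC.
    by case: (ord2P j) => -> /=; ring.
  rewrite E mevalD !mevalM Fv !mulr0 addr0.
  have [-> | nz] := eqVneq ((a *: A 0 + b *: A 1).@[v 0]) 0; first by rewrite mulr0.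
  by case: nAB; exists v.
have side (u : 'rV[K]_2) : u != 0 -> a * u 0 0 + b * u 0 1 = 0.
  move=> nzu; have [x Cx fx] := fsurj (pt nzu); have [c [Dc nzc Hc]] := H x Cx.
  move: Dc; rewrite fx => /(vline_eqP _ nzu)[l _ ->].
  by rewrite !mxE !(mulrCA _ l) -mulrDr Hc mulr0.
have := side _ (row2_neq0l 0 (oner_neq0 K)); have := side _ (row2_neq0r 0 (oner_neq0 K)).
by rewrite !mxE /= !mulr1 !mulr0 add0r addr0 => -> ->; rewrite eqxx.
Qed.

End Morphism.

Section ProjectiveLine.
Variable K : closedFieldType.

Definition affine_pt (t : K) : proj_space K 1 := pt (row2_neq0r t (oner_neq0 K)).

Lemma affine_pt_ev e (P : {mpoly K[2]}) t : P \is e.-homog ->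
  (ev P (affine_pt t) == 0) = (P.@[row2 t 1 0] == 0).
Proof. by move=> hP; apply: (ev_vline_eq0 _ hP). Qed.

Lemma restr_affine (P : {mpoly K[2]}) t :
  (restr (row2 0 1) (row2 1 0) P).[t] = P.@[row2 t 1 0].
Proof.
rewrite restr_horner; congr meval; congr (fun_of_matrix _ _).
by apply: row2P; rewrite !mxE /= ?mulr1 ?mulr0 ?addr0 ?add0r.
Qed.

Lemma generically_affine P : generically predT P ->
  exists2 h : {poly K}, h != 0 & forall t, h.[t] != 0 -> P (affine_pt t).
Proof.
move=> [e [H [hH [y _ nHy] HP]]].
exists (restr (row2 0 1) (row2 1 0) H); last first.
  by move=> t; rewrite restr_affine => nz; apply: HP => //; rewrite (affine_pt_ev t hH).
(* The point y may be (1 : 0), at infinity. It is moved in the direction (0, 1) to a point with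
   nonzero second coordinate where H is still nonzero. *)
set w := hcoord y in nHy; have nzr : ((w 0 1)%:P + 'X) * restr w (row2 0 1) H != 0.
  rewrite mulf_neq0 //; first by rewrite addrC -(opprK (_%:P)) -polyCN polyXsubC_eq0.
  by apply: contraNneq nHy => /(congr1 (fun p => p.[0])); rewrite restr_horner scale0r addr0 horner0 => /eqP.
have [s] := closed_nonrootP _ nzr; rewrite rootM negb_or /root !hornerE restr_horner => /andP[nz nH].
apply: contraNneq nH => h0; have := restr_affine H (w 0 0 / (w 0 1 + s)); rewrite h0 horner0 => H0.
rewrite (@meval_homogZ _ _ _ _ (w 0 1 + s) (row2 (w 0 0 / (w 0 1 + s)) 1 0) _ hH) -?H0 ?mulr0 // => j.
case: (ord2P j) => ->; rewrite !mxE /= ?mulr0 ?mulr1 ?addr0 //.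
by rewrite mulrC divfK.
Qed.

Lemma rational_affine a : rational_on predT a -> exists p q : {poly K},
  q != 0 /\ forall t, q.[t] != 0 -> a (affine_pt t) = p.[t] / q.[t].
Proof.
move=> [k [G [H [hG hH /generically_affine[h nzh Hh]]]]].
pose g := restr (row2 0 1) (row2 1 0) G; pose q := restr (row2 0 1) (row2 1 0) H.
have nq t : h.[t] != 0 -> q.[t] != 0.
  by move=> /Hh [nz _]; rewrite restr_affine -(affine_pt_ev t hH).
have nzq : q != 0.
  have [t] := closed_nonrootP _ nzh; rewrite /root => /nq; apply: contraNneq => ->.
  by rewrite horner0.
(* The factor h makes the denominator vanish wherever h does, so that the formula for a is only
   claimed where [Hh] gives it. *)
exists (g * h), (q * h); split; first exact: mulf_neq0.
move=> t; rewrite !hornerM mulf_eq0 negb_or => /andP[qt ht].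
have [_ ->] := Hh t ht; rewrite -[RHS]mulf_div divff // mulr1 !restr_affine.
have Dx : val (affine_pt t) = <[row2 t 1]>%VS by [].
have [c nzc Dc] := hcoord_vline Dx.
have E P : P \is k.-homog -> P.@[hcoord (affine_pt t) 0] = c ^+ k * P.@[row2 t 1 0].
  by move=> hP; apply: (meval_homogZ hP) => i; rewrite Dc mxE.
rewrite !evE (E _ hG) (E _ hH).
by rewrite -[LHS]mulf_div divff ?expf_neq0 // mul1r.
Qed.

End ProjectiveLine.

(** With one row more than columns there is a nonzero kernel vector; it is divided by X - t as long
    as all its entries vanish at t. *)
Lemma kernel_nonzero_at (K : fieldType) m (M : 'M[{poly K}]_(m.+1, m)) (t : K) :
  exists2 b : 'rV[{poly K}]_m.+1, b *m M = 0 & exists i, (b 0 i).[t] != 0.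
Proof.
pose M' : 'M[{poly K}]_m.+1 := \matrix_(i, j) if unlift ord_max j is Some j' then M i j' else 0.
have dM' : \det M' == 0.
  rewrite -det_tr; apply/det0P; exists (delta_mx 0 ord_max).
    by apply/eqP => /rowP /(_ ord_max); rewrite !mxE !eqxx => /eqP; rewrite oner_eq0.
  by rewrite -rowE; apply/rowP => j; rewrite !mxE unlift_none.
have [b nzb bM'] := det0P dM'.
have {bM'} bM : b *m M = 0.
  apply/rowP => j; move/rowP/(_ (lift ord_max j)): bM'; rewrite !mxE => E0.
  by rewrite -[RHS]E0; apply: eq_bigr => i _; rewrite !mxE liftK.
have [i0 nzi] := rV0Pn _ nzb; have [n] := ubnP (size (b 0 i0)).
elim: n b {nzb} bM nzi => // n IH b bM nzi lt.
have [ex|nex] := classic (exists i, (b 0 i).[t] != 0); first by exists b.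
have rb i : root (b 0 i) t.
  by apply/eqP; apply/eqP; apply: contraT => nz; case: nex; exists i.
pose b' : 'rV[{poly K}]_m.+1 := \row_i (b 0 i %/ ('X - t%:P)).
have Db : b = ('X - t%:P) *: b'.
  by apply/rowP => i; rewrite !mxE mulrC divpK // dvdp_XsubCl.
apply: (IH b').
- have : ('X - t%:P) *: (b' *m M) = 0 by rewrite scalemxAl -Db.
  by move/eqP; rewrite scalemx_eq0 polyXsubC_eq0 => /eqP.
- by apply: contraNneq nzi => b0; rewrite Db mxE b0 mulr0.
rewrite mxE size_divp ?polyXsubC_eq0 // size_XsubC subn1.
by move: lt nzi; rewrite -size_poly_gt0; case: (size _) => // a; rewrite !ltnS.
Qed.

(* V^n p(U / V), for p of degree at most n. *)
Definition phom (K : closedFieldType) r n (p : {poly K}) (U V : {mpoly K[r]}) :=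
  \sum_(j < n.+1) p`_j *: (U ^+ j * V ^+ (n - j)).

Section Phom.
Variables (K : closedFieldType) (r n : nat) (p : {poly K}) (U V : {mpoly K[r]}).

Lemma phom_homog k : U \is k.-homog -> V \is k.-homog -> phom n p U V \is (k * n).-homog.
Proof.
move=> hU hV; apply: rpred_sum => j _; apply: rpredZ.
have -> : (k * n = k * j + k * (n - j))%N by rewrite -mulnDr subnKC // -ltnS.
by apply: dhomogM; apply: dhomogMn.
Qed.

Lemma phom_meval (v : 'I_r -> K) : (size p <= n.+1)%N -> V.@[v] != 0 ->
  (phom n p U V).@[v] = V.@[v] ^+ n * p.[U.@[v] / V.@[v]].
Proof.
move=> sp nz; rewrite (horner_coef_wide _ sp) raddf_sum mulr_sumr; apply: eq_bigr => j _ /=.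
rewrite mevalZ mevalM !rmorphXn /= exprMn exprVn [RHS]mulrCA; congr (_ * _).
have le : (j <= n)%N by rewrite -ltnS.
have -> : V.@[v] ^+ n = V.@[v] ^+ (n - j) * V.@[v] ^+ j by rewrite -exprD subnK.
by rewrite -mulrA [V.@[v] ^+ j * _]mulrCA mulfV ?expf_neq0 // mulr1 mulrC.
Qed.

Lemma phomZ c : phom n (c *: p) U V = c *: phom n p U V.
Proof. by rewrite scaler_sumr; apply: eq_bigr => j _; rewrite coefZ scalerA. Qed.

Lemma phom0 : phom n 0 U V = 0.
Proof. by apply: big1 => j _; rewrite coef0 scale0r. Qed.

End Phom.

(** * Generic forms and the degree of f *)

Section Generic.
Variables (K : closedFieldType) (d : nat) (F : {mpoly K[3]}).
Hypotheses (Fhom : F \is d.-homog) (Firr : irreducible_mpoly F).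

Definition generic_form (P : {mpoly K[3]}) := (exists e, P \is e.-homog) /\ nonzero_on F P.

Lemma generic_formM P Q : generic_form P -> generic_form Q -> generic_form (P * Q).
Proof.
move=> [[e hP] nP] [[e' hQ] nQ]; split; first by exists (e + e')%N; apply: dhomogM.
exact: (curve_nonzeroM Fhom Firr hP hQ nP nQ).
Qed.

Lemma generic_form_prod (I : finType) (P : I -> {mpoly K[3]}) :
  (exists Q, generic_form Q) -> (forall i, generic_form (P i)) -> generic_form (\prod_i P i).
Proof.
move=> [Q [_ [v [nzv Fv _]]]] HP; apply: (big_ind generic_form) => // [|R S].
  by split; [exists 0%N; apply: dhomog1|exists v; rewrite meval1 oner_neq0].
exact: generic_formM.
Qed.

Lemma generic_form_ev P : generic_form P -> exists2 x, x \in zeros F & ev P x != 0.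
Proof.
move=> [[e hP] [v [nzv Fv Pv]]]; exists (pt nzv); first exact: (zeros_pt Fhom).
by rewrite (@ev_vline_eq0 _ _ v _ e).
Qed.

Lemma evM P Q (x : proj_space K 2) : ev (P * Q) x = ev P x * ev Q x.
Proof. exact: mevalM. Qed.

Lemma ev_prod (I : finType) (P : I -> {mpoly K[3]}) (x : proj_space K 2) :
  ev (\prod_i P i) x = \prod_i ev (P i) x.
Proof. exact: rmorph_prod. Qed.

Lemma generically_form P : generically (zeros F) P -> exists2 H, generic_form H &
  forall x, x \in zeros F -> ev H x != 0 -> P x.
Proof.
move=> [e [H [hH [x Cx nx] HP]]]; exists H => //; split; first by exists e.
exact: (nonzero_on_ev hH Cx nx).
Qed.

Lemma form_generically H (P : proj_space K 2 -> Prop) : generic_form H ->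
  (forall x, x \in zeros F -> ev H x != 0 -> P x) -> generically (zeros F) P.
Proof.
move=> gH HP; have [[e hH] _] := gH; exists e, H; split=> //.
exact: generic_form_ev.
Qed.

Lemma exists_coord : (exists Q, generic_form Q) -> exists l, generic_form 'X_l.
Proof.
move=> [Q [_ [v [nzv Fv _]]]]; have [l nl] := rV0Pn _ nzv.
exists l; split; first by exists 1%N; apply: homogX.
by exists v; rewrite mevalXU.
Qed.

End Generic.

Section Degree.
Variables (K : closedFieldType) (d N : nat) (F : {mpoly K[3]}).
Hypotheses (Fhom : F \is d.-homog) (Firr : irreducible_mpoly F).
Variable f : proj_space K 2 -> proj_space K 1.
Hypothesis fsurj : forall q, exists2 x, x \in zeros F & f x = q.
Hypothesis fdeg : has_degree (zeros F) predT f N.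
Variables (k : nat) (A : 'I_2 -> {mpoly K[3]}).
Hypothesis hA : forall j, A j \is k.-homog.
Hypothesis nzA : exists j, nonzero_on F (A j).
Hypothesis fA : forall x, x \in zeros F -> exists e (B : 'I_2 -> {mpoly K[3]}),
    [/\ forall j, B j \is e.-homog, val (f x) = <[\row_j ev (B j) x]>%VS
      & exists Q, cross A B = Q * F].

Lemma generic_comb a b : (a != 0) || (b != 0) -> generic_form F (a *: A 0 + b *: A 1).
Proof.
move=> ab; split; last exact: (morphism_nonconst Fhom Firr fsurj hA nzA fA).
by exists k; apply: rpredD; apply: rpredZ; apply: hA.
Qed.

Lemma generic_A1 : generic_form F (A 1).
Proof.
by have := @generic_comb 0 1; rewrite oner_neq0 orbT scale0r scale1r add0r => /(_ isT).
Qed.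

(** p splits into linear factors, and each A 0 - a A 1 is nonzero on the irreducible curve because f
    is not constant. *)
Lemma generic_phom n (p : {poly K}) : p != 0 -> (size p <= n.+1)%N -> generic_form F (phom n p (A 0) (A 1)).
Proof.
move=> nzp sp; split; first by exists (k * n)%N; exact: (phom_homog n p (hA 0) (hA 1)).
have [rs Drs] := closed_field_poly_normal p.
have [] : generic_form F (A 1 * \prod_(a <- rs) (A 0 - a *: A 1)).
  apply: (generic_formM Fhom Firr generic_A1).
  elim: rs {Drs} => [|a rs IH].
    rewrite big_nil; have := @generic_form_prod _ _ F Fhom Firr 'I_0 (fun=> 0).
    by rewrite big_ord0; apply; [exists (A 1); apply: generic_A1|case].
  rewrite big_cons; apply: (generic_formM Fhom Firr) => //.
  by have := @generic_comb 1 (- a); rewrite oner_neq0 scale1r scaleNr => /(_ isT).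
move=> _ [v [nzv Fv]]; rewrite mevalM mulf_eq0 negb_or => /andP[nA1 nP].
exists v; split=> //; rewrite phom_meval // mulf_neq0 ?expf_neq0 //.
rewrite Drs hornerZ mulf_neq0 ?lead_coef_eq0 // horner_prod.
move: nP; rewrite rmorph_prod /= !prodf_seq_neq0; apply: sub_all => a /=.
rewrite hornerXsubC mevalB mevalZ; apply: contra => /eqP /(canRL (subrK _)).
by rewrite add0r => /(canRL (divfK nA1)) ->; rewrite subrr.
Qed.

Lemma f_affine x : x \in zeros F -> ev (A 1) x != 0 -> f x = affine_pt (ev (A 0) x / ev (A 1) x).
Proof.
move=> Cx nA1; apply: proj_space_eq.
have cAA : exists Q, cross A A = Q * F by exists 0; rewrite /cross mul0r mulrC subrr.
have nz : \row_j ev (A j) x != 0.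
  by apply: contraNneq nA1 => /rowP /(_ 1); rewrite !mxE => ->.
rewrite (morphism_eval Fhom Firr hA nzA fA hA cAA Cx nz).
apply/(vline_eqP _ nz); exists (ev (A 1) x) => //.
by apply: row2P; rewrite !mxE /= ?mulr1 // mulrC divfK.
Qed.

(* The N + 1 functions G i are linearly dependent over K(f). The coefficients of
   the relation can be chosen not all zero at f = t. *)
Lemma field_relation (t : K) e (G : 'I_N.+1 -> {mpoly K[3]}) : (forall i, G i \is e.-homog) ->
  exists n (b : 'I_N.+1 -> {poly K}), [/\ forall i, (size (b i) <= n.+1)%N,
    exists i, (b i).[t] != 0 & exists Q, \sum_i phom n (b i) (A 0) (A 1) * G i = Q * F].
Proof.
move=> hG; have exg : exists Q, generic_form F Q by exists (A 1); apply: generic_A1.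
have [l gl] := exists_coord exg.
have gH : generic_form F ('X_l ^+ e).
  elim: e {hG} => [|e IH]; last by rewrite exprS; apply: (generic_formM Fhom Firr).
  rewrite expr0; have := @generic_form_prod _ _ F Fhom Firr 'I_0 (fun=> 0).
  by rewrite big_ord0; apply => //; case.
have hH : 'X_l ^+ e \is [in K[3], e.-homog] by rewrite -[e in e.-homog]mul1n; apply/dhomogMn/homogX.
case: fdeg => u [_ _ span].
have /fin_all_exists2[a ra ga] (i : 'I_N.+1) := span (fun x => ev (G i) x / ev ('X_l ^+ e) x)
  (ex_intro _ e (ex_intro _ (G i) (ex_intro _ ('X_l ^+ e) (And3 (hG i) hH
   (form_generically Fhom gH (fun x _ nz => conj nz erefl)))))).
have /fin_all_exists2[Hs gHs HHs] i := generically_form (ga i).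
have /fin_all_exists[p Hp] (ij : 'I_N.+1 * 'I_N) := rational_affine (ra ij.1 ij.2).
have /fin_all_exists[q Hq] ij := Hp ij.
pose qq := \prod_ij q ij.
have nzqq : qq != 0 by apply/prodf_neq0 => ij _; case: (Hq ij).
pose p' ij := p ij * \prod_(ij' | ij' != ij) q ij'.
have ap i j s : qq.[s] != 0 -> a i j (affine_pt s) = (p' (i, j)).[s] / qq.[s].
  have [_ /(_ s) H] := Hq (i, j); rewrite /p' /qq (bigD1 (i, j)) //= !hornerM.
  rewrite mulf_eq0 negb_or => /andP[/H -> nz]; rewrite -mulf_div divff // mulr1 //.
have [b bM [i0 bi0]] := kernel_nonzero_at (\matrix_(i, j) p' (i, j)) t.
pose n := (\max_(i < N.+1) size (b 0%R i))%N.
have sb i : (size (b 0%R i) <= n.+1)%N by apply/leqW/(leq_bigmax i).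
exists n, (b 0); split; [exact: sb|by exists i0|].
have hR : \sum_i phom n (b 0 i) (A 0) (A 1) * G i \is (k * n + e).-homog.
  by apply: rpred_sum => i _; apply: dhomogM => //; apply: phom_homog.
apply: (curve_zero Fhom Firr hR) => nR.
have gR : generic_form F (\sum_i phom n (b 0 i) (A 0) (A 1) * G i) by split=> //; exists (k * n + e)%N.
have gq : generic_form F (phom (size qq) qq (A 0) (A 1)) by apply: generic_phom.
have gprod := generic_form_prod Fhom Firr exg gHs.
have [x Cx] := generic_form_ev Fhom (generic_formM Fhom Firr (generic_formM Fhom Firr gR gH)
  (generic_formM Fhom Firr (generic_formM Fhom Firr gq gprod) generic_A1)).
rewrite !evM ev_prod !mulf_eq0 !negb_or => /andP[/andP[Rx Hx] /andP[/andP[qx /prodf_neq0 Hsx] A1x]].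
case/eqP: Rx; rewrite evE raddf_sum /=.
set s := ev (A 0) x / ev (A 1) x.
have qs : qq.[s] != 0 by move: qx; rewrite evE phom_meval // mulf_eq0 negb_or => /andP[].
transitivity (ev (A 1) x ^+ n * (ev ('X_l ^+ e) x * \sum_i (b 0 i).[s] * (ev (G i) x / ev ('X_l ^+ e) x))).
  rewrite mulr_sumr mulr_sumr; apply: eq_bigr => i _.
  by rewrite mevalM phom_meval // -mulrA; congr (_ * _); rewrite [RHS]mulrCA; congr (_ * _); rewrite mulrC divfK.
rewrite [X in _ * (_ * X)](_ : _ = 0) ?mulr0 //.
transitivity (\sum_j (\sum_i (b 0 i).[s] * (p' (i, j)).[s]) / qq.[s] * u j x).
  under [RHS]eq_bigr do rewrite !mulr_suml.
  rewrite exchange_big; apply: eq_bigr => i _ /=.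
  rewrite (HHs i x Cx (Hsx i isT)) mulr_sumr; apply: eq_bigr => j _.
  by rewrite (f_affine Cx A1x) ap // !mulrA.
apply: big1 => j _; rewrite (_ : \sum_i _ = 0) ?mul0r //.
have := congr1 (fun M : 'rV_N => (M 0 j).[s]) bM; rewrite !mxE horner0 horner_sum => E0.
by rewrite -[RHS]E0; apply: eq_bigr => i _; rewrite mxE [RHS]hornerM.
Qed.

(** Given N + 1 points over t, take forms of degree N, each nonzero at exactly one of them. The
    relation of [field_relation], evaluated at each point, makes every coefficient vanish at t,
    although one does not. *)
Lemma fibre_size (t : K) s : distinct_points s ->
  (forall u : 'rV[K]_3, u \in s -> [/\ F.@[u 0] = 0, (A 1).@[u 0] != 0 & (A 0).@[u 0] = t * (A 1).@[u 0]]) ->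
  (size s <= N)%N.
Proof.
move=> [us nz ds] Hs; rewrite leqNgt; apply/negP => lt.
pose r (i : 'I_N.+1) := nth 0 s i.
have rs i : r i \in s by apply: mem_nth; apply: leq_trans (ltn_ord i) lt.
have rinj i j : r i = r j -> i = j.
  move=> /eqP; rewrite nth_uniq //; first by move/eqP/val_inj.
    exact: leq_trans (ltn_ord i) lt.
  exact: leq_trans (ltn_ord j) lt.
have H i : exists G : {mpoly K[3]}, [/\ G \is N.-homog, forall j, j != i -> G.@[r j 0] = 0 & G.@[r i 0] != 0].
  have [|||G [hG Gt nG]] := @separating_form _ (r i) [seq r j | j <- enum (predC1 i)] N.
  - exact: nz.
  - move=> v /mapP[j]; rewrite mem_enum => /= ji ->; apply: ds => //.
    by apply: contra ji => /eqP /rinj ->.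
  - by rewrite size_map -cardE cardC1 card_ord.
  by exists G; split=> // j ji; apply: Gt; apply: map_f; rewrite mem_enum.
have /fin_all_exists[G HG] := H.
have [|n [b [sb [i bi] [Q HQ]]]] := @field_relation t N G; first by move=> i; case: (HG i).
case/eqP: bi; have := congr1 (meval (r i 0)) HQ.
have [Fr A1r A0r] := Hs _ (rs i); rewrite mevalM Fr mulr0 raddf_sum (bigD1 i) //= big1 ?addr0.
  have [_ _ nG] := HG i; rewrite mevalM phom_meval // A0r mulfK // => /eqP.
  by rewrite !mulf_eq0 expf_eq0 (negPf A1r) (negPf nG) andbF orbF /= => /eqP.
by move=> j ji; have [_ Gj _] := HG j; rewrite mevalM (Gj i) ?mulr0 // eq_sym.
Qed.

End Degree.

Lemma homogXX (A : comNzRingType) n (i l : 'I_n) a m : (a <= m)%N ->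
  'X_i ^+ a * 'X_l ^+ (m - a) \is [in A[n], m.-homog].
Proof.
have h e (c : 'I_n) : 'X_c ^+ e \is [in A[n], (1 * e).-homog] by apply/dhomogMn/homogX.
by move=> le; have := dhomogM (h a i) (h (m - a)%N l); rewrite !mul1n subnKC.
Qed.

(** * Unramified fibres *)

Section Ramification.
Variables (K : closedFieldType) (d N : nat) (F : {mpoly K[3]}).
Hypotheses (charK : [pchar K] =i pred0).
Hypotheses (Fhom : F \is d.-homog) (Firr : irreducible_mpoly F) (d1 : (1 < d)%N).
Variable f : proj_space K 2 -> proj_space K 1.
Hypothesis fsurj : forall q, exists2 x, x \in zeros F & f x = q.
Hypothesis fdeg : has_degree (zeros F) predT f N.
Variables (k : nat) (A : 'I_2 -> {mpoly K[3]}).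
Hypothesis hA : forall j, A j \is k.-homog.
Hypothesis nzA : exists j, nonzero_on F (A j).
Hypothesis fA : forall x, x \in zeros F -> exists e (B : 'I_2 -> {mpoly K[3]}),
    [/\ forall j, B j \is e.-homog, val (f x) = <[\row_j ev (B j) x]>%VS
      & exists Q, cross A B = Q * F].

Lemma generic_linear P : P != 0 -> P \is 1.-homog -> generic_form F P.
Proof.
move=> nzP hP; split; first by exists 1%N.
apply: NNPP => /(curve_zero Fhom Firr hP)[Q DP].
have nzQ : Q != 0 by apply: contraNneq nzP => Q0; rewrite DP Q0 mul0r.
have nzF := irr_neq0 Firr.
have := homog_size nzP hP; rewrite DP msizeM // (homog_size nzF Fhom).
by move: nzQ; rewrite -msize_poly_eq0; move: (mmeasure _ Q) => q; clear -d1; lia.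
Qed.

Variables (i j l : 'I_3).
Hypotheses (ij : i != j) (il : i != l) (jl : j != l).
Hypothesis nzFj : nonzero_on F (F^`M(j)).

(* [jac i j F] is a derivation that preserves the ideal of F and kills X_l; up to
   units, [ramification] is the derivative of A 0 / A 1 on the curve. *)
Definition ramification := A 1 * jac i j F (A 0) - A 0 * jac i j F (A 1).

Lemma jac_homog e P : P \is e.-homog -> jac i j F P \is (d.-1 + e.-1).-homog.
Proof. by move=> hP; apply: rpredB; apply: dhomogM; apply: mderiv_homog. Qed.

Lemma ramification_homog : ramification \is (k + (d.-1 + k.-1)).-homog.
Proof. by apply: rpredB; apply: dhomogM => //; apply: jac_homog. Qed.

Section AtPoint.
Variable v : 'rV[K]_3.
Hypothesis Fv : F.@[v 0] = 0.
Hypothesis Ev : ramification.@[v 0] = 0.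

Let D P := (jac i j F P).@[v 0].

Let DD P Q : D (P + Q) = D P + D Q.
Proof. by rewrite /D /jac !mderivD !mulrDr !(mevalB, mevalD); ring. Qed.

Let DZ c P : D (c *: P) = c * D P.
Proof. by rewrite /D /jac !mderivZ -!scalerAr -scalerBr mevalZ. Qed.

Let DM P Q : D (P * Q) = D P * Q.@[v 0] + P.@[v 0] * D Q.
Proof. by rewrite /D /jac !mderivM !(mevalB, mevalD, mevalM); ring. Qed.

Let D0 : D 0 = 0.
Proof. by rewrite /D /jac !mderiv0 !mulr0 subrr meval0. Qed.

Let D1' : D 1 = 0.
Proof. by rewrite /D /jac -mpolyC1 !mderivC !mulr0 subrr meval0. Qed.

Let DX P n : D (P ^+ n) = n%:R * P.@[v 0] ^+ n.-1 * D P.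
Proof.
elim: n => [|n IH]; first by rewrite expr0 D1' mul0r mul0r.
rewrite exprS DM IH rmorphXn /=; case: n {IH} => [|n]; first by rewrite !mul0r mulr0 addr0 !expr0 !mul1r mulr1.
by rewrite /= [_ ^+ n.+1]exprS -[n.+2%:R]natr1; ring.
Qed.

Let Dsum (I : Type) (r : seq I) P : D (\sum_(a <- r) P a) = \sum_(a <- r) D (P a).
Proof. by elim: r => [|a r IH]; rewrite ?big_nil ?D0 // !big_cons DD IH. Qed.

Lemma jac_ideal Q : D (Q * F) = 0.
Proof. by rewrite DM Fv mulr0 add0r /D (_ : jac i j F F = 0) ?meval0 ?mulr0 // /jac mulrC subrr. Qed.

(** The form is A1^n p(A0 / A1), and A0 / A1 has derivative 0 at v by [Ev], so only A1^n
    contributes. Multiplying by A1 avoids a division at v. *)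
Lemma jac_phom n p : (A 1).@[v 0] * D (phom n p (A 0) (A 1)) =
  n%:R * (phom n p (A 0) (A 1)).@[v 0] * D (A 1).
Proof.
have E : (A 1).@[v 0] * D (A 0) = (A 0).@[v 0] * D (A 1).
  by apply/eqP; rewrite -subr_eq0 -!mevalM -mevalB Ev.
rewrite /phom Dsum raddf_sum mulr_sumr [n%:R * _]mulr_sumr mulr_suml; apply: eq_bigr => m _ /=.
rewrite DZ mevalZ mevalM !rmorphXn /= DM !DX !rmorphXn /=.
have le : (m <= n)%N by rewrite -ltnS.
have -> : n%:R = m%:R + (n - m)%:R :> K by rewrite -natrD subnKC.
move: (n - m)%N => c; move: E.
move: (A 1).@[v 0] (A 0).@[v 0] (D (A 0)) (D (A 1)) => a1 a0 D0' D1'' E.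
have E0 : m%:R * a0 ^+ m.-1 * a0 = m%:R * a0 ^+ m :> K.
  by case: (nat_of_ord m) => [|m']; rewrite ?mul0r // -mulrA -exprSr.
have E1 : c%:R * a1 ^+ c.-1 * a1 = c%:R * a1 ^+ c :> K.
  by case: (c) => [|m']; rewrite ?mul0r // -mulrA -exprSr.
transitivity (p`_m * ((m%:R * a0 ^+ m.-1) * (a1 * D0') * a1 ^+ c + a0 ^+ m * (c%:R * a1 ^+ c.-1 * a1) * D1'')).
  ring.
by rewrite E E1 [_ * (a0 * _)]mulrA E0; ring.
Qed.

Lemma jac_monomial a b : D ('X_i ^+ a * 'X_l ^+ b) =
  - (a%:R * v 0 i ^+ a.-1 * v 0 l ^+ b) * (F^`M(j)).@[v 0].
Proof.
have Dl : D 'X_l = 0.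
  by rewrite /D /jac !mderivXU [l == j]eq_sym [l == i]eq_sym (negPf jl) (negPf il) !mulr0 subrr meval0.
have Di : D 'X_i = - (F^`M(j)).@[v 0].
  by rewrite /D /jac !mderivXU (negPf ij) eqxx mulr0 mulr1 sub0r mevalN.
by rewrite DM !DX Dl Di !rmorphXn /= !mevalXU; ring.
Qed.

Lemma jac_relation m n (b : nat -> {poly K}) :
  let R := \sum_(a < m.+1) phom n (b a) (A 0) (A 1) * ('X_i ^+ a * 'X_l ^+ (m - a)) in
  (A 1).@[v 0] * D R = n%:R * R.@[v 0] * D (A 1) -
   (A 1).@[v 0] * (F^`M(j)).@[v 0] * \sum_(a < m.+1) a%:R * (phom n (b a) (A 0) (A 1)).@[v 0]
      * (v 0 i ^+ a.-1 * v 0 l ^+ (m - a)).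
Proof.
rewrite /= Dsum raddf_sum mulr_sumr [n%:R * _]mulr_sumr mulr_suml [X in _ - X]mulr_sumr -sumrB; apply: eq_bigr => a _ /=.
rewrite DM jac_monomial mulrDr mulrA jac_phom mevalM; ring.
Qed.

End AtPoint.

(* If f has derivative 0, then deriving an equation of X_i / X_l over K(f) gives
   another one of smaller degree. *)
Lemma ramification_relation (nE : ~ nonzero_on F ramification) m n (b : nat -> {poly K}) :
  (forall a, (size (b a) <= n.+1)%N) ->
  (exists Q, \sum_(a < m.+1) phom n (b a) (A 0) (A 1) * ('X_i ^+ a * 'X_l ^+ (m - a)) = Q * F) ->
  forall a, (a <= m)%N -> b a = 0.
Proof.
have gX a : generic_form F 'X_a by apply: generic_linear; rewrite ?mpolyX_neq0 ?homogX.
have gXe a e : generic_form F ('X_a ^+ e).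
  elim: e => [|e IH]; last by rewrite exprS; exact: (generic_formM Fhom Firr (gX a) IH).
  have := @generic_form_prod _ _ F Fhom Firr 'I_0 (fun=> 0).
  by rewrite big_ord0 expr0; apply; [exists 'X_a; exact: gX|case].
have dropz e (c : {poly K}) : (size c <= n.+1)%N -> (exists Q, phom n c (A 0) (A 1) * 'X_l ^+ e = Q * F) -> c = 0.
  move=> sc [Q HQ]; apply/eqP; apply: contraT => nzc.
  have g := generic_phom Fhom Firr fsurj hA nzA fA nzc sc.
  have [_ /(nonzero_on_ndvd)] := generic_formM Fhom Firr g (gXe l e).
  by case; exists Q.
elim: m b => [|m IH] b sb [Q HQ] a.
  rewrite leqn0 => /eqP ->; apply: (dropz 0%N) => //; exists Q.
  by rewrite -HQ big_ord1 !expr0 !mulr1.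
(* These are the coefficients of the derivative of the polynomial with coefficients b, whose root is
   X_i / X_l. *)
pose b' a := (a.+1)%:R *: b a.+1.
have hS m' (c : nat -> {poly K}) :
   \sum_(a < m'.+1) phom n (c a) (A 0) (A 1) * ('X_i ^+ a * 'X_l ^+ (m' - a)) \is [in K[3], (k * n + m').-homog].
  apply: rpred_sum => a' _; apply: dhomogM; first exact: (phom_homog n _ (hA 0) (hA 1)).
  by apply: homogXX; rewrite -ltnS.
have b'0 : forall a, (a <= m)%N -> b' a = 0.
  apply: IH => [a'|]; first by rewrite (leq_trans (size_scale_leq _ _)).
  apply: (curve_zero Fhom Firr (hS m b')) => nR.
  have hFj := mderiv_homog j Fhom; have [_ nA1] := generic_A1 Fhom Firr fsurj hA nzA fA.
  have := curve_nonzeroM Fhom Firr (dhomogM (hS m b') hFj) (hA 1)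
    (curve_nonzeroM Fhom Firr (hS m b') hFj nR nzFj) nA1.
  move=> [v [nzv Fv]] /eqP; apply; rewrite !mevalM.
  have Ev : ramification.@[v 0] = 0 by apply/eqP; apply: contraT => nz; case: nE; exists v.
  have /= := jac_relation Ev m.+1 n b; rewrite HQ jac_ideal // mevalM Fv mulr0 !mulr0 mul0r sub0r.
  move/eqP; rewrite eq_sym oppr_eq0 big_ord_recl mul0r mul0r add0r => /eqP E.
  rewrite -[RHS]E [RHS]mulr_sumr raddf_sum /= [X in X * _]mulr_suml mulr_suml; apply: eq_bigr => c _ /=.
  rewrite /bump /= add1n subSS /b' phomZ mevalM mevalZ mevalM !rmorphXn /= !mevalXU; ring.
case: a => [_|a am]; last first.
  have /eqP := b'0 _ am; rewrite scaler_eq0 (_ : (_ == 0) = false) => [/eqP //|].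
  by rewrite (pcharf0P _).1.
have H1 c : (c < m.+1)%N -> b c.+1 = 0.
  move=> cm; have /eqP := b'0 _ cm; rewrite scaler_eq0 (_ : (_ == 0) = false) => [/eqP //|].
  by rewrite (pcharf0P _).1.
apply: (dropz m.+1) => //; exists Q; rewrite -HQ big_ord_recl /= expr0 mul1r big1 ?addr0 // => c _.
by rewrite /bump /= add1n H1 // phom0 mul0r.
Qed.

(** Otherwise [ramification_relation] would annihilate the nontrivial relation that [field_relation]
    gives between the N + 1 monomials X_i^a X_l^(N - a). *)
Lemma ramification_generic : generic_form F ramification.
Proof.
split; first by exists (k + (d.-1 + k.-1))%N; apply: ramification_homog.
apply: NNPP => nE.
have [|n [b [sb [a ba] [Q HQ]]]] := @field_relation _ d N F Fhom Firr f fsurj fdeg k A hA nzA fA 0 N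
  (fun a => 'X_i ^+ a * 'X_l ^+ (N - a)).
  by move=> a; apply: homogXX; rewrite -ltnS.
have := @ramification_relation nE N n (fun a => b (inord a)).
case/eqP: ba; rewrite -(inord_val a) (ramification_relation nE (m := N) (n := n) (b := fun a => b (inord a))) ?horner0 //.
- by exists Q; rewrite -HQ; apply: eq_bigr => c _; rewrite inord_val.
- by rewrite -ltnS.
Qed.

End Ramification.

Lemma affine_pt_inj (K : closedFieldType) : injective (@affine_pt K).
Proof.
move=> t t' /(congr1 val) /=; have nz := row2_neq0r t (oner_neq0 K).
move/(vline_eqP _ nz) => [c _ Dc].
have := congr1 (fun r : 'rV_2 => r 0 1) Dc; have := congr1 (fun r : 'rV_2 => r 0 0) Dc.
by rewrite !mxE /= mulr1 => -> <-; rewrite mul1r.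
Qed.

(** * An unramified fibre and the pencil of linear forms *)

Section Pencil.
Variables (K : closedFieldType) (d : nat) (F : {mpoly K[3]}).
Hypotheses (charK : [pchar K] =i pred0).
Hypotheses (Fhom : F \is d.-homog) (Firr : irreducible_mpoly F) (d4 : (4 < d)%N).
Hypothesis smooth : forall x : proj_space K 2, x \in zeros F -> exists i : 'I_3, ev (F^`M(i)) x != 0.
Variable f : proj_space K 2 -> proj_space K 1.
Hypothesis fsurj : forall q, exists2 x, x \in zeros F & f x = q.
Hypothesis fdeg : has_degree (zeros F) predT f d.
Variables (k : nat) (A : 'I_2 -> {mpoly K[3]}).
Hypothesis hA : forall j, A j \is k.-homog.
Hypothesis nzA : exists j, nonzero_on F (A j).
Hypothesis fA : forall x, x \in zeros F -> exists e (B : 'I_2 -> {mpoly K[3]}),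
    [/\ forall j, B j \is e.-homog, val (f x) = <[\row_j ev (B j) x]>%VS
      & exists Q, cross A B = Q * F].

Let d1 : (1 < d)%N. Proof. by apply: leq_trans d4. Qed.

(** t avoids the values of f at the finitely many zeros of A 1 times [ramification] on the curve.
    Over such a t, A 0 = t A 1 at u, and [ramification] becomes A 1 times the Jacobian of F and A 0
    - t A 1. *)
Lemma exists_unramified_value : exists t, forall u : 'rV[K]_3, forall nz : u != 0, F.@[u 0] = 0 ->
  f (pt nz) = affine_pt t ->
  (A 1).@[u 0] != 0 /\ exists i j l : 'I_3, [/\ i != j, i != l, j != l &
    (jac i j F (A 0 - t *: A 1)).@[u 0] != 0].
Proof.
have [x Cx _] := fsurj (affine_pt 0); have [j nj] := smooth Cx.
have nFj : nonzero_on F F^`M(j) by apply: (nonzero_on_ev (mderiv_homog j Fhom) Cx nj).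
have [i [l [ij il jl]]] : exists i l : 'I_3, [/\ i != j, i != l & j != l].
  case: (j) => -[|[|[|//]]] lt; [exists 1, ord_max|exists 0, ord_max|exists 0, 1]; split; by [].
have gE := ramification_generic charK Fhom Firr d1 fsurj fdeg hA nzA fA ij il jl nFj.
have gA1 := generic_A1 Fhom Firr fsurj hA nzA fA.
have [[e hAE] nAE] := generic_formM Fhom Firr gA1 gE.
have [ws Hws] := curve_finite Fhom Firr hAE (nonzero_on_ndvd nAE).
have [ts Hts] : exists ts : seq K, forall w x t, w \in ws -> val x = <[w]>%VS -> f x = affine_pt t -> t \in ts.
  elim: ws {Hws} => [|w ws [ts IH]]; first by exists [::].
  have [[x' [t' [Dx' fx']]]|nex] := classic (exists x t, val x = <[w]>%VS /\ f x = affine_pt t).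
    exists (t' :: ts) => v y t; rewrite inE => /orP[/eqP -> Dy fy|vws Dy fy]; rewrite inE; last first.
      by rewrite (IH v y t) ?orbT.
    rewrite (_ : t = t') ?eqxx //; apply: affine_pt_inj; rewrite -fy -fx'; congr f.
    by apply: proj_space_eq; rewrite Dy Dx'.
  exists ts => v y t; rewrite inE => /orP[/eqP -> Dy fy|]; last exact: IH.
  by case: nex; exists y, t.
have [t nt] := closed_field_notin ts.
exists t => u nz Fu fu.
have : (A 1 * ramification F A i j).@[u 0] != 0.
  apply/eqP => AE0; have [w ws' [c Du]] := Hws u nz Fu AE0.
  case/negP: nt; apply: (Hts w (pt nz) t) => //.
  have nc : c != 0 by apply/eqP => c0; move: (nz); rewrite Du c0 scale0r eqxx.
  by rewrite -(vlineZ w nc) -Du.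
rewrite mevalM mulf_eq0 negb_or => /andP[A1u Eu]; split=> //.
exists i, j, l; split=> //; move: Eu.
have Cu := zeros_pt Fhom nz Fu; have Dx : val (pt nz) = <[u]>%VS by [].
have A1x : ev (A 1) (pt nz) != 0 by rewrite (ev_vline_eq0 Dx (hA 1)).
have := f_affine Fhom Firr hA nzA fA Cu A1x; rewrite fu => /affine_pt_inj Dt.
have A0u : (A 0).@[u 0] = t * (A 1).@[u 0].
  have [c nc Dc] := hcoord_vline Dx.
  have E B : B \is k.-homog -> ev B (pt nz) = c ^+ k * B.@[u 0].
    by move=> hB; rewrite evE; apply: (meval_homogZ hB) => a; rewrite Dc mxE.
  by rewrite Dt !E // -mulf_div divff ?expf_neq0 // mul1r divfK.
rewrite /ramification mevalB !mevalM A0u.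
apply: contraNneq => J0; rewrite /jac !mderivB !mderivZ mulrBr mulrBr -!scalerAr in J0.
move: J0; rewrite /jac !mevalB !mevalZ !mevalM => J0.
set a := meval _ (A 1); apply/eqP; rewrite -(mulr0 a) -[in RHS]J0; ring.
Qed.

(** s is a longest list of distinct points of the fibre: [fibre_size] makes it exist, and maximality
    makes it exhaust the fibre. *)
Lemma exists_fibre : exists t s, [/\ distinct_points s, (size s <= d)%N,
  (forall u : 'rV[K]_3, u \in s -> [/\ F.@[u 0] = 0, (A 0 - t *: A 1).@[u 0] = 0, (A 1).@[u 0] != 0 &
     exists i j l : 'I_3, [/\ i != j, i != l, j != l & (jac i j F (A 0 - t *: A 1)).@[u 0] != 0]]) &
  forall v : 'rV[K]_3, v != 0 -> F.@[v 0] = 0 ->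
    (exists2 u, u \in s & exists c, v = c *: u) \/ off_fibre F (A 0) (A 1) t v].
Proof.
have [t Ht] := exists_unramified_value.
pose fib (v : 'rV[K]_3) := F.@[v 0] = 0 /\ exists nz : v != 0, f (pt nz) = affine_pt t.
have fibP v : fib v -> [/\ F.@[v 0] = 0, (A 0).@[v 0] = t * (A 1).@[v 0], (A 1).@[v 0] != 0 &
     exists i j l : 'I_3, [/\ i != j, i != l, j != l & (jac i j F (A 0 - t *: A 1)).@[v 0] != 0]].
  move=> [Fv [nz fv]]; have [A1v HJ] := Ht v nz Fv fv; split=> //.
  have Cv := zeros_pt Fhom nz Fv; have Dx : val (pt nz) = <[v]>%VS by [].
  have A1x : ev (A 1) (pt nz) != 0 by rewrite (ev_vline_eq0 Dx (hA 1)).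
  have := f_affine Fhom Firr hA nzA fA Cv A1x; rewrite fv => /affine_pt_inj Dt.
  have [c nc Dc] := hcoord_vline Dx.
  have E B : B \is k.-homog -> ev B (pt nz) = c ^+ k * B.@[v 0].
    by move=> hB; rewrite evE; apply: (meval_homogZ hB) => a; rewrite Dc mxE.
  by rewrite Dt !E // -mulf_div divff ?expf_neq0 // mul1r divfK.
pose P n := exists s, [/\ distinct_points s, forall v, v \in s -> fib v & size s = n].
have [||n [s [ds fs ss]] maxs] := @max_nat_prop P d 0.
- by exists [::]; split.
- move=> n [s [ds fs <-]].
  apply: (@fibre_size _ d d F Fhom Firr f fsurj fdeg k A hA nzA fA t) => // u /fs /fibP[-> -> -> _] //.
have le : (size s <= d)%N.
  by apply: (@fibre_size _ d d F Fhom Firr f fsurj fdeg k A hA nzA fA t) => // u /fs /fibP[-> -> -> _].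
exists t, s; split=> //.
  by move=> u /fs /fibP[-> A0u -> HJ]; split=> //; rewrite mevalB mevalZ A0u subrr.
move=> v nz Fv; have [fv|nfv] := classic (fib v).
  left; apply: NNPP => nex.
  have [us nzs dd] := ds.
  have vs u : u \in s -> ~~ (v <= u)%MS.
    by move=> us'; apply/sub_rVP => -[c Dv]; apply: nex; exists u => //; exists c.
  have /maxs : P n.+1; last by rewrite ltnn.
  exists (v :: s); split; rewrite /= ?ss //.
  - split=> /=.
    + by rewrite us andbT; apply/negP => /vs; rewrite submx_refl.
    + by move=> u; rewrite inE => /orP[/eqP ->|/nzs].
    move=> u w; rewrite !inE => /orP[/eqP ->|us1] /orP[/eqP ->|ws1] uw.
    + by rewrite eqxx in uw.
    + exact: vs.
    + apply: contra (vs u us1) => /sub_rVP[c Du]; apply/sub_rVP; exists c^-1.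
      have nzc : c != 0 by apply: contraNneq (nzs u us1) => c0; rewrite Du c0 scale0r.
      by rewrite Du scalerA mulVf // scale1r.
    + exact: dd.
  by move=> u; rewrite inE => /orP[/eqP ->|/fs].
(* If B 0 - t B 1 vanished at v, f would take the value t there and v would be in the fibre. *)
right; have Cv := zeros_pt Fhom nz Fv; have [e [B [hB fx HQ]]] := fA Cv.
exists e, (B 0), (B 1); split=> //; apply/eqP => B0; apply: nfv; split=> //; exists nz.
apply: proj_space_eq; rewrite fx.
have Dx : val (pt nz) = <[v]>%VS by [].
have nzr := row_ev_neq0 fx.
have hBt : B 0 - t *: B 1 \is e.-homog by apply: rpredB => //; apply: rpredZ.
have : ev (B 0 - t *: B 1) (pt nz) = 0 by apply/eqP; rewrite (ev_vline_eq0 Dx hBt) B0.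
rewrite evE mevalB mevalZ => /eqP; rewrite subr_eq0 => /eqP E0.
have Dr : \row_j ev (B j) (pt nz) = ev (B 1) (pt nz) *: row2 t 1.
  by apply: row2P; rewrite !mxE /= ?mulr1 // mulrC.
rewrite Dr vlineZ //; apply: contraNneq nzr => b0.
by rewrite Dr b0 scale0r.
Qed.

(** If a M 0 + b M 1 were 0, F would divide the product of the equation of the line with a A 0 + b A
    1, both nonzero on the curve. *)
Lemma exists_linear_pencil : exists M : 'I_2 -> {mpoly K[3]}, [/\ forall j, M j \is 1.-homog,
  exists Q, cross A M = Q * F &
  forall a b, (a != 0) || (b != 0) -> a *: M 0 + b *: M 1 != 0].
Proof.
have [t [s [ds le Hs Hoff]]] := exists_fibre.
have gN : generic_form F (A 0 - t *: A 1).
  have := generic_comb Fhom Firr fsurj hA nzA fA (a := 1) (b := - t).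
  by rewrite oner_neq0 scale1r scaleNr => /(_ isT).
have nzN := nonzero_on_ndvd gN.2.
have sF u : u \in s -> F.@[u 0] = 0 by move=> /Hs[].
have sN u : u \in s -> (A 0 - t *: A 1).@[u 0] = 0 by move=> /Hs[].
have sA1 u : u \in s -> (A 1).@[u 0] != 0 by move=> /Hs[].
have sJ u : u \in s -> exists i j l : 'I_3, [/\ i != j, i != l, j != l &
  (jac i j F (A 0 - t *: A 1)).@[u 0] != 0] by move=> /Hs[].
have ss u : u \in s -> exists i : 'I_3, (F^`M(i)).@[u 0] != 0.
  move=> us; have [_ nz _] := ds; have nzu := nz u us.
  have [i ni] := smooth (zeros_pt Fhom nzu (sF u us)); exists i.
  by rewrite -(ev_vline_eq0 (erefl : val (pt nzu) = _) (mderiv_homog i Fhom)).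
have cb := fibre_cayley_bacharach Fhom Firr (hA 0) (hA 1) nzN sF sN sJ Hoff sA1 ds ss (ltnW (ltnW d4)).
have [|c nzc cs] := cayley_bacharach_line ds cb.
  by apply: (leq_trans le); clear -d4; lia.
have hN : A 0 - t *: A 1 \is k.-homog by apply: rpredB => //; apply: rpredZ.
have reg (j : 'I_2) : exists M, M \is 1.-homog /\ exists W, linform c * A j = (A 0 - t *: A 1) * M + W * F.
  have [|M [W [hM HM]]] := fibre_regular Fhom Firr (hA 0) (hA 1) nzN sF sN sJ Hoff (linform_homog c) cs (A := A j).
    by case: (ord2P j) => ->; [left|right].
  by exists M; split=> //; exists W.
have [M HM] := fin_all_exists reg.
have gl : generic_form F (linform c).
  by apply: (generic_linear Fhom Firr d1); rewrite ?linform_neq0 ?linform_homog.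
exists M; split; first by move=> j; case: (HM j).
  have [hM0 [W0 E0]] := HM 0; have [hM1 [W1 E1]] := HM 1.
  have hAM : cross A M \is (k + 1).-homog by apply: cross_homog => // j; case: (HM j).
  have [|//|//] := curve_prime Fhom Firr hN hAM.
  exists (A 1 * W0 - A 0 * W1); rewrite /cross.
  have -> : (A 0 - t *: A 1) * (A 0 * M 1 - A 1 * M 0) =
    A 0 * ((A 0 - t *: A 1) * M 1 + W1 * F) - A 1 * ((A 0 - t *: A 1) * M 0 + W0 * F)
    + (A 1 * W0 - A 0 * W1) * F by ring.
  by rewrite -E0 -E1; ring.
move=> a b ab; apply/eqP => M0.
have := generic_formM Fhom Firr gl (generic_comb Fhom Firr fsurj hA nzA fA ab).
case=> _ /nonzero_on_ndvd; apply.
have [_ [W0 E0]] := HM 0; have [_ [W1 E1]] := HM 1.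
exists (a *: W0 + b *: W1); move: (A 0 - t *: A 1) E0 E1 => D E0 E1.
rewrite mulrDr -!scalerAr E0 E1 !scalerDr -!mul_mpolyC.
have -> : a%:MP * (D * M 0) + a%:MP * (W0 * F) + (b%:MP * (D * M 1) + b%:MP * (W1 * F))
  = D * (a%:MP * M 0 + b%:MP * M 1) + (a%:MP * W0 + b%:MP * W1) * F by ring.
by rewrite -!mul_mpolyC in M0; rewrite M0 mulr0 add0r.
Qed.

End Pencil.

(** * The projection *)

Lemma homog1_meval (A : comNzRingType) n (P : {mpoly A[n]}) (v : 'rV[A]_n) :
  P \is 1.-homog -> P.@[v 0] = \sum_i v 0 i * P.@[(delta_mx 0 i : 'rV[A]_n) 0].
Proof.
move=> hP; have DP : P = \sum_i 'X_i * (P^`M(i)@_0)%:MP.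
  rewrite -[LHS](homog_euler hP); apply: eq_bigr => i _; congr (_ * _).
  exact/homog0_const/(mderiv_homog i hP).
have E w : P.@[w] = \sum_i w i * P^`M(i)@_0.
  by rewrite {1}DP raddf_sum; apply: eq_bigr => i _ /=; rewrite mevalM mevalXU mevalC.
rewrite E; apply: eq_bigr => i _; rewrite E (bigD1 i) //= mxE !eqxx mul1r big1 ?addr0 // => j ji.
by rewrite mxE (negPf ji) andbF mul0r.
Qed.

Section Coordinates.
Variables (K : closedFieldType) (n : nat) (e0 e1 p : 'rV[K]_n).
Implicit Types P : {mpoly K[n]}.

(** Inner variable: the slope s of a line through p; outer variable: the position t on that line.
    The coefficient of t^N is P(p), so the degree in t drops when P vanishes at p. *)
Definition coord_poly : {mpoly K[n]} -> {poly {poly K}} :=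
  mmap (polyC \o @polyC K) (fun a => (e0 0 a *: 'X + (e1 0 a)%:P)%:P + (p 0 a)%:P *: 'X).
HB.instance Definition _ := GRing.RMorphism.copy coord_poly
  (mmap (polyC \o @polyC K) (fun a => (e0 0 a *: 'X + (e1 0 a)%:P)%:P + (p 0 a)%:P *: 'X)).

Lemma coord_poly_horner P s t :
  (coord_poly P).[t%:P].[s] = P.@[(s *: e0 + e1 + t *: p) 0].
Proof.
elim/mpoly_alg_ind: P => [c|i|q r Hq Hr|q r Hq Hr].
- by rewrite /coord_poly mmapC mevalC /= !hornerC.
- rewrite /coord_poly mmapX mmap1U mevalXU !mxE !hornerE /=; ring.
- by rewrite !rmorphD /= !hornerD Hq Hr.
- by rewrite !rmorphM /= !hornerM Hq Hr.
Qed.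

Lemma coord_poly_size N P : P \is N.-homog -> P.@[p 0] = 0 -> (size (coord_poly P) <= N)%N.
Proof.
move=> hP Pp; have [] := mmap_line_top (@polyC K)
  (fun a => e0 0 a *: 'X + (e1 0 a)%:P) (fun a => (p 0 a)%:P) hP.
have -> : mmap (@polyC K) (fun a => (p 0 a)%:P) P = (P.@[p 0])%:P.
  elim/mpoly_alg_ind: (P) => [c|i|q r Hq Hr|q r Hq Hr].
  - by rewrite mmapC mevalC.
  - by rewrite mmapX mmap1U mevalXU.
  - by rewrite !rmorphD /= Hq Hr.
  - by rewrite !rmorphM /= Hq Hr.
rewrite Pp; rewrite leq_eqVlt => /orP[/eqP sz lead0|//].
have : lead_coef (coord_poly P) = 0 by rewrite lead_coefE sz.
by move/eqP; rewrite lead_coef_eq0 => /eqP ->; rewrite size_poly0.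
Qed.

End Coordinates.

(* If p lies on the curve, then y has degree less than d over K(x), where x is
   the slope of the lines through p. *)
Lemma projection_relation (K : closedFieldType) n m (F : {mpoly K[n]}) (e0 e1 p : 'rV[K]_n)
    (G : 'I_m.+1 -> {mpoly K[n]}) :
  (0 < size (coord_poly e0 e1 p F) <= m.+1)%N ->
  exists2 a : 'I_m.+1 -> {poly K}, exists i, a i != 0 & forall s t,
    F.@[(s *: e0 + e1 + t *: p) 0] = 0 ->
    \sum_i (a i).[s] * (G i).@[(s *: e0 + e1 + t *: p) 0] = 0.
Proof.
pose h := coord_poly e0 e1 p; rewrite -/h => /andP[sF0 sF].
have nzF : h F != 0 by rewrite -size_poly_gt0.
(* The pseudo-remainders r i have at most m coefficients, so these m + 1 polynomials are dependent
   over K[s]; c i is the factor introduced by pseudo-division. *)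
pose r i := h (G i) %% h F; pose c i := lead_coef (h F) ^+ scalp (h (G i)) (h F).
have [b bM [i0 bi0]] := kernel_nonzero_at (\matrix_(i < m.+1, j < m) (r i)`_j) (0 : K).
exists (fun i => b 0 i * c i).
  exists i0; rewrite mulf_neq0 ?expf_neq0 ?lead_coef_eq0 //.
  by apply: contraNneq bi0 => ->; rewrite horner0.
move=> s t Fst.
have sum0 : \sum_i b 0 i *: r i = 0.
  apply/polyP => j; rewrite coef_sum coef0; have [lt|ge] := ltnP j m.
    have := congr1 (fun M : 'rV_m => M 0 (Ordinal lt)) bM; rewrite !mxE => E0.
    by rewrite -[RHS]E0; apply: eq_bigr => i _; rewrite coefZ mxE.
  apply: big1 => i _; rewrite coefZ [X in _ * X]nth_default ?mulr0 //.
  have := ltn_modp (h (G i)) (h F); rewrite nzF => lt.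
  by rewrite (leq_trans _ ge) // -ltnS (leq_trans lt).
have H : \sum_i (b 0 i * c i) *: h (G i) = (\sum_i b 0 i *: (h (G i) %/ h F)) * h F.
  rewrite mulr_suml -[RHS]addr0 -[X in _ + X]sum0 -big_split; apply: eq_bigr => i _ /=.
  by rewrite -[LHS]scalerA /c Pdiv.WeakIdomain.divp_eq scalerDr scalerAl.
have := congr1 (fun q => q.[t%:P].[s]) H; rewrite hornerM hornerM coord_poly_horner Fst mulr0.
rewrite !horner_sum => E; rewrite -[RHS]E; apply: eq_bigr => i _.
by rewrite hornerZ [RHS]hornerM coord_poly_horner.
Qed.

Section Projection.
Variables (K : closedFieldType) (d : nat) (F : {mpoly K[3]}).
Hypotheses (Fhom : F \is d.-homog) (Firr : irreducible_mpoly F).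
Hypotheses (charK : [pchar K] =i pred0) (d4 : (4 < d)%N).
Hypothesis smooth : forall x : proj_space K 2, x \in zeros F -> exists i : 'I_3, ev (F^`M(i)) x != 0.
Variable f : proj_space K 2 -> proj_space K 1.
Hypothesis fmor : morphism_on (zeros F) f.
Hypothesis fsurj : forall q, exists2 x, x \in zeros F & f x = q.
Hypothesis fdeg : has_degree (zeros F) predT f d.

Lemma projection_matrix : exists L : 'M[K]_(3, 2), row_full L /\
  forall x, x \in zeros F -> hcoord x *m L != 0 -> val (f x) = <[hcoord x *m L]>%VS.
Proof.
have [k [A [hA nzA fA]]] := morphism_global Fhom Firr fmor fsurj.
have [M [hM AM indep]] := exists_linear_pencil charK Fhom Firr d4 smooth fsurj fdeg hA nzA fA.
pose L : 'M[K]_(3, 2) := \matrix_(i, j) (M j).@[(delta_mx 0 i : 'rV[K]_3) 0].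
have ML v : v *m L = \row_j (M j).@[v 0].
  apply/rowP => j; rewrite !mxE (homog1_meval v (hM j)).
  by apply: eq_bigr => i _; rewrite mxE.
exists L; split; last first.
  move=> x Cx; rewrite ML => nz; apply: (morphism_eval Fhom Firr hA nzA fA hM AM Cx nz).
rewrite /row_full -mxrank_tr -/(row_free L^T) -kermx_eq0; apply/rowV0P => v /sub_kermxP vL.
apply/eqP; apply: contraT => nzv.
have : (v 0 0 != 0) || (v 0 1 != 0).
  apply: contraNT nzv; rewrite negb_or !negbK => /andP[/eqP v0 /eqP v1].
  by apply/eqP/row2P; rewrite mxE.
move/indep/eqP; case; apply: mpoly_ext_row => w; rewrite meval0.
have E : (v *m (w *m L)^T) 0 0 = 0 by rewrite trmx_mul mulmxA vL mul0mx mxE.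
rewrite -[RHS]E mevalD !mevalZ ML mxE !big_ord_recl big_ord0 addr0 !mxE.
by congr (_ * _ + v 0 _ * (M _).@[_]); apply: val_inj.
Qed.

Variable L : 'M[K]_(3, 2).
Hypothesis Lfull : row_full L.
Hypothesis fL : forall x, x \in zeros F -> hcoord x *m L != 0 -> val (f x) = <[hcoord x *m L]>%VS.

Lemma projection_center : exists p : 'rV[K]_3, [/\ p != 0, p *m L = 0 &
  forall v, v *m L = 0 -> exists c, v = c *: p].
Proof.
have rk : \rank (kermx L) = 1%N by rewrite mxrank_ker (eqP Lfull).
have /rowV0Pn[p pk nzp] : kermx L != 0 by rewrite -mxrank_eq0 rk.
exists p; split=> //; first exact/sub_kermxP.
move=> v /sub_kermxP vk; apply/sub_rVP; apply: submx_trans vk _.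
by rewrite -(geq_leqif (mxrank_leqif_sup pk)) rk rank_rV nzp.
Qed.

(** If p is on the curve, [projection_relation] with m = d - 1 gives a relation over K(f) between
    any d functions. For a basis u of d elements it contradicts independence. *)
Lemma projection_center_notin (p : 'rV[K]_3) : p != 0 -> p *m L = 0 ->
  (forall v, v *m L = 0 -> exists c, v = c *: p) -> F.@[p 0] != 0.
Proof.
move=> nzp pL kerL; apply/negP => /eqP Fp.
have [e eL] := row_fullP Lfull.
pose e0 := row 0 e; pose e1 := row 1 e.
(* As e is a section of L, v and v L e differ by a multiple of p. The slope is the ratio of the
   coordinates of v L, which on the curve is the affine value of f. *)
have decomp v : (v *m L) 0 1 != 0 -> exists t,
    v = (v *m L) 0 1 *: (((v *m L) 0 0 / (v *m L) 0 1) *: e0 + e1 + t *: p).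
  move=> nz; have [|c Dc] := kerL (v - v *m L *m e).
    by rewrite mulmxBl -[v *m L *m e *m L]mulmxA eL mulmx1 subrr.
  exists (c / (v *m L) 0 1); rewrite !scalerDr !scalerA mulrC divfK // [_ * (c / _)]mulrC divfK //.
  rewrite -Dc; have -> : v *m L *m e = (v *m L) 0 0 *: e0 + (v *m L) 0 1 *: e1.
    have E1 : lift ord0 ord0 = 1 :> 'I_2 by apply: val_inj.
    by rewrite [LHS]mulmx_sum_row !big_ord_recl big_ord0 addr0 E1.
  by rewrite addrC subrK.
have sF : (0 < size (coord_poly e0 e1 p F) <= d.-1.+1)%N.
  rewrite (ltn_predK d4) (coord_poly_size e0 e1 Fhom Fp) andbT size_poly_gt0.
  apply/eqP => F0; case/eqP: (irr_neq0 Firr).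
  (* Multiplying F by the equation of the line where [decomp] fails leaves only points at which F is
     read off [coord_poly]. *)
  have nzl : linform (col 1 L) != 0.
    apply: contraTneq isT => l0; have := linform_col L 1 e1.
    by rewrite l0 meval0 -row_mul eL !mxE => /eqP; rewrite eq_sym oner_eq0.
  apply: (mulfI nzl); rewrite mulr0; apply: mpoly_ext_row => v; rewrite meval0 mevalM linform_col.
  have [->|nz] := eqVneq ((v *m L) 0 1) 0; first by rewrite mul0r.
  have [t Dv] := decomp v nz.
  set s := _ / _ in Dv; set w := _ + t *: p in Dv.
  have -> : F.@[v 0] = (v *m L) 0 1 ^+ d * F.@[w 0].
    by apply: (meval_homogZ Fhom) => i; rewrite {1}Dv mxE.
  by rewrite /w -coord_poly_horner F0 !horner0 !mulr0.
have := fdeg; rewrite -(ltn_predK d4) => -[u [ru indep _]].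
have /fin_all_exists[ks Hks] i := ru i.
have /fin_all_exists[G HG] i := Hks i.
have /fin_all_exists[H HH] i := HG i.
have hG i : G i \is (ks i).-homog by case: (HH i).
have hH i : H i \is (ks i).-homog by case: (HH i).
have /fin_all_exists2[T gT HT] i := generically_form (let: And3 _ _ g := HH i in g).
have gH i : generic_form F (H i).
  split; first by exists (ks i).
  have [x Cx nx] := generic_form_ev Fhom (gT i).
  by have [nHx _] := HT i x Cx nx; apply: (nonzero_on_ev (hH i) Cx nHx).
have d1 : (1 < d)%N by apply: leq_trans d4.
pose l := linform (col 1 L).
have gl : generic_form F l.
  apply: (generic_linear Fhom Firr d1); last exact: linform_homog.
  apply: contraTneq isT => l0; have := linform_col L 1 e1.
  by rewrite -/l l0 meval0 -row_mul eL !mxE => /eqP; rewrite eq_sym oner_eq0.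
(* Numerators of the u i over the common denominator, the product of all H j; they are forms of one
   and the same degree. *)
pose G' i := G i * \prod_(j | j != i) H j.
have hG' i : G' i \is (\sum_j ks j).-homog.
  rewrite (bigD1 i) //=; apply: dhomogM => //.
  elim/big_ind2: _ => [|? ? ? ? ? ?|j _]; [exact: dhomog1|exact: dhomogM|exact: hH].
have [a [i0 nzi0] rel] := projection_relation G' sF.
(* The coefficient a i as a rational function on P^1; its default value at infinity is excluded by
   the generic conditions. *)
pose alpha i (y : proj_space K 1) := (a i).[hcoord y 0 0 / hcoord y 0 1].
have ralpha i : rational_on predT (alpha i).
  exists (size (a i)), (phom (size (a i)) (a i) 'X_0 'X_1), ('X_1 ^+ size (a i)); split.
  - by rewrite -[X in X.-homog]mul1n; apply: phom_homog; apply: homogX.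
  - by rewrite -[X in X.-homog]mul1n; apply/dhomogMn/homogX.
  exists 1%N, 'X_1; split; first exact: homogX.
    exists (affine_pt 0) => //.
    by rewrite (affine_pt_ev 0 (homogX _ _)) mevalXU !mxE /= oner_neq0.
  move=> y _ ny; have nyn : ev ('X_1 ^+ size (a i)) y != 0 by rewrite evE rmorphXn expf_neq0.
  split=> //; rewrite [X in _ = X / _]evE phom_meval //.
  by rewrite [X in _ / X]evE rmorphXn /= [RHS]mulrC mulKf ?expf_neq0 // !mevalXU.
have comb0 : generically (zeros F) (fun x => \sum_i alpha i (f x) * u i x = 0).
  have exg : exists Q, generic_form F Q by exists l.
  apply: (form_generically Fhom (generic_formM Fhom Firr (generic_formM Fhom Firr
    (generic_form_prod Fhom Firr exg gT) (generic_form_prod Fhom Firr exg gH)) gl)).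
  move=> x Cx; rewrite !evM !ev_prod !mulf_eq0 !negb_or => /andP[/andP[/prodf_neq0 Tx Hx] lx].
  set v := hcoord x; have vL : (v *m L) 0 1 != 0 by rewrite -linform_col.
  have nzvL : v *m L != 0 by apply: contraNneq vL => ->; rewrite mxE.
  have [c nzc Dc] := hcoord_vline (fL Cx nzvL).
  have [t Dv] := decomp v vL; set s := _ / _ in Dv; set w := _ + t *: p in Dv.
  have Dcj j : hcoord (f x) 0 j = c * (v *m L) 0 j by rewrite Dc mxE.
  have Ds : hcoord (f x) 0 0 / hcoord (f x) 0 1 = s by rewrite !Dcj -mulf_div divff // mul1r.
  have scale D (P : {mpoly K[3]}) : P \is D.-homog -> P.@[v 0] = (v *m L) 0 1 ^+ D * P.@[w 0].
    by move=> hP; apply: (meval_homogZ hP) => i; rewrite {1}Dv mxE.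
  have Fw : F.@[w 0] = 0.
    move: Cx; rewrite zerosE -/v (scale _ _ Fhom) mulf_eq0 expf_eq0 (negPf vL) andbF /=.
    by move/eqP.
  have E := rel _ _ Fw.
  transitivity ((\prod_i ev (H i) x)^-1 * ((v *m L) 0 1 ^+ (\sum_j ks j) * \sum_i (a i).[s] * (G' i).@[w 0])); last first.
    by rewrite E !mulr0.
  rewrite !mulr_sumr; apply: eq_bigr => i _.
  have [nHx ->] := HT i x Cx (Tx i isT).
  rewrite /alpha Ds [X in _ = _ * X]mulrCA -(scale _ _ (hG' i)) [RHS]mulrCA; congr (_ * _).
  have -> : (G' i).@[v 0] = ev (G i) x * \prod_(j | j != i) ev (H j) x.
    by rewrite /G' mevalM rmorph_prod.
  rewrite (bigD1 i) //= invfM; have nzP : \prod_(j | j != i) ev (H j) x != 0.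
    by move: Hx; rewrite (bigD1 i) //= mulf_eq0 negb_or => /andP[].
  by rewrite mulrACA mulVf // mulr1 mulrC.
have /generically_affine[h nzh Hh] := indep alpha ralpha comb0 i0.
have [t] := closed_nonrootP _ (mulf_neq0 nzh nzi0); rewrite rootM negb_or => /andP[ht /negP]; apply.
have := Hh t ht; rewrite /alpha; have [c nzc ->] := hcoord_vline (erefl : val (affine_pt t) = _).
by rewrite !mxE /= mulr1 mulrC mulKf // => /eqP.
Qed.

Lemma projection_identification : exists2 p : proj_space K 2, p \notin zeros F
    & exists2 theta : {vspace 'rV[K]_3} -> proj_space K 1, pencil_identification p theta
        & forall x, x \in zeros F -> f x = theta (linear_projection p x).
Proof.
have [p [nzp pL kerL]] := projection_center.
have Fp := projection_center_notin nzp pL kerL.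
pose l : 'Hom('rV[K]_3, 'rV[K]_2) := linfun (mulmxr L).
have lE v : l v = v *m L by rewrite lfunE.
have kl : lker l = <[p]>%VS.
  apply/vspaceP => v; rewrite memv_ker lE; apply/eqP/vlineP => [/kerL //|[c ->]].
  by rewrite -scalemxAl pL scaler0.
(* The default [affine_pt 0] serves when l maps M to something else than a line; on the pencil this
   does not occur, as M has dimension 2 and contains the kernel p. *)
pose theta (M : {vspace 'rV[K]_3}) : proj_space K 1 :=
  insubd (affine_pt 0 : {U : {vspace 'rV[K]_2} | \dim U == 1%N}) (l @: M)%VS.
have thetaE M : \dim (l @: M) == 1%N -> val (theta M) = (l @: M)%VS.
  by move=> dM; rewrite /theta val_insubd dM.
exists (pt nzp).
  by rewrite zerosE -evE (ev_vline_eq0 (erefl : val (pt nzp) = _) Fhom).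
exists theta.
  exists l => // M /andP[/eqP dM pM]; apply: thetaE.
  have := limg_ker_dim l M; rewrite dM kl (capv_idPr pM) dim_vline nzp => /eqP.
  by rewrite add1n eqSS.
move=> x Cx; apply: proj_space_eq; rewrite /linear_projection.
(* The kernel of L is p, which is off the curve, so the linear pair has no base point on it. *)
have nzx : hcoord x *m L != 0.
  apply/eqP => /kerL[c Dx]; case/negP: Fp; move: Cx; rewrite zerosE.
  rewrite (@meval_homogZ _ _ _ _ c (p 0) _ Fhom) => [|i]; last by rewrite Dx mxE.
  rewrite mulf_eq0 expf_eq0 => /orP[/andP[_ /eqP c0]|//].
  by have := hcoord_neq0 x; rewrite Dx c0 scale0r eqxx.
have Dl : (l @: (val (pt nzp) + val x) = <[hcoord x *m L]>)%VS.
  by rewrite (hcoordK x) limgD !limg_line !lE pL -[<[0]>%VS]/(0%VS) add0v.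
by rewrite thetaE Dl ?dim_vline ?nzx // (fL Cx nzx).
Qed.

End Projection.

Theorem theorem1p1 (R : realType) (d : nat) (F : {mpoly R[i][3]})
    (f : proj_space R[i] 2 -> proj_space R[i] 1) :
  (4 < d)%N ->
  smooth_plane_curve d F ->
  meromorphic_function (zeros F) d f ->
  exists2 p : proj_space R[i] 2,
    p \notin zeros F
    & exists2 theta : {vspace 'rV[R[i]]_3} -> proj_space R[i] 1,
        pencil_identification p theta
        & forall x, x \in zeros F -> f x = theta (linear_projection p x).
Proof.
move=> d4 [Fhom Firr smooth] [fmor fsurj fdeg].
have charK : [pchar R[i]] =i pred0 := @Num.Theory.pchar_num R[i].
have [L [Lfull fL]] := projection_matrix Fhom Firr charK d4 smooth fmor fsurj fdeg.
exact: (projection_identification Fhom Firr d4 fdeg Lfull fL).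
Qed.
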